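(* Let $\alpha\in(0,2]$, $a\ge0$, $\mu,\rho>0$. Let $f\in L^{c}(\mathbb{R})$ be such that $(\mathcal{D}_x^{\alpha})^{j}f\in L^{c}(\mathbb{R})$ for every $j=0,1,2,\dots$ and such that the series defining $\mathcal{P}_{1/\rho,x}^{\alpha}f$ converges uniformly. Then the solution to the initial-value problem $$\partial_t u(x,t)=\left[a\,\mathcal{D}_x^{\alpha}+\mu\,\mathcal{P}_{1/\rho,x}^{\alpha}\right]u(x,t),\qquad u(x,0)=f(x),\qquad x\in\mathbb{R},\ t>0,$$ coincides with the semigroup $\mathcal{T}_t^{\mathcal{X}}f(x)=\mathbb{E}f[x-\mathcal{X}_\alpha(t)]$ of the subordinated process $$\mathcal{X}_\alpha(t)=\mathcal{S}_\alpha(at+\Gamma(t)),\qquad t\ge0,$$ where $\mathcal{S}_\alpha(t)$, $t\ge0$, is the symmetric $\alpha$-stable process and $\Gamma(t)$, $t\ge0$, is an independent gamma subordinator with parameters $\mu,\rho$.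
   Context: Fourier transform: $\mathcal{F}\{f(x);\xi\}=\widetilde f(\xi)=\int_{-\infty}^{+\infty}e^{ix\xi}f(x)\,dx$. $L^{c}(\mathcal{I})$ denotes the space of functions whose Riemann improper integral on the open interval $\mathcal{I}$ converges absolutely. The Riesz derivative $\mathcal{D}_x^{\alpha}$, $\alpha\in(0,2]$, is defined by $\mathcal{F}\{\mathcal{D}_x^{\alpha}f(x);\xi\}=-|\xi|^{\alpha}\widetilde f(\xi)$. The fractional logarithmic operator is, for $c>0$ and $\alpha\in(0,2]$, $$\mathcal{P}_{c,x}^{\alpha}f(x)=\sum_{n=1}^{\infty}\frac{c^n}{n}(\mathcal{D}_x^{\alpha})^{n}f(x),$$ where $(\mathcal{D}_x^{\alpha})^{n}$ is the $n$-fold iteration; it is defined for $f\in L^c(\mathbb{R})$ with all $(\mathcal{D}_x^{\alpha})^{j}f\in L^c(\mathbb{R})$, provided that the series converges uniformly. $\mathcal{S}_\alpha(t)$, $t\ge0$, is the symmetric $\alpha$-stable Lévy process with $\mathbb{E}e^{i\xi\mathcal{S}_\alpha(t)}=e^{-t|\xi|^{\alpha}}$. The gamma subordinator $\Gamma(t)$ with parameters $\mu,\rho>0$ has density $f_\Gamma(x,t)=\frac{\rho^{\mu t}}{\Gamma(\mu t)}x^{\mu t-1}e^{-\rho x}$ for $x\ge0$ and $0$ for $x<0$. *)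

(* Defs.v *)
From HB Require Import structures.
From mathcomp Require Import all_boot all_order all_algebra.
From mathcomp Require Import all_classical all_reals all_analysis.
From mathcomp Require Import complex.
Set Implicit Arguments.
Unset Strict Implicit.
Unset Printing Implicit Defensive.
Import Order.TTheory GRing.Theory Num.Theory.
Import numFieldNormedType.Exports.
Local Open Scope classical_set_scope.
Local Open Scope complex_scope.
Local Open Scope ring_scope.

Section RieszDerivative.
Context {R : realType}.
Implicit Types f g u : R -> R.
Local Notation mu := (@lebesgue_measure R).

(* Darboux form of the Riemann integral for a <= b: [m] and [M] bound [f] on
   the cells [x i, x i.+1], so that the two sums are below (resp. above) the
   lower (resp. upper) Darboux sum of the partition. *)
Definition is_riemann_integral f (a b I : R) : Prop :=
  forall e : R, 0 < e ->
  exists (n : nat) (x m M : nat -> R),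
    [/\ x 0%N = a, x n = b,
        (forall i, (i < n)%N -> x i <= x i.+1 /\
           forall y, x i <= y <= x i.+1 -> m i <= f y <= M i),
        I - e < \sum_(i < n) m i * (x i.+1 - x i)
      & \sum_(i < n) M i * (x i.+1 - x i) < I + e].

Definition is_improper_riemann_integral f (I : R) : Prop :=
  exists J : R -> R -> R,
    (forall a b, a <= b -> is_riemann_integral f a b (J a b)) /\
    J p.1 p.2 @[p --> filter_prod (ninfty_nbhs R) (pinfty_nbhs R)] --> I.

Definition Lc f : Prop :=
  (forall a b, a <= b -> exists I, is_riemann_integral f a b I) /\
  exists I, is_improper_riemann_integral (fun x => `|f x|) I.

(* The integrals are Lebesgue integrals; for [f] in [Lc] they coincide with the
   improper Riemann integrals. *)
Definition fourier f (xi : R) : R[i] :=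
  (\int[mu]_x (cos (x * xi) * f x)) +i* (\int[mu]_x (sin (x * xi) * f x)).

Definition is_riesz_derivative (alpha : R) f g : Prop :=
  [/\ Lc f, Lc g &
      forall xi, fourier g xi = - (`|xi| `^ alpha)%:C * fourier f xi].

(* [Df n] is the n-fold iterate of the Riesz derivative on [f]. A Fourier
   transform determines a function only up to a null set; the iterates with
   n >= 1 are taken to be the continuous representatives. When all the iterates
   are in [Lc] this is no restriction: every |xi|^(n alpha) * fourier f xi is
   then bounded, so each iterate agrees a.e. with a continuous function. *)
Definition riesz_iterates (alpha : R) f (Df : nat -> R -> R) : Prop :=
  [/\ Df 0%N = f,
      forall n, is_riesz_derivative alpha (Df n) (Df n.+1)
    & forall n, continuous (Df n.+1)].

Definition frac_log_sum (c : R) (Df : nat -> R -> R) (N : nat) (x : R) : R :=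
  \sum_(1 <= n < N.+1) c ^+ n / n%:R * Df n x.

Definition is_frac_log (c : R) (Df : nat -> R -> R) (Pf : R -> R) : Prop :=
  {uniform, (frac_log_sum c Df) @ \oo --> Pf}.

(* A classical solution, with [u x t] the value at position x and time t. Each
   u(., t) is in the domain of both operators, and t |-> u(., t) is continuous
   from [0, +oo[ to L^1. As [f] need not be continuous, continuity in x is only
   required at positive times. *)
Definition is_solution (alpha a m rho : R) f (u : R -> R -> R) : Prop :=
  [/\ forall x, u x 0 = f x,
      forall t, 0 <= t -> Lc (u ^~ t),
      forall t, 0 < t -> continuous (u ^~ t),
      forall s, 0 <= s ->
        (\int[mu]_x (`|u x t - u x s|%R)%:E)%E
          @[t --> within [set t | 0 <= t] (nbhs s)] --> 0%E
    & forall t, 0 < t -> exists (Du : nat -> R -> R) (Pu : R -> R),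
        [/\ riesz_iterates alpha (u ^~ t) Du,
            is_frac_log rho^-1 Du Pu
          & forall x, is_derive t 1 (u x) (a * Du 1%N x + m * Pu x)]].

Definition gamma_fun (z : R) : R :=
  \int[mu]_(x in `]0, +oo[) (x `^ (z - 1) * expR (- x)).

Definition gamma_density (m rho t x : R) : R :=
  if 0 <= x
  then rho `^ (m * t) / gamma_fun (m * t) * x `^ (m * t - 1) * expR (- rho * x)
  else 0.

End RieszDerivative.

(* Processes indexed by R, of which only the times t >= 0 matter. *)
Section Processes.
Context {d : measure_display} {Omega : measurableType d} {R : realType}.
Variable P : probability Omega R.
Implicit Types X Y : R -> {RV P >-> R}.

Definition independent_increments X : Prop :=
  forall (n : nat) (s : nat -> R) (B : nat -> set R),
    0 <= s 0%N -> (forall i, (i < n)%N -> s i <= s i.+1) ->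
    (forall i, measurable (B i)) ->
    P (\bigcap_(i in `I_n) [set w | B i (X (s i.+1) w - X (s i) w)]) =
    (\prod_(i < n) P [set w | B i (X (s i.+1) w - X (s i) w)%R])%E.

Definition stationary_increments X : Prop :=
  forall (s t : R) (B : set R), 0 <= s -> 0 <= t -> measurable B ->
    P [set w | B (X (s + t) w - X s w)] = P (X t @^-1` B).

Definition cadlag (p : R -> R) : Prop :=
  forall t, 0 <= t ->
    p s @[s --> t^'+] --> p t /\ (0 < t -> cvg (p s @[s --> t^'-])).

Definition levy_process X : Prop :=
  [/\ {ae P, forall w, X 0 w = 0},
      independent_increments X,
      stationary_increments X
    & {ae P, forall w, cadlag (X ^~ w)}].

Definition symmetric_stable_process (alpha : R) X : Prop :=
  levy_process X /\
  forall t xi, 0 <= t ->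
    fine 'E_P[fun w => cos (xi * X t w)] +i*
    fine 'E_P[fun w => sin (xi * X t w)] =
    (expR (- t * `|xi| `^ alpha))%:C.

Definition gamma_subordinator (m rho : R) X : Prop :=
  [/\ levy_process X,
      {ae P, forall w, forall s t, 0 <= s -> s <= t -> X s w <= X t w}
    & forall t, 0 < t -> forall B : set R, measurable B ->
        distribution P (X t) B =
        (\int[lebesgue_measure]_(x in B) (gamma_density m rho t x)%:E)%E].

Definition process_sigma_algebra X : set (set Omega) :=
  <<s [set A | exists (t : R) (B : set R),
               [/\ 0 <= t, measurable B & A = X t @^-1` B]] >>.

Definition independent_processes X Y : Prop :=
  forall A B, process_sigma_algebra X A -> process_sigma_algebra Y B ->
    P (A `&` B) = (P A * P B)%E.

Definition subordinated (a : R) (S Gam : R -> {RV P >-> R}) (t : R)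
    (w : Omega) : R :=
  S (a * t + Gam t w) w.

Definition semigroup (X : R -> Omega -> R) (f : R -> R) (x t : R) : R :=
  fine 'E_P[fun w => f (x - X t w)].

End Processes.

(* Main.v *)
From HB Require Import structures.
Require Import Defs.
From mathcomp Require Import all_boot all_order all_algebra.
From mathcomp Require Import all_classical all_reals all_analysis.
From mathcomp Require Import complex measurable_realfun ring lra.
Set Implicit Arguments.
Unset Strict Implicit.
Unset Printing Implicit Defensive.
Import Order.TTheory GRing.Theory Num.Theory.
Import numFieldNormedType.Exports.
Local Open Scope classical_set_scope.
Local Open Scope ring_scope.

(** Why the theorem holds. On the Fourier side the operator [a D + mu P] is
    multiplication by [psi xi = - (a |xi|^alpha + mu ln (1 + |xi|^alpha / rho))],
    because the logarithmic series sums to [- ln (1 + |xi|^alpha / rho)]; and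
    [exp (t psi xi)] is the characteristic function of the subordinated process,
    as conditioning on the clock gives [E exp (- (a t + Gamma(t)) |xi|^alpha)]
    and the Laplace transform of the gamma law is a power of [1 + s / rho]. All
    of this is done with real cosine and sine transforms ([fcos], [fsin]);
    [synth c s m] is the function whose spectrum on the positive frequencies is
    [(m * c, m * s)], and [average Y h x] is the mean of [h (x - Y)].

    Band limitation makes the formal computation rigorous. Uniform convergence of
    the logarithmic series forces [|D^n f| <= n rho^n] for large [n], and by
    Parseval's identity this is only possible if the spectrum of [f] vanishes
    where [|xi|^alpha > rho] ([iter_band_limit]). On the band the symbols are
    bounded, so that both operators, and the semigroup, become bounded spectral
    multipliers with compact support ([spectral_representation]). A member of
    [Lc] is continuous almost everywhere and Fourier inversion recovers it at its
    points of continuity ([Lc_borel], [fourier_inversion]).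

    Existence. Averaging over the translates by the process multiplies spectra by
    its characteristic function ([average_synth], [subordinated_law]); this gives
    the equation in time, and also the Riesz derivatives of the semigroup, which
    are averages of those of [f]. At a positive time [f] may be replaced by its
    continuous version under the expectation because the law of the process
    charges no null set ([clock_null]). Continuity in mean follows from uniform
    convergence, since averaging is a contraction in mean ([orbit_L1_start]).

    Uniqueness. Given a solution [u], the mean of [u (y - X (T - t), t)] has
    derivative zero in [t]: the rate of change of [u] cancels that of the
    semigroup. It equals [u (y, T)] at [t = T] and the value of the semigroup at
    [t = 0] ([evolution_unique]). As all the spectra live on one bounded band,
    continuity in mean of [u] makes its rate of change continuous in time
    uniformly in space, so that the cancellation survives the averaging. *)

(** * Integrals: almost everywhere equality, domination, Fubini, translations *)

Section IntegralAlmostEverywhere.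
Context {d : measure_display} {T : measurableType d} {R : realType}.
Variable m : {measure set T -> \bar R}.
Local Open Scope ereal_scope.
Import HBNNSimple.

Lemma nnintegral_ae_le (f g : T -> \bar R) :
  (forall x, 0 <= f x) -> (forall x, 0 <= g x) ->
  {ae m, forall x, f x = g x} -> \int[m]_x f x <= \int[m]_x g x.
Proof.
move=> f0 g0 [N [mN N0 subN]]; rewrite !ge0_integralTE//.
apply: ge_ereal_sup => _ [h hf <-].
pose h' := mul_nnsfun h (indic_nnsfun R (measurableC mN)).
apply: le_ereal_sup_tmp; exists (sintegral m h').
  exists h' => // x; rewrite /h' /= /indic_nnsfun /= mindicE.
  have [xN|xN] := boolP (x \in ~` N); last by rewrite mulr0.
  rewrite mulr1 -(_ : f x = g x) ?hf//.
  by apply: contrapT => fg; move/set_mem: xN; apply; exact: subN.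
rewrite -!integralT_nnsfun le_eqVlt; apply/orP; left; apply/eqP.
apply: ge0_ae_eq_integral => //; try exact/measurable_EFinP.
- by move=> x _; rewrite lee_fin.
- by move=> x _; rewrite lee_fin.
exists N; split => // x /= /not_implyP[_] xh; apply: contrapT => xN; apply: xh.
by rewrite /= mindicE mem_set ?mulr1.
Qed.

(** Neither function has to be measurable: the integral of a nonnegative
    function is a supremum over simple functions, and these can be cut to the
    complement of a null set. This matters for the members of [Lc], which are
    Riemann integrable but possibly not Borel. *)
Lemma integral_ae_eqT (f g : T -> \bar R) :
  {ae m, forall x, f x = g x} -> \int[m]_x f x = \int[m]_x g x.
Proof.
move=> fg.
have gf : {ae m, forall x, g x = f x} by apply: filterS fg.
rewrite integralE [RHS]integralE; congr (_ - _); apply/eqP;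
  rewrite eq_le; apply/andP; split; apply: nnintegral_ae_le => //;
  by [apply: filterS fg => x xx; rewrite /= !(funeposE,funenegE) xx
     |apply: filterS gf => x xx; rewrite /= !(funeposE,funenegE) xx].
Qed.

End IntegralAlmostEverywhere.

Notation L1 m f := (m.-integrable setT (EFin \o f)).

Section RealIntegrals.
Context {d : measure_display} {T : measurableType d} {R : realType}.
Variable m : {measure set T -> \bar R}.
Implicit Types f g : T -> R.

Lemma aeS (A B : T -> Prop) :
  (forall x, A x -> B x) -> {ae m, forall x, A x} -> {ae m, forall x, B x}.
Proof. by move=> AB; apply: filterS. Qed.

Lemma aeI (A B : T -> Prop) : {ae m, forall x, A x} -> {ae m, forall x, B x} ->
  {ae m, forall x, A x /\ B x}.
Proof. by move=> *; exact: filterI. Qed.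

Lemma Rintegral_ae_eq f g :
  {ae m, forall x, f x = g x} -> \int[m]_x f x = \int[m]_x g x.
Proof.
move=> fg; congr fine; apply: integral_ae_eqT.
by apply: filterS fg => x ->.
Qed.

Lemma L1_measurable f : L1 m f -> measurable_fun setT f.
Proof. by move=> /measurable_int/measurable_EFinP. Qed.

Lemma L1_le f g : measurable_fun setT f -> L1 m g ->
  (forall x, `|f x| <= g x) -> L1 m f.
Proof.
move=> mf ig fg; apply: (le_integrable measurableT _ _ ig).
  exact/measurable_EFinP.
by move=> x _ /=; rewrite lee_fin (le_trans (fg x))// ler_norm.
Qed.

Lemma L1_ext f g : f =1 g -> L1 m f -> L1 m g.
Proof. by move=> /funext ->. Qed.

Lemma L1D f g : L1 m f -> L1 m g -> L1 m (fun x => f x + g x).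
Proof. by move=> ? ?; apply: (integrableD measurableT (f := EFin \o f) (g := EFin \o g)). Qed.

Lemma L1B f g : L1 m f -> L1 m g -> L1 m (fun x => f x - g x).
Proof. by move=> ? ?; apply: (integrableB measurableT (f := EFin \o f) (g := EFin \o g)). Qed.

Lemma L1Z c f : L1 m f -> L1 m (fun x => c * f x).
Proof. by move=> ?; apply: (@integrableZl _ _ _ m _ measurableT c (EFin \o f)). Qed.

Lemma L1_norm f : L1 m f -> L1 m (fun x => `|f x|).
Proof. exact: integrable_norm. Qed.

Lemma L1M_bounded f (h : T -> R) C : measurable_fun setT h ->
  (forall x, `|h x| <= C) -> L1 m f -> L1 m (fun x => h x * f x).
Proof.
move=> mh hC lf; apply: (@L1_le _ (fun x => C * `|f x|)).
- by apply: measurable_funM => //; exact: L1_measurable.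
- exact/L1Z/L1_norm.
- by move=> x; rewrite normrM ler_wpM2r.
Qed.

Lemma EFin_Rintegral f : L1 m f -> (\int[m]_x f x)%:E = (\int[m]_x (f x)%:E)%E.
Proof. by move=> lf; rewrite /Rintegral fineK//; exact: integrable_fin_num. Qed.

Lemma Rintegral_norm_le f C : L1 m f ->
  \int[m]_x `|f x| <= C -> `|\int[m]_x f x| <= C.
Proof. by move=> lf; apply: le_trans; exact: le_normr_Rintegral. Qed.

Lemma Rintegral_le_dom f g : measurable_fun setT f -> L1 m g ->
  (forall x, `|f x| <= g x) -> `|\int[m]_x f x| <= \int[m]_x g x.
Proof.
move=> mf lg fg; have lf := L1_le mf lg fg; apply: Rintegral_norm_le => //.
by apply: le_Rintegral => //; exact: L1_norm.
Qed.

Lemma Rintegral_dominated (f_ : nat -> T -> R) f g :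
  (forall n, measurable_fun setT (f_ n)) -> measurable_fun setT f ->
  {ae m, forall x, f_ ^~ x @ \oo --> f x} -> L1 m g ->
  {ae m, forall x n, `|f_ n x| <= g x} ->
  \int[m]_x f_ n x @[n --> \oo] --> \int[m]_x f x.
Proof.
move=> mf_ mf ff lg fg.
have [] := @dominated_convergence _ T R m setT measurableT
  (fun n => EFin \o f_ n) (EFin \o f) (EFin \o g).
- by move=> n; exact/measurable_EFinP.
- exact/measurable_EFinP.
- apply: filterS ff => x fx _ /=; apply: cvg_EFin => //.
  exact: nearW.
- exact: lg.
- by apply: filterS fg => x fx n _ /=; rewrite lee_fin.
move=> lf _ H; apply: fine_cvg => /=.
by rewrite fineK; [exact: H|exact: integrable_fin_num].
Qed.

End RealIntegrals.

Section FubiniReal.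
Context {d1 d2 : measure_display} {T1 : measurableType d1}
  {T2 : measurableType d2} {R : realType}.
Variables (m1 : {sigma_finite_measure set T1 -> \bar R})
  (m2 : {sigma_finite_measure set T2 -> \bar R}).

Lemma Rintegral_Fubini (F : T1 -> T2 -> R) :
  L1 (m1 \x m2)%E (fun z => F z.1 z.2) ->
  (forall x, L1 m2 (F x)) -> (forall y, L1 m1 (F ^~ y)) ->
  [/\ L1 m1 (fun x => \int[m2]_y F x y), L1 m2 (fun y => \int[m1]_x F x y) &
   \int[m1]_x \int[m2]_y F x y = \int[m2]_y \int[m1]_x F x y].
Proof.
move=> iF F1 F2.
have E1 : (fun x => (\int[m2]_y F x y)%:E) = (fubini_F m2 (fun z => (F z.1 z.2)%:E)).
  by apply/funext => x; rewrite EFin_Rintegral.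
have E2 : (fun y => (\int[m1]_x F x y)%:E) = (fubini_G m1 (fun z => (F z.1 z.2)%:E)).
  by apply/funext => x; rewrite EFin_Rintegral.
split.
- by rewrite /comp E1; exact: (integrable_fubini_F iF).
- rewrite /comp E2; apply/integrableP; split.
    exact: (measurable_fubini_G iF).
  have mF := measurable_int _ iF.
  apply: le_lt_trans ((integrable21ltyP m1 m2 mF).1 iF).
  apply: ge0_le_integral => //.
  + by apply: measurableT_comp => //; exact: (measurable_fubini_G iF).
  + apply: (measurable_fun_fubini_tonelli_G (fun z => `|F z.1 z.2|%:E)).
      by apply/measurable_EFinP; apply: measurableT_comp => //; exact/measurable_EFinP.
    by move=> z; rewrite lee_fin.
  + move=> y _; apply: le_abse_integral => //.
    exact: measurable_int (F2 y).
rewrite /Rintegral; congr fine.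
transitivity (\int[m1]_x fubini_F m2 (fun z => (F z.1 z.2)%:E) x)%E.
  by apply: eq_integral => x _; rewrite -E1.
rewrite [LHS](Fubini iF).
by apply: eq_integral => y _; rewrite -[RHS]/((fun y => (\int[m1]_x F x y)%:E) y) E2.
Qed.

Lemma measurable_slice1 (F : T1 -> T2 -> R) x :
  measurable_fun setT (fun z : T1 * T2 => F z.1 z.2) ->
  measurable_fun setT (F x).
Proof.
move=> mF; apply: (measurableT_comp (f := fun z : T1 * T2 => F z.1 z.2)
  (g := fun y => (x, y))) => //; exact: pair1_measurable.
Qed.

Lemma measurable_slice2 (F : T1 -> T2 -> R) y :
  measurable_fun setT (fun z : T1 * T2 => F z.1 z.2) ->
  measurable_fun setT (F ^~ y).
Proof.
move=> mF; apply: (measurableT_comp (f := fun z : T1 * T2 => F z.1 z.2)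
  (g := fun x => (x, y))) => //; exact: pair2_measurable.
Qed.

Lemma L1_prod (F : T1 -> T2 -> R) (g1 : T1 -> R) (g2 : T2 -> R) :
  measurable_fun setT (fun z : T1 * T2 => F z.1 z.2) ->
  L1 m1 g1 -> L1 m2 g2 -> (forall x y, `|F x y| <= g1 x * g2 y) ->
  L1 (m1 \x m2)%E (fun z => F z.1 z.2).
Proof.
move=> mF l1 l2 Fg.
have nn x : L1 m2 (fun y => `|g1 x * g2 y|) by exact/L1_norm/L1Z.
apply/integrable12ltyP; first exact/measurable_EFinP.
have E x : (\int[m2]_y `|g1 x * g2 y|%:E = (`|g1 x| * \int[m2]_y `|g2 y|)%:E)%E.
  rewrite -EFin_Rintegral//; congr EFin.
  under eq_Rintegral do rewrite normrM.
  by rewrite RintegralZl//; exact: L1_norm.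
apply: (@le_lt_trans _ _ (\int[m1]_x (`|g1 x| * \int[m2]_y `|g2 y|)%:E)%E).
  apply: ge0_le_integral => //.
  - by move=> x _; apply: integral_ge0 => y _; rewrite lee_fin.
  - apply: (measurable_fun_fubini_tonelli_F (fun z => `|F z.1 z.2|%:E)).
      by apply/measurable_EFinP; apply: measurableT_comp.
    by move=> z; rewrite lee_fin.
  - apply/measurable_EFinP/measurable_funM => //.
    by apply: measurableT_comp => //; exact: L1_measurable l1.
  move=> x _; rewrite -E; apply: ge0_le_integral => //.
  - by apply/measurable_EFinP/measurableT_comp => //; exact: measurable_slice1.
  - by apply/measurable_EFinP; exact: L1_measurable (nn x).
  - by move=> y _; rewrite /= lee_fin (le_trans (Fg x y))// ler_norm.
have : L1 m1 (fun x => (\int[m2]_y `|g2 y|) * `|g1 x|) by exact/L1Z/L1_norm.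
move=> /integrable_lty => /(_ measurableT); apply: le_lt_trans.
by apply: ge0_le_integral => //=;
  try (by move=> *; rewrite lee_fin ?mulr_ge0 ?Rintegral_ge0// mulrC);
  apply/measurable_EFinP/measurable_funM => //;
  apply: measurableT_comp => //; exact: L1_measurable l1.
Qed.

(** The form in which the two theorems of Fubini and Tonelli are applied: the
    integrand is dominated by a product of two integrable functions. *)
Lemma Fubini_dominated (F : T1 -> T2 -> R) (g1 : T1 -> R) (g2 : T2 -> R) :
  measurable_fun setT (fun z : T1 * T2 => F z.1 z.2) ->
  L1 m1 g1 -> L1 m2 g2 -> (forall x y, `|F x y| <= g1 x * g2 y) ->
  [/\ L1 m1 (fun x => \int[m2]_y F x y), L1 m2 (fun y => \int[m1]_x F x y) &
   \int[m1]_x \int[m2]_y F x y = \int[m2]_y \int[m1]_x F x y].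
Proof.
move=> mF l1 l2 Fg; apply: Rintegral_Fubini.
- exact: L1_prod l1 l2 Fg.
- move=> x; apply: (@L1_le _ _ _ _ _ (fun y => g1 x * g2 y)).
  + exact: measurable_slice1.
  + exact: L1Z.
  + exact: Fg.
- move=> y; apply: (@L1_le _ _ _ _ _ (fun x => g2 y * g1 x)).
  + exact: (measurable_slice2 _ mF).
  + exact: L1Z.
  + by move=> x; rewrite mulrC; exact: Fg.
Qed.

End FubiniReal.

Section LebesgueAffine.
Context {R : realType}.
Local Notation mu := (@lebesgue_measure R).

(* Lebesgue measure lives on a copy of the real line whose Borel structure is
   convertible, but not syntactically equal, to the one of [R]. *)
Lemma L1_measurableR (f : R -> R) : L1 mu f -> measurable_fun setT f.
Proof. by move=> lf; have := L1_measurable lf. Qed.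

Lemma measurable_affine (c b : R) : measurable_fun setT (fun x : R => c * x + b).
Proof. by apply: measurable_funD => //; exact: measurable_funM. Qed.

Local Open Scope ereal_scope.

Lemma lebesgue_affine_itv (c b x y : R) : (0 < c)%R ->
  mu ((fun z : R => (c * z + b)%R) @^-1` `]x, y]%classic) =
  mu `]((x - b) / c)%R, ((y - b) / c)%R]%classic.
Proof.
move=> c0; congr (mu _); apply/seteqP; split => z /=; rewrite !in_itv/=;
by rewrite ltr_pdivrMr// ler_pdivlMr// ltrBlDr lerBrDr mulrC.
Qed.

(** The image of Lebesgue measure under an increasing affine map is a multiple
    of Lebesgue measure, since the two agree on half-open intervals. *)
Lemma ge0_integral_affine (c b : R) (f : R -> \bar R) : (0 < c)%R ->
  measurable_fun setT f -> (forall x, 0 <= f x) ->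
  \int[mu]_x f x = c%:E * \int[mu]_x f (c * x + b)%R.
Proof.
move=> c0 mf f0.
have c0' : (0 <= c)%R by exact: ltW.
pose phi : measurableTypeR R -> measurableTypeR R := fun x => (c * x + b)%R.
have mphi : measurable_fun setT phi by exact: (measurable_affine c b).
pose pm : {measure set (measurableTypeR R) -> \bar R} :=
  @measure_function_pushforward__canonical__measure_function_Measure
    _ _ _ _ _ mu phi mphi.
pose nu : {measure set (measurableTypeR R) -> \bar R} := mscale (NngNum c0') pm.
transitivity (\int[nu]_x f x).
  apply: eq_measure_integral => A mA _.
  apply: (@lebesgue_measure_unique R nu _ A mA) => _ [[x y] _ <-].
  rewrite /nu /= /mscale/= /pushforward/= lebesgue_affine_itv//.
  rewrite !lebesgue_measure_itv/=.
  rewrite !lte_fin ltr_pM2r ?invr_gt0// ltrD2r.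
  case: ifPn => xy; last by rewrite mule0.
  rewrite -!EFinB -EFinM; congr EFin; field.
  by rewrite gt_eqF.
rewrite ge0_integral_mscale//=; congr (_ * _).
by rewrite ge0_integral_pushforward//= preimage_setT.
Qed.

Lemma ge0_integral_shift (b : R) (f : R -> \bar R) :
  measurable_fun setT f -> (forall x, 0 <= f x) ->
  \int[mu]_x f (x + b)%R = \int[mu]_x f x.
Proof.
move=> mf f0; rewrite [RHS](@ge0_integral_affine 1%R b)//; rewrite mul1e.
by under [RHS]eq_integral do rewrite mul1r.
Qed.

Local Close Scope ereal_scope.

Lemma measurable_shift (f : R -> R) b :
  measurable_fun setT f -> measurable_fun setT (fun x : R => f (x + b)).
Proof.
move=> mf; apply: (measurableT_comp (f := f) (g := fun x : R => x + b)) => //.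
exact: measurable_funD.
Qed.

Lemma L1_shift (f : R -> R) b : L1 mu f -> L1 mu (fun x : R => f (x + b)).
Proof.
move=> lf; have mf := L1_measurableR lf.
move: lf => /integrableP[_ fi]; apply/integrableP; split.
  by apply/measurable_EFinP; exact: (measurable_shift b mf).
rewrite /= (ge0_integral_shift b (f := fun x => `|f x|%:E))//.
by apply/measurable_EFinP; exact: measurableT_comp.
Qed.

Lemma Rintegral_shift (f : R -> R) b :
  L1 mu f -> \int[mu]_x f (x + b) = \int[mu]_x f x.
Proof.
move=> lf; have mf := L1_measurableR lf.
have mf' : measurable_fun setT (fun x => (f x)%:E) by exact/measurable_EFinP.
rewrite /Rintegral integralE [in RHS]integralE.
congr (fine (_ - _)).
  rewrite -[RHS](ge0_integral_shift b)//.
    by apply: eq_integral => x _; rewrite !funeposE.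
  by move: (measurable_funepos mf').
rewrite -[RHS](ge0_integral_shift b)//.
  by apply: eq_integral => x _; rewrite !funenegE.
by move: (measurable_funeneg mf').
Qed.

End LebesgueAffine.

(** * The Poisson kernel *)

Section PoissonKernel.
Context {R : realType}.
Local Notation mu := (@lebesgue_measure R).
Implicit Types e x y z xi : R.

(** The function [exp (- e xi)] cut to the half-line of positive frequencies,
    whose cosine transform is the Poisson kernel. *)
Definition exp_half e xi : R := \1_(`[0, +oo[%classic : set R) xi * expR (- (e * xi)).

Definition poisson e z : R := e / (e ^+ 2 + z ^+ 2).

Lemma measurable_cos_mul z : measurable_fun setT (fun xi : R => cos (z * xi)).
Proof.
apply: continuous_measurable_fun => xi.
apply: continuous_comp; last exact: continuous_cos.
by apply: cvgM; [exact: cvg_cst|exact: cvg_id].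
Qed.

Lemma measurable_sin_mul z : measurable_fun setT (fun xi : R => sin (z * xi)).
Proof.
apply: continuous_measurable_fun => xi.
apply: continuous_comp; last exact: continuous_sin.
by apply: cvgM; [exact: cvg_cst|exact: cvg_id].
Qed.

Lemma cos_le1_norm x : `|cos x| <= 1.
Proof. by rewrite ler_norml cos_geN1 cos_le1. Qed.

Lemma sin_le1_norm x : `|sin x| <= 1.
Proof. by rewrite ler_norml sin_geN1 sin_le1. Qed.

Lemma measurable_exp_half e : measurable_fun setT (exp_half e).
Proof.
apply: measurable_funM; first exact: measurable_indic.
apply: continuous_measurable_fun => xi.
apply: continuous_comp; last exact: continuous_expR.
apply: continuousN; apply: cvgM; [exact: cvg_cst|exact: cvg_id].
Qed.

Lemma exp_half_ge0 e xi : 0 <= exp_half e xi.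
Proof. by rewrite mulr_ge0 ?expR_ge0// indicE ler0n. Qed.

Let prim e z xi : R :=
  expR (- (e * xi)) * ((z * sin (z * xi) - e * cos (z * xi)) / (e ^+ 2 + z ^+ 2)).

Let is_derive_prim e z xi : 0 < e ->
  is_derive xi 1 (prim e z) (expR (- (e * xi)) * cos (z * xi)).
Proof.
move=> e0.
have e2 : e ^+ 2 + z ^+ 2 != 0 by rewrite gt_eqF// ltr_pwDl ?exprn_gt0// sqr_ge0.
rewrite /prim; apply: is_derive_eq.
rewrite /GRing.scale/=; field => //.
Qed.

Let prim_cvg e z : 0 < e -> prim e z xi @[xi --> +oo] --> (0 : R).
Proof.
move=> e0.
have e2 : 0 < e ^+ 2 + z ^+ 2 by rewrite ltr_pwDl ?exprn_gt0// sqr_ge0.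
pose C : R := (`|z| + e) / (e ^+ 2 + z ^+ 2).
have hE : C * expR (- (e * xi)) @[xi --> +oo] --> (0 : R).
  rewrite -(mulr0 C); apply: cvgM; first exact: cvg_cst.
  apply: (@cvg_comp _ _ _ (fun xi => e * xi) (fun y => expR (- y)) _ (pinfty_nbhs R)).
    exact: gt0_cvgMry.
  exact: cvgr_expR.
have hN : - (C * expR (- (e * xi))) @[xi --> +oo] --> (0 : R).
  by rewrite -oppr0; apply: cvgN.
apply: (squeeze_cvgr _ hN hE).
near=> xi; rewrite -ler_norml /prim normrM ger0_norm ?expR_ge0// mulrC ler_wpM2r ?expR_ge0//.
rewrite normrM normfV (gtr0_norm e2) ler_wpM2r ?invr_ge0 ?(ltW e2)//.
rewrite (le_trans (ler_normB _ _))// !normrM (gtr0_norm e0) lerD//.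
  by rewrite ler_piMr// sin_le1_norm.
by rewrite ler_piMr ?(ltW e0)// cos_le1_norm.
Unshelve. all: by end_near. Qed.

Let prim0 e z : prim e z 0 = - poisson e z.
Proof. by rewrite /prim /poisson !mulr0 oppr0 expR0 sin0 cos0; ring. Qed.

Lemma continuous_exp_mul e : continuous (fun xi : R => expR (- (e * xi))).
Proof.
move=> xi; apply: continuous_comp; last exact: continuous_expR.
apply: continuousN; apply: cvgM; [exact: cvg_cst|exact: cvg_id].
Qed.

Let integral_exp_half1cos e z : 0 < e ->
  (\int[mu]_(xi in `[0%R, +oo[) (expR (- (e * xi)) * (1 + cos (z * xi)))%:E =
   (poisson e 0 + poisson e z)%:E)%E.
Proof.
move=> e0.
have D xi : is_derive xi 1 (fun t => prim e 0 t + prim e z t)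
    (expR (- (e * xi)) * (1 + cos (z * xi))).
  have d0 := is_derive_prim 0 xi e0.
  have d1 := is_derive_prim z xi e0.
  apply: is_derive_eq.
  by rewrite mul0r cos0 mulr1 mulrDr mulr1.
rewrite (@ge0_continuous_FTC2y R _ (fun t => prim e 0 t + prim e z t) 0 0).
- by rewrite !prim0 -EFinB; congr EFin; ring.
- move=> xi _; rewrite mulr_ge0 ?expR_ge0// -lerBlDl sub0r.
- apply: continuous_subspaceT => xi; apply: cvgM; first exact: continuous_exp_mul.
  apply: cvgD; first exact: cvg_cst.
  apply: continuous_comp; last exact: continuous_cos.
  by apply: cvgM; [exact: cvg_cst|exact: cvg_id].
- by rewrite -[X in _ --> X](addr0 0); apply: cvgD; exact: prim_cvg.
- by move=> xi _; exact: (@ex_derive _ _ _ _ _ _ _ (D xi)).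
- apply: cvg_at_right_filter.
  have /derivable1_diffP/differentiable_continuous := @ex_derive _ _ _ _ _ _ _ (D 0).
  exact.
- by move=> xi _; rewrite derive1E; exact: (@derive_val _ _ _ _ _ _ _ (D xi)).
Qed.

Lemma exp_halfE e : exp_half e = (fun xi => expR (- (e * xi))) \_ `[0, +oo[.
Proof.
apply/funext => xi; rewrite /exp_half patchE indicE.
by case: ifP => _; rewrite ?mul1r ?mul0r.
Qed.

Let integral_exp_halfE e z : 0 < e ->
  (\int[mu]_xi (exp_half e xi * (1 + cos (z * xi)))%:E =
   (poisson e 0 + poisson e z)%:E)%E.
Proof.
move=> e0; rewrite -integral_exp_half1cos// [RHS]integral_mkcond.
apply: eq_integral => xi _; rewrite exp_halfE !patchE.
by case: ifP; rewrite ?mul0r.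
Qed.

Lemma L1_exp_half e : 0 < e -> L1 mu (exp_half e).
Proof.
move=> e0; apply/integrableP; split.
  by apply/measurable_EFinP; exact: measurable_exp_half.
have := integral_exp_halfE 0 e0.
under eq_integral do rewrite mul0r cos0.
move=> H; apply: (@le_lt_trans _ _ (poisson e 0 + poisson e 0)%:E); last by rewrite ltry.
rewrite -H; apply: ge0_le_integral => //.
- apply/measurable_EFinP; apply: measurableT_comp => //.
  exact: measurable_exp_half.
- apply/measurable_EFinP; apply: measurable_funM => //.
  exact: measurable_exp_half.
move=> xi _; rewrite /= lee_fin ger0_norm ?exp_half_ge0//.
by have := exp_half_ge0 e xi; lra.
Qed.

Lemma Rintegral_exp_half e : 0 < e -> \int[mu]_xi exp_half e xi = poisson e 0.
Proof.
move=> e0; have := integral_exp_halfE 0 e0.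
have -> : (\int[mu]_xi (exp_half e xi * (1 + cos (0 * xi)))%:E =
    (2 * \int[mu]_xi exp_half e xi)%:E)%E.
  rewrite -RintegralZl//; last exact: L1_exp_half.
  rewrite EFin_Rintegral; last by apply: L1Z; exact: L1_exp_half.
  by apply: eq_integral => xi _; rewrite mul0r cos0 mulrC.
by move=> []; lra.
Qed.

(** The Poisson kernel is the cosine transform of the exponential: the
    integrand is nonnegative after adding the constant 1 to the cosine, so that
    the fundamental theorem of calculus applies on the half-line. *)
Lemma Rintegral_exp_half_cos e z : 0 < e ->
  \int[mu]_xi (exp_half e xi * cos (z * xi)) = poisson e z.
Proof.
move=> e0; have := integral_exp_halfE z e0.
have l0 := L1_exp_half e0.
have l1 : L1 mu (fun xi => exp_half e xi * cos (z * xi)).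
  apply: (@L1_ext _ _ _ mu (fun xi => cos (z * xi) * exp_half e xi)).
    by move=> xi; rewrite mulrC.
  apply: (@L1M_bounded _ _ _ mu _ _ 1) => //.
    exact: measurable_cos_mul.
  by move=> xi; exact: cos_le1_norm.
rewrite -EFin_Rintegral; last first.
  by apply: L1_ext (L1D l0 l1) => xi; rewrite mulrDr mulr1.
have -> : \int[mu]_xi (exp_half e xi * (1 + cos (z * xi))) =
    \int[mu]_xi (exp_half e xi + exp_half e xi * cos (z * xi)).
  by apply: eq_Rintegral => xi _; rewrite mulrDr mulr1.
rewrite RintegralD// Rintegral_exp_half// => -[] /eqP.
by rewrite (inj_eq (addrI _)) => /eqP.
Qed.

Lemma poisson_ge0 e z : 0 < e -> 0 <= poisson e z.
Proof. by move=> e0; rewrite divr_ge0 ?(ltW e0)// addr_ge0 ?sqr_ge0. Qed.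

Lemma poissonN e z : poisson e (- z) = poisson e z.
Proof. by rewrite /poisson sqrrN. Qed.

Lemma continuous_poisson e : 0 < e -> continuous (poisson e).
Proof.
move=> e0 z; apply: cvgM; first exact: cvg_cst.
apply: cvgV; first by rewrite gt_eqF// ltr_pwDl ?exprn_gt0// sqr_ge0.
by apply: cvgD; [exact: cvg_cst|exact: exprn_continuous].
Qed.

Let integral_poissonE e : 0 < e -> (\int[mu]_z (poisson e z)%:E = pi%:E)%E.
Proof.
move=> e0.
rewrite ge0_symfun_integralT; last 3 first.
- by move=> z; exact: poisson_ge0.
- exact: continuous_poisson.
- by move=> z; rewrite /= poissonN.
have D z : is_derive z 1 (fun t => atan (t / e)) (poisson e z).
  apply: is_derive_eq; rewrite /GRing.scale/= /poisson; field.
  by rewrite !gt_eqF// ltr_pwDl ?exprn_gt0// sqr_ge0.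
rewrite -set_itvcy (@ge0_continuous_FTC2y R _ (fun t => atan (t / e)) 0 (pi / 2)).
- by rewrite mul0r atan0 oppe0 adde0 -EFinM; congr EFin; field.
- by move=> z _; exact: poisson_ge0.
- by apply: continuous_subspaceT => z; exact: continuous_poisson.
- apply: (@cvg_comp _ _ _ (fun t => t / e) atan _ (pinfty_nbhs R)); last exact: cvgy_atan.
  apply: (@cvg_trans _ (e^-1 * t @[t --> +oo])).
    by apply: near_eq_cvg; near=> t; rewrite mulrC.
  by apply: gt0_cvgMry; rewrite ?invr_gt0.
- by move=> z _; exact: (@ex_derive _ _ _ _ _ _ _ (D z)).
- apply: cvg_at_right_filter.
  have /derivable1_diffP/differentiable_continuous := @ex_derive _ _ _ _ _ _ _ (D 0).
  exact.
- by move=> z _; rewrite derive1E; exact: (@derive_val _ _ _ _ _ _ _ (D z)).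
Unshelve. all: by end_near. Qed.

Lemma measurable_poisson e : 0 < e -> measurable_fun setT (poisson e).
Proof. by move=> e0; apply: continuous_measurable_fun; exact: continuous_poisson. Qed.

Lemma L1_poisson e : 0 < e -> L1 mu (poisson e).
Proof.
move=> e0; apply/integrableP; split.
  by apply/measurable_EFinP; exact: measurable_poisson.
under eq_integral do rewrite /= ger0_norm ?poisson_ge0//.
by rewrite integral_poissonE// ltry.
Qed.

Lemma Rintegral_poisson e : 0 < e -> \int[mu]_z poisson e z = pi.
Proof. by move=> e0; rewrite /Rintegral integral_poissonE. Qed.

End PoissonKernel.

(** * Fourier inversion *)

Section Spectrum.
Context {R : realType}.
Local Notation mu := (@lebesgue_measure R).
Implicit Types f g : R -> R.

Lemma normM3_le (a b c : R) : 0 <= a -> `|b| <= 1 -> `|a * (b * c)| <= a * `|c|.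
Proof. by move=> a0 b1; rewrite !normrM (ger0_norm a0) ler_wpM2l// ler_piMl. Qed.

Definition fcos f (xi : R) : R := \int[mu]_x (cos (x * xi) * f x).
Definition fsin f (xi : R) : R := \int[mu]_x (sin (x * xi) * f x).

(** The real part of [exp (- i x xi)] times the Fourier transform of [f],
    written with an arbitrary pair of cosine and sine transforms. *)
Definition wave (c s : R -> R) (x xi : R) : R := cos (x * xi) * c xi + sin (x * xi) * s xi.

Lemma measurable_cos_mulr z : measurable_fun setT (fun x : R => cos (x * z)).
Proof. by under eq_fun do rewrite mulrC; exact: measurable_cos_mul. Qed.

Lemma measurable_sin_mulr z : measurable_fun setT (fun x : R => sin (x * z)).
Proof. by under eq_fun do rewrite mulrC; exact: measurable_sin_mul. Qed.

Lemma L1_cosM f z : L1 mu f -> L1 mu (fun x => cos (x * z) * f x).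
Proof.
move=> lf; apply: (@L1M_bounded _ _ _ mu _ _ 1) => //.
  exact: measurable_cos_mulr.
by move=> x; exact: cos_le1_norm.
Qed.

Lemma L1_sinM f z : L1 mu f -> L1 mu (fun x => sin (x * z) * f x).
Proof.
move=> lf; apply: (@L1M_bounded _ _ _ mu _ _ 1) => //.
  exact: measurable_sin_mulr.
by move=> x; exact: sin_le1_norm.
Qed.

Lemma wave_conv f x xi : L1 mu f ->
  wave (fcos f) (fsin f) x xi = \int[mu]_y (cos ((x - y) * xi) * f y).
Proof.
move=> lf; rewrite /wave /fcos /fsin.
rewrite -RintegralZl//; last exact: L1_cosM.
rewrite -RintegralZl//; last exact: L1_sinM.
rewrite -RintegralD//; last 2 first.
- by apply: L1Z; exact: L1_cosM.
- by apply: L1Z; exact: L1_sinM.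
by apply: eq_Rintegral => y _; rewrite mulrBl cosB; ring.
Qed.

Lemma fcos_le f xi : L1 mu f -> `|fcos f xi| <= \int[mu]_x `|f x|.
Proof.
move=> lf; apply: Rintegral_le_dom; last 2 first.
- exact: L1_norm.
- by move=> x; rewrite normrM ler_piMl// cos_le1_norm.
by have := L1_measurable (L1_cosM xi lf).
Qed.

Lemma fsin_le f xi : L1 mu f -> `|fsin f xi| <= \int[mu]_x `|f x|.
Proof.
move=> lf; apply: Rintegral_le_dom; last 2 first.
- exact: L1_norm.
- by move=> x; rewrite normrM ler_piMl// sin_le1_norm.
by have := L1_measurable (L1_sinM xi lf).
Qed.

Lemma wave_le c s x xi : `|wave c s x xi| <= `|c xi| + `|s xi|.
Proof.
rewrite (le_trans (ler_normD _ _))// !normrM lerD// ler_piMl//.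
  exact: cos_le1_norm.
exact: sin_le1_norm.
Qed.

Section Joint.
Context {d : measure_display} {T : measurableType d}.

Lemma measurable_cos_comp (h : T -> R) : measurable_fun setT h ->
  measurable_fun setT (fun z => cos (h z)).
Proof.
move=> mh; apply: (measurableT_comp (f := cos)) => //.
exact: continuous_measurable_fun (@continuous_cos R).
Qed.

Lemma measurable_sin_comp (h : T -> R) : measurable_fun setT h ->
  measurable_fun setT (fun z => sin (h z)).
Proof.
move=> mh; apply: (measurableT_comp (f := sin)) => //.
exact: continuous_measurable_fun (@continuous_sin R).
Qed.

End Joint.

Lemma measurable_fstR : measurable_fun setT (fun z : measurableTypeR R * measurableTypeR R => (z.1 : R)).
Proof. by move: (@measurable_fst _ _ (measurableTypeR R) (measurableTypeR R)). Qed.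

Lemma measurable_sndR : measurable_fun setT (fun z : measurableTypeR R * measurableTypeR R => (z.2 : R)).
Proof. by move: (@measurable_snd _ _ (measurableTypeR R) (measurableTypeR R)). Qed.

Lemma measurable_comp_fst f : measurable_fun setT f ->
  measurable_fun setT (fun z : measurableTypeR R * measurableTypeR R => f z.1).
Proof. by move=> mf; exact: (measurableT_comp mf measurable_fstR). Qed.

Lemma measurable_comp_snd f : measurable_fun setT f ->
  measurable_fun setT (fun z : measurableTypeR R * measurableTypeR R => f z.2).
Proof. by move=> mf; exact: (measurableT_comp mf measurable_sndR). Qed.

(** The Poisson kernel in [xi] only serves to make the integrand integrable on
    the plane, so that Fubini's theorem yields the measurability. *)
Lemma measurable_transform (k f : R -> R) : measurable_fun setT k ->
  (forall y, `|k y| <= 1) -> L1 mu f ->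
  measurable_fun setT (fun xi : R => \int[mu]_x (k (x * xi) * f x)).
Proof.
move=> mk k1 lf; have mf := L1_measurableR lf.
have [] := @Fubini_dominated _ _ _ _ R mu mu
  (fun xi x => poisson 1 xi * (k (x * xi) * f x)) (poisson 1) (fun x => `|f x|).
- apply: measurable_funM; first exact: (measurable_comp_fst (measurable_poisson ltr01)).
  apply: measurable_funM; last exact: measurable_comp_snd.
  by apply: (measurableT_comp mk); exact: measurable_funM.
- exact: L1_poisson.
- exact: L1_norm.
- by move=> xi x; apply: normM3_le; [exact: poisson_ge0|exact: k1].
move=> /L1_measurableR H _ _.
have -> : (fun xi : R => \int[mu]_x (k (x * xi) * f x)) =
    (fun xi => (1 + xi ^+ 2) * (\int[mu]_x (poisson 1 xi * (k (x * xi) * f x)))).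
  apply/funext => xi; rewrite RintegralZl//; last first.
    apply: (@L1M_bounded _ _ _ mu _ _ 1) => //.
    have : measurable_fun setT (fun x : R => k (x * xi)); last by [].
    by apply: (measurableT_comp mk); apply: measurable_funM => //; exact: measurable_cst.
  rewrite mulrA /poisson expr1n div1r mulfV ?mul1r//.
  by rewrite gt_eqF// ltr_pwDl// sqr_ge0.
apply: measurable_funM => //; apply: measurable_funD => //.
Qed.

Lemma measurable_fcos f : L1 mu f -> measurable_fun setT (fcos f).
Proof.
apply: measurable_transform => [|y]; last exact: cos_le1_norm.
exact: continuous_measurable_fun (@continuous_cos R).
Qed.

Lemma measurable_fsin f : L1 mu f -> measurable_fun setT (fsin f).
Proof.
apply: measurable_transform => [|y]; last exact: sin_le1_norm.
exact: continuous_measurable_fun (@continuous_sin R).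
Qed.

Lemma measurable_wave c s x : measurable_fun setT c -> measurable_fun setT s ->
  measurable_fun setT (wave c s x).
Proof.
move=> mc ms; apply: measurable_funD; apply: measurable_funM => //.
  exact: measurable_cos_mul.
exact: measurable_sin_mul.
Qed.

(** Fubini's theorem turns the summation of the Fourier integral with factor
    [exp (- e xi)] into a convolution with the Poisson kernel. *)
Lemma abel_poisson f x e : L1 mu f -> 0 < e ->
  \int[mu]_xi (exp_half e xi * wave (fcos f) (fsin f) x xi) =
  \int[mu]_y (poisson e (y - x) * f y).
Proof.
move=> lf e0; have mf := L1_measurableR lf.
have [] := @Fubini_dominated _ _ _ _ R mu mu
  (fun xi y => exp_half e xi * (cos ((x - y) * xi) * f y)) (exp_half e) (fun y => `|f y|).
- apply: measurable_funM; first exact: (measurable_comp_fst (measurable_exp_half e)).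
  apply: measurable_funM; last exact: measurable_comp_snd.
  apply: measurable_cos_comp; apply: measurable_funM => //.
  exact: measurable_funB.
- exact: L1_exp_half.
- exact: L1_norm.
- by move=> xi y; apply: normM3_le; [exact: exp_half_ge0|exact: cos_le1_norm].
move=> _ _ H.
transitivity (\int[mu]_xi \int[mu]_y (exp_half e xi * (cos ((x - y) * xi) * f y))).
  apply: eq_Rintegral => xi _; rewrite wave_conv// -RintegralZl//.
  apply: (@L1M_bounded _ _ _ mu _ _ 1) => //.
    apply: measurable_cos_comp.
    by apply: measurable_funM => //; exact: measurable_funB.
  by move=> y; exact: cos_le1_norm.
rewrite H; apply: eq_Rintegral => y _.
have -> : poisson e (y - x) = poisson e (x - y) by rewrite -poissonN opprB.
rewrite -(Rintegral_exp_half_cos _ e0).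
transitivity (\int[mu]_xi (exp_half e xi * cos ((x - y) * xi) * f y)).
  by apply: eq_Rintegral => xi _; rewrite mulrA.
rewrite RintegralZr//.
apply: (@L1_ext _ _ _ mu (fun xi => cos ((x - y) * xi) * exp_half e xi)).
  by move=> xi; rewrite mulrC.
apply: (@L1M_bounded _ _ _ mu _ _ 1); last exact: L1_exp_half.
  exact: measurable_cos_mul.
by move=> xi; exact: cos_le1_norm.
Qed.

Lemma le_Rintegral_ae f g : L1 mu f -> L1 mu g ->
  {ae mu, forall x, f x <= g x} -> \int[mu]_x f x <= \int[mu]_x g x.
Proof.
move=> lf lg fg.
have lm : L1 mu (fun x => Num.min (f x) (g x)).
  apply: (@L1_le _ _ _ mu _ (fun x => `|f x| + `|g x|)).
  - by apply: measurable_minr; [have := L1_measurable lf|have := L1_measurable lg].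
  - by apply: L1D; exact: L1_norm.
  - by move=> x; rewrite minEle; case: ifP => _; rewrite ?lerDl ?lerDr.
rewrite (@Rintegral_ae_eq _ _ _ mu _ (fun x => Num.min (f x) (g x))).
  by apply: le_Rintegral => // x _; rewrite ge_min lexx orbT.
by apply: (aeS _ fg) => {}x {}fg; rewrite (min_idPl fg).
Qed.

(** [f] is almost everywhere close to [L] near [x]; this is continuity at [x]
    for functions that are only known up to a null set. *)
Definition ae_near f (x L : R) := forall eta : R, 0 < eta ->
  exists2 dl : R, 0 < dl & {ae mu, forall y, `|y - x| < dl -> `|f y - L| <= eta}.

Let poisson_far (e dl z : R) : 0 < e -> 0 < dl -> dl <= `|z| ->
  poisson e z <= e / dl ^+ 2 /\ poisson e z <= e * ((1 + dl ^- 2) * poisson 1 z).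
Proof.
move=> e0 dl0 dlz.
have z2 : dl ^+ 2 <= z ^+ 2 by rewrite -(real_normK (num_real z)) lerXn2r// nnegrE ltW.
have dl2 : 0 < dl ^+ 2 by rewrite exprn_gt0.
have zz : 0 < z ^+ 2 by exact: lt_le_trans z2.
have e2 : 0 < e ^+ 2 by rewrite exprn_gt0.
split.
  by rewrite /poisson ler_wpM2l ?(ltW e0)// lef_pV2 ?posrE// ?addr_gt0// ler_wpDl// ltW.
rewrite /poisson expr1n mul1r ler_wpM2l ?(ltW e0)//.
rewrite ler_pdivlMr ?addr_gt0// mulrC ler_pdivrMr ?addr_gt0//.
apply: (@le_trans _ _ ((1 + dl ^- 2) * z ^+ 2)).
  rewrite mulrDl mul1r addrC lerD2l.
  by rewrite mulrC ler_pdivlMr// mul1r.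
by rewrite ler_wpM2l ?lerDr ?(ltW e2)// addr_ge0// invr_ge0 ltW.
Qed.

Lemma L1_poisson_shift x e : 0 < e -> L1 mu (fun y => poisson e (y - x)).
Proof. by move=> e0; exact: (L1_shift (- x) (L1_poisson e0)). Qed.

Lemma Rintegral_poisson_shift x e : 0 < e -> \int[mu]_y poisson e (y - x) = pi.
Proof.
move=> e0; rewrite -(Rintegral_poisson e0).
by rewrite -(Rintegral_shift (- x) (L1_poisson e0)).
Qed.

Lemma L1_poissonM f x e : L1 mu f -> 0 < e -> L1 mu (fun y => poisson e (y - x) * f y).
Proof.
move=> lf e0; apply: (@L1M_bounded _ _ _ mu _ _ e^-1) => //.
  by have := L1_measurable (L1_poisson_shift x e0).
move=> y; rewrite ger0_norm ?poisson_ge0// /poisson ler_pdivrMr.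
  by rewrite mulrDr expr2 mulrA mulVf ?mul1r ?gt_eqF// lerDl mulr_ge0 ?sqr_ge0// invr_ge0 ltW.
by rewrite ltr_pwDl ?exprn_gt0// sqr_ge0.
Qed.

(** The Poisson integral of [f] at [x] is within [eta] of [L], up to a term of
    order [e] coming from the points [y] away from [x]. *)
Lemma poisson_approx f x L : L1 mu f -> ae_near f x L -> forall eta, 0 < eta ->
  exists C, forall e, 0 < e ->
  `|\int[mu]_y (poisson e (y - x) * f y) - pi * L| <= eta * pi + e * C.
Proof.
move=> lf fx eta eta0; have [dl dl0 H] := fx _ eta0.
pose g y := dl ^- 2 * `|f y| + `|L| * (1 + dl ^- 2) * poisson 1 (y - x).
have lg : L1 mu g.
  apply: L1D; first exact/L1Z/L1_norm.
  by apply: L1Z; exact: L1_poisson_shift.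
exists (\int[mu]_y g y) => e e0.
have lp := L1_poisson_shift x e0.
have lpf := L1_poissonM x lf e0.
have lpL : L1 mu (fun y => L * poisson e (y - x)) by exact: L1Z.
have -> : pi * L = \int[mu]_y (L * poisson e (y - x)).
  rewrite RintegralZl// mulrC; congr (_ * _).
  exact/esym/Rintegral_poisson_shift.
rewrite -RintegralB//.
have lB := L1B lpf lpL.
apply: Rintegral_norm_le => //.
have -> : eta * pi + e * \int[mu]_y g y = \int[mu]_y (eta * poisson e (y - x) + e * g y).
  rewrite -(Rintegral_poisson_shift x e0) -RintegralZl// -RintegralZl//.
  by rewrite RintegralD//; exact: L1Z.
apply: le_Rintegral_ae.
- exact: L1_norm.
- by apply: L1D; exact: L1Z.
apply: (aeS _ H) => y Hy.
have p0 : 0 <= poisson e (y - x) by exact: poisson_ge0.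
have p1 : 0 <= poisson 1 (y - x) by exact: poisson_ge0.
have d2 : 0 < dl ^- 2 by rewrite invr_gt0 exprn_gt0.
have g0 : 0 <= g y.
  apply: addr_ge0; apply: mulr_ge0 => //; first exact: ltW.
  by rewrite mulr_ge0// addr_ge0// ltW.
rewrite -(mulrC (poisson e (y - x)) L) -mulrBr normrM (ger0_norm p0).
have [ydl|ydl] := ltP `|y - x| dl.
  rewrite (le_trans (ler_wpM2l p0 (Hy ydl)))// mulrC lerDl mulr_ge0//.
  exact: ltW.
have [h1 h2] := poisson_far e0 dl0 ydl.
rewrite (le_trans (ler_wpM2l p0 (ler_normB _ _)))// mulrDr.
rewrite (@le_trans _ _ (e * g y))//; last first.
  by rewrite lerDr mulr_ge0// ltW.
rewrite /g mulrDr lerD//.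
  by rewrite mulrA ler_wpM2r.
rewrite (le_trans (ler_wpM2r (normr_ge0 L) h2))// le_eqVlt; apply/orP; left; apply/eqP; ring.
Qed.

(** Fourier inversion, at one point and for an integrable spectrum: insert the
    convergence factor [exp (- e xi)], recognise a Poisson integral of [f], and
    let [e] tend to 0 on both sides. Only the restriction of the spectrum to the
    half-line appears, as [f] is real. *)
Theorem fourier_inversion f x L (B : R -> R) : L1 mu f -> ae_near f x L -> L1 mu B ->
  (forall xi, 0 <= xi -> `|wave (fcos f) (fsin f) x xi| <= B xi) ->
  \int[mu]_xi (\1_(`[0, +oo[%classic : set R) xi * wave (fcos f) (fsin f) x xi) = pi * L.
Proof.
move=> lf fx lB WB.
pose e_ n : R := n.+1%:R^-1.
have e0 n : 0 < e_ n by rewrite invr_gt0.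
have ecvg : e_ n @[n --> \oo] --> 0 by exact: cvg_harmonic.
pose W := wave (fcos f) (fsin f) x.
have mW : measurable_fun setT W.
  by apply: measurable_wave; [exact: measurable_fcos|exact: measurable_fsin].
have A : \int[mu]_xi (exp_half (e_ n) xi * W xi) @[n --> \oo] -->
    \int[mu]_xi (\1_(`[0, +oo[%classic : set R) xi * W xi).
  apply: (@Rintegral_dominated _ _ _ mu _ _ (fun xi => `|B xi|)).
  - move=> n; apply: measurable_funM; last exact: mW.
    by have := @measurable_exp_half R (e_ n).
  - by apply: measurable_funM; last exact: mW; exact: measurable_indic.
  - apply: aeW => xi; apply: cvgM; last exact: cvg_cst.
    rewrite -[X in _ --> X]mulr1; apply: cvgM; first exact: cvg_cst.
    rewrite -expR0; apply: (@cvg_comp _ _ _ (fun n => - (e_ n * xi)) expR _ (nbhs 0)); last exact: continuous_expR.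
    by rewrite -oppr0 -(mul0r xi); apply: cvgN; apply: cvgM => //; exact: cvg_cst.
  - exact: L1_norm.
  - apply: aeW => xi n; rewrite normrM /exp_half indicE.
    have [/set_mem/=|_] := boolP (xi \in _); last by rewrite mul0r normr0 mul0r.
    rewrite in_itv/= andbT => xi0; rewrite mul1r ger0_norm ?expR_ge0//.
    rewrite (le_trans _ (ler_norm _))// (le_trans _ (WB _ xi0))//.
    by rewrite ler_piMl// -expR0 ler_expR oppr_le0 mulr_ge0// ltW.
have A' : \int[mu]_y (poisson (e_ n) (y - x) * f y) @[n --> \oo] --> pi * L.
  apply/cvgrPdist_le => eta eta0.
  have eta1 : 0 < eta / 2 / pi by rewrite !divr_gt0// pi_gt0.
  have [C HC] := poisson_approx lf fx eta1.
  have H : (e_ n * C) @[n --> \oo] --> 0.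
    by rewrite -(mul0r C); apply: cvgM => //; exact: cvg_cst.
  have eta2 : 0 < eta / 2 by rewrite divr_gt0.
  move/cvgrPdist_le : H => /(_ _ eta2) H.
  near=> n; rewrite distrC (le_trans (HC _ (e0 n)))//.
  rewrite divfK ?gt_eqF ?pi_gt0// [leRHS]splitr lerD2l.
  rewrite (le_trans (ler_norm _))// -normrN -sub0r.
  by near: n.
have EA : (fun n => \int[mu]_xi (exp_half (e_ n) xi * W xi)) = (fun n => \int[mu]_y (poisson (e_ n) (y - x) * f y)).
  by apply/funext => n; rewrite abel_poisson.
move: A; rewrite EA => A.
exact: (cvg_unique _ A A').
Unshelve. all: by end_near. Qed.

End Spectrum.

(** * From improper Riemann integrals to Lebesgue integrals *)

Section RiemannLebesgue.
Context {R : realType}.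
Local Notation mu := (@lebesgue_measure R).
Implicit Types (f g : R -> R) (x : nat -> R).

Lemma chain_le x n : (forall i, (i < n)%N -> x i <= x i.+1) ->
  forall i j, (i <= j <= n)%N -> x i <= x j.
Proof.
move=> H i; elim=> [|j IH]; first by rewrite leqn0 => /andP[/eqP ->].
rewrite leq_eqVlt => /andP[/predU1P[->//|ij jn]].
by rewrite (le_trans (IH _))// ?H// -ltnS ij ltnW.
Qed.

Lemma chain_cell x n y : x 0%N < y <= x n ->
  exists2 i, (i < n)%N & x i < y <= x i.+1.
Proof.
elim: n => [/andP[a /(lt_le_trans a)]|n IH]; first by rewrite ltxx.
move=> /andP[xy yx]; have [yn|yn] := leP y (x n).
  by have [|i iln ?] := IH; [rewrite xy|exists i => //; exact: ltnW].
by exists n => //; rewrite yn.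
Qed.

Definition step_fun x (M : nat -> R) n y : R :=
  \sum_(i < n) M i * \1_(`]x i, x i.+1]%classic : set R) y.

Lemma L1_indic_itvoc (a b : R) : L1 mu (\1_(`]a, b]%classic : set R)).
Proof. exact: (integrable_indic_itv a b false false). Qed.

Lemma Rintegral_indic_itvoc (a b : R) : a <= b ->
  \int[mu]_y (\1_(`]a, b]%classic : set R) y) = b - a.
Proof.
move=> ab; transitivity (fine (mu `]a, b]%classic)).
  by rewrite /Rintegral integral_indic// setIT.
rewrite lebesgue_measure_itv/= lte_fin.
case: ifPn => [_//|]; rewrite -leNgt /= => ba; lra.
Qed.

Lemma step_funS x M n : step_fun x M n.+1 =
  (fun y => step_fun x M n y + M n * \1_(`]x n, x n.+1]%classic : set R) y).
Proof. by apply/funext => y; rewrite /step_fun big_ord_recr. Qed.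

Lemma L1_step_fun x M n : L1 mu (step_fun x M n).
Proof.
elim: n => [|n IH].
  apply: (@L1_ext _ _ _ mu (fun=> 0)); last exact: integrable0.
  by move=> y; rewrite /step_fun big_ord0.
by rewrite step_funS; apply: L1D => //; exact/L1Z/L1_indic_itvoc.
Qed.

Lemma Rintegral_step_fun x M n : (forall i, (i < n)%N -> x i <= x i.+1) ->
  \int[mu]_y step_fun x M n y = \sum_(i < n) M i * (x i.+1 - x i).
Proof.
elim: n => [_|n IH H].
  rewrite big_ord0; have -> : step_fun x M 0 = cst 0.
    by apply/funext => y; rewrite /step_fun big_ord0.
  by rewrite /Rintegral integral0.
rewrite step_funS big_ord_recr /= -IH; last by move=> i iln; apply: H; exact: ltnW.
rewrite RintegralD//; last by apply: L1Z; exact: L1_indic_itvoc.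
  rewrite RintegralZl//; last exact: L1_indic_itvoc.
  by rewrite Rintegral_indic_itvoc// H.
exact: L1_step_fun.
Qed.

Lemma step_fun0 x M n y : (forall i, (i < n)%N -> x i <= x i.+1) ->
  ~~ (x 0%N < y <= x n) -> step_fun x M n y = 0.
Proof.
move=> H Hy; rewrite /step_fun big1// => i _.
rewrite indicE; have [/set_mem/=|_] := boolP (y \in _); last by rewrite mulr0.
rewrite in_itv/= => /andP[a b]; case/negP: Hy; apply/andP; split.
  by apply: le_lt_trans a; apply: (chain_le H); rewrite leq0n ltnW.
by apply: (le_trans b); apply: (chain_le H); rewrite ltn_ord leqnn.
Qed.

Lemma step_fun_ge x M n g y : (forall i, (i < n)%N -> x i <= x i.+1) ->
  (forall i, (i < n)%N -> forall y, x i <= y <= x i.+1 -> g y <= M i) ->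
  x 0%N < y <= x n -> g y <= step_fun x M n y.
Proof.
elim: n => [_ _ /andP[a /(lt_le_trans a)]|n IH H gM]; first by rewrite ltxx.
move=> /andP[xy yx]; rewrite step_funS.
have H' i : (i < n)%N -> x i <= x i.+1 by move=> iln; apply: H; exact: ltnW.
have [yn|yn] := leP y (x n).
  rewrite indicE memNset ?mulr0 ?addr0; last first.
    by rewrite /= in_itv/= => /andP[/lt_le_trans/(_ yn)]; rewrite ltxx.
  apply: IH => //; last by rewrite xy.
  by move=> i iln; apply: gM; exact: ltnW.
rewrite step_fun0//; last by rewrite negb_and -!ltNge yn orbT.
by rewrite add0r indicE mem_set ?mulr1 ?gM ?(ltW yn)//= in_itv/= yn.
Qed.

(** A function bounded by constants on the cells of a partition is bounded by
    the upper Darboux sum of that partition. *)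
Lemma Rintegral_le_darboux g x M n : L1 mu g ->
  (forall i, (i < n)%N -> x i <= x i.+1) ->
  (forall y, ~~ (x 0%N <= y <= x n) -> g y <= 0) ->
  (forall i, (i < n)%N -> forall y, x i <= y <= x i.+1 -> g y <= M i) ->
  \int[mu]_y g y <= \sum_(i < n) M i * (x i.+1 - x i).
Proof.
move=> lg H g0 gM; rewrite -Rintegral_step_fun//.
apply: le_Rintegral_ae => //; first exact: L1_step_fun.
have N : {ae mu, forall y, y != x 0%N}.
  exists [set x 0%N]; split => //; first exact: lebesgue_measure_set1.
  by move=> y /= /negP; rewrite negbK => /eqP ->.
apply: (aeS _ N) => y yx; have [Hy|Hy] := boolP (x 0%N < y <= x n).
  exact: step_fun_ge.
rewrite step_fun0// g0//; apply: contra Hy => /andP[a ->].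
by rewrite andbT lt_neqAle eq_sym yx.
Qed.

Lemma null_cover (D : set R) : (forall eta : R, 0 < eta ->
  exists N, [/\ measurable N, D `<=` N & (mu N <= eta%:E)%E]) -> mu.-negligible D.
Proof.
move=> H; have H' k : exists N, [/\ measurable N, D `<=` N & (mu N <= (k.+1%:R^-1)%:E)%E].
  by apply: H; rewrite invr_gt0.
move: H' => /choice[N HN]; exists (\bigcap_k N k); split.
- by apply: bigcapT_measurable => k; have [] := HN k.
- apply/eqP; rewrite eq_le measure_ge0 andbT.
  apply/lee_addgt0Pr => e e0; rewrite add0e.
  have [k ke] : exists k : nat, k.+1%:R^-1 < e.
    have [k _ /(_ k (leqnn k)) ke] := near_infty_natSinv_lt (PosNum e0).
    by exists k.
  have [mN _ Nk] := HN k.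
  apply: (@le_trans _ _ (mu (N k))).
    apply: le_measure; rewrite ?inE//; last exact: bigcap_inf.
    by apply: bigcapT_measurable => j; have [] := HN j.
  by rewrite (le_trans Nk)// lee_fin ltW.
- by move=> y Dy k _; have [_ + _] := HN k; exact.
Qed.

Definition osc_lt f (e y : R) := exists2 dl : R, 0 < dl &
  forall z, `|z - y| < dl -> `|f z - f y| < e.

(** Points of large oscillation lie in the few cells of large height, apart
    from the finitely many end points of the cells. *)
Lemma riemann_osc f (a b I e : R) : is_riemann_integral f a b I -> 0 < e ->
  mu.-negligible [set y | a < y < b /\ ~ osc_lt f e y].
Proof.
move=> fI e0; apply: null_cover => eta eta0.
have ee : 0 < eta * e / 2 by rewrite divr_gt0// mulr_gt0.
have [n [x [m [M [x0 xn H lo up]]]]] := fI _ ee.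
have Hx i : (i < n)%N -> x i <= x i.+1 by move=> /H[].
pose bad i : set R := if e <= M i - m i then `[x i, x i.+1]%classic else set0.
have mbad i : measurable (bad i) by rewrite /bad; case: ifP.
pose E : set R := [set x i | i in `I_n.+1].
have cE : countable E by apply/finite_set_countable/finite_image/finite_II.
have mE : measurable E by exact: countable_measurable.
exists (\big[setU/set0]_(i < n) bad i `|` E); split.
- by apply: measurableU => //; exact: bigsetU_measurable.
- move=> y [/andP[ay yb] yosc]; apply: contrapT => /not_orP[ybad yE].
  apply: yosc; have [|i iln /andP[xy yx]] := @chain_cell x n y.
    by rewrite x0 xn ay (ltW yb).
  have {}yx : y < x i.+1.
    rewrite lt_neqAle yx andbT; apply/eqP => yxi; apply: yE; exists i.+1 => //=.
  have Mm : M i - m i < e.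
    rewrite ltNge; apply/negP => Mm; apply: ybad.
    rewrite -bigcup_mkord; exists i => //=; rewrite /bad Mm/= in_itv/=.
    by rewrite (ltW xy) ltW.
  exists (Num.min (y - x i) (x i.+1 - y)); first by rewrite lt_min !subr_gt0 xy.
  move=> z; rewrite lt_min => /andP[].
  rewrite !ltr_norml => /andP[z1 _] /andP[_ z2].
  have [_ Hi] := H _ iln.
  have /andP[f1 f2] : m i <= f z <= M i by apply: Hi; lra.
  have /andP[f3 f4] : m i <= f y <= M i by apply: Hi; lra.
  by lra.
- apply: (@le_trans _ _ (mu (\big[setU/set0]_(i < n) bad i) + mu E)%E).
    by apply: measureU2 => //; apply: bigsetU_measurable => i _; exact: mbad.
  rewrite [X in (_ + X)%E]countable_lebesgue_measure0// adde0.
  apply: (@le_trans _ _ (\sum_(i < n) mu (bad i))%E).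
    apply: content_subadditive.
    - by move=> i _; exact: mbad.
    - by apply: bigsetU_measurable => i _; exact: mbad.
    - by [].
  apply: (@le_trans _ _ (\sum_(i < n) ((M i - m i) * (x i.+1 - x i) / e)%:E)%E).
    apply: lee_sum => i _; have [xi Hi] := H _ (ltn_ord i).
    have Mm : m i <= M i.
      have /andP[] : m i <= f (x i) <= M i by apply: Hi; rewrite lexx.
      exact: le_trans.
    rewrite /bad; case: ifPn => [eM|_]; last first.
      by rewrite measure0 lee_fin divr_ge0 ?mulr_ge0 ?subr_ge0// ltW.
    rewrite lebesgue_measure_itv/= lte_fin.
    have D0 : 0 <= x i.+1 - x i by rewrite subr_ge0.
    have D1 : x i.+1 - x i <= (M i - m i) * (x i.+1 - x i) / e.
      by rewrite ler_pdivlMr// mulrC ler_wpM2r.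
    case: ifP => _; rewrite ?lee_fin//.
    exact: le_trans D0 D1.
  rewrite sumEFin lee_fin -mulr_suml ler_pdivrMr//.
  under eq_bigr do rewrite mulrBl.
  rewrite big_split/= sumrN; lra.
Qed.

Lemma riemann_ae_continuous f :
  (forall a b, a <= b -> exists I, is_riemann_integral f a b I) ->
  {ae mu, forall y, {for y, continuous f}}.
Proof.
move=> fI.
have A j k : {ae mu, forall y, - j%:R < y < j%:R -> osc_lt f k.+1%:R^-1 y}.
  have [|I HI] := fI (- j%:R) j%:R; first by rewrite (@le_trans _ _ 0)// oppr_le0.
  have e0 : 0 < k.+1%:R^-1 :> R by rewrite invr_gt0.
  apply: negligibleS (riemann_osc HI e0) => y /=.
  by move=> /not_implyP.
have : {ae mu, forall y, forall j k : nat, - j%:R < y < j%:R -> osc_lt f k.+1%:R^-1 y}.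
  by apply: ae_foralln => j; apply: ae_foralln => k.
apply: aeS => y Hy; apply/cvgrPdist_lt => e e0.
have [k _ /(_ k (leqnn k)) ke] := near_infty_natSinv_lt (PosNum e0).
have [|dl dl0 H] := Hy (Num.bound `|y|) k.
  by rewrite -ltr_norml archi_boundP.
exists dl => //= z yz; rewrite distrC (lt_trans _ ke)//; apply: H.
by rewrite distrC.
Qed.

(** A real function with a null set of discontinuities, which need not be Borel
    itself, is almost everywhere equal to a Borel function. *)
Lemma ae_continuous_borel f : {ae mu, forall y, {for y, continuous f}} ->
  exists f0 : R -> R, [/\ measurable_fun setT f0, {ae mu, forall y, f y = f0 y} &
    forall y, f0 y = f y \/ f0 y = 0].
Proof.
move=> [N [mN N0 HN]].
have mNC : measurable (~` N) by exact: measurableC.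
exists (f \_ (~` N)); split.
- apply/(measurable_restrictT f mNC).
  suff : measurable_fun (~` N) f by [].
  apply: subspace_continuous_measurable_fun => //.
  apply/subspace_continuousP => y yN; apply: cvg_within_filter.
  by apply: contrapT => h; apply: yN; exact: HN.
- exists N; split => // y /= yy; apply: contrapT => yN; apply: yy.
  by rewrite patchE mem_set.
- by move=> y; rewrite patchE; case: ifP; [left|right].
Qed.

Lemma L1_bounded_itv f (a b C : R) : measurable_fun setT f ->
  (forall y, a <= y <= b -> `|f y| <= C) ->
  L1 mu (fun y => \1_(`[a, b]%classic : set R) y * f y).
Proof.
move=> mf fC; apply: (@L1_le _ _ _ mu _ (fun y => C * \1_(`[a, b]%classic : set R) y)).
- by apply: measurable_funM => //; exact: measurable_indic.
- by apply: L1Z; exact: (integrable_indic_itv a b true false).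
- move=> y; rewrite indicE; have [/set_mem/=|_] := boolP (y \in _); last first.
    by rewrite mul0r normr0 mulr0.
  by rewrite in_itv/= mul1r mulr1 => /fC.
Qed.

Lemma Rintegral_itv_le_riemann f g (a b J : R) : is_riemann_integral f a b J ->
  measurable_fun setT g -> (forall y, 0 <= g y <= f y) ->
  L1 mu (fun y => \1_(`[a, b]%classic : set R) y * g y) /\
  \int[mu]_y (\1_(`[a, b]%classic : set R) y * g y) <= J.
Proof.
move=> fJ mg gf.
have bnd e : 0 < e -> exists C, (forall y, a <= y <= b -> `|g y| <= C) /\
    (L1 mu (fun y => \1_(`[a, b]%classic : set R) y * g y) ->
  \int[mu]_y (\1_(`[a, b]%classic : set R) y * g y) <= J + e).
  move=> e0; have [n [x [m [M [x0 xn H lo up]]]]] := fJ _ e0.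
  have Hx i : (i < n)%N -> x i <= x i.+1 by move=> /H[].
  have gM i : (i < n)%N -> forall y, x i <= y <= x i.+1 -> g y <= M i.
    move=> iln y /(H _ iln).2 /andP[_]; apply: le_trans.
    by have /andP[] := gf y.
  exists (\sum_(i < n) `|M i| + g a); split.
    move=> y /andP[ay yb]; have /andP[g0 _] := gf y; rewrite ger0_norm//.
    move: ay; rewrite le_eqVlt => /predU1P[<-|ay]; first by rewrite lerDr sumr_ge0.
    have [|i iln /andP[xy yx]] := @chain_cell x n y; first by rewrite x0 xn ay.
    have : g y <= M i by apply: (gM _ iln); rewrite (ltW xy).
    move=> /le_trans; apply; rewrite (le_trans (ler_norm _))//.
    rewrite (bigD1 (Ordinal iln))//= -addrA lerDl addr_ge0 ?sumr_ge0//.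
    by have /andP[] := gf a.
  move=> lg; apply: le_trans (ltW up).
  apply: Rintegral_le_darboux => //.
    move=> y; rewrite x0 xn indicE => Hy.
    by rewrite memNset ?mul0r//= in_itv/=; apply/negP.
  move=> i iln y Hy; apply: le_trans (gM _ iln _ Hy).
  have /andP[g0 _] := gf y.
  by rewrite indicE; case: (_ \in _); rewrite ?mul1r ?mul0r.
have lg : L1 mu (fun y => \1_(`[a, b]%classic : set R) y * g y).
  have [C [gC _]] := bnd 1 ltr01; exact: L1_bounded_itv gC.
split => //; apply/ler_addgt0Pr => e e0.
by have [_ [_]] := bnd e e0; exact.
Qed.

Lemma riemann_abs_L1 f g I : is_improper_riemann_integral (fun y => `|f y|) I ->
  measurable_fun setT g -> (forall y, `|g y| <= `|f y|) -> L1 mu g.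
Proof.
move=> [J [HJ Jcvg]] mg gf.
have mng : measurable_fun setT (fun y => `|g y|) by exact: measurableT_comp.
have H1 : \forall n \near \oo, J (- n%:R) n%:R <= I + 1.
  have /cvgrPdist_le/(_ _ ltr01) := Jcvg.
  move=> [[A B] /= [A1 B1] AB].
  have HA : \forall n \near \oo, A (- n%:R).
    case: A1 => MA [_ HMA]; near=> n; apply: HMA.
    by rewrite ltrNl; near: n; exact: nbhs_infty_gtr.
  have HB : \forall n \near \oo, B n%:R.
    case: B1 => MB [_ HMB]; near=> n; apply: HMB.
    by near: n; exact: nbhs_infty_gtr.
  near=> n; have /= : `|I - J (- n%:R) n%:R| <= 1.
    by apply: (AB (- n%:R, n%:R)); split => /=; near: n.
  by rewrite ler_norml => /andP[]; lra.
apply/integrableP; split; first exact/measurable_EFinP.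
pose F (n : nat) : set R := `[- n%:R, n%:R]%classic.
have FT : \bigcup_n F n = setT.
  apply/seteqP; split => // y _; exists (Num.bound `|y|) => //.
  by rewrite /F/= in_itv/= -ler_norml ltW// archi_boundP.
have Fn n : (\int[mu]_(y in F n) `|g y|%:E <= (J (- n%:R) n%:R)%:E)%E.
  have [lg gJ] : L1 mu (fun y => \1_(F n) y * `|g y|) /\
      \int[mu]_y (\1_(F n) y * `|g y|) <= J (- n%:R) n%:R.
    apply: (@Rintegral_itv_le_riemann (fun y => `|f y|)) => //.
    - by apply: HJ; rewrite (@le_trans _ _ 0)// oppr_le0.
    - by move=> y; rewrite normr_ge0/=.
  rewrite integral_mkcond; apply: (@le_trans _ _ (\int[mu]_y (\1_(F n) y * `|g y|)%:E)%E).
    rewrite le_eqVlt; apply/orP; left; apply/eqP; apply: eq_integral => y _.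
    by rewrite patchE indicE; case: ifP; rewrite ?mul1r ?mul0r.
  by rewrite -EFin_Rintegral// lee_fin.
have : (\int[mu]_(y in F i) `|g y|%:E @[i --> \oo] --> \int[mu]_(y in \bigcup_i F i) `|g y|%:E)%E.
  apply: ge0_nondecreasing_set_cvg_integral => //.
  - move=> n p np; rewrite /F; apply/subsetPset => y /=; rewrite !in_itv/= -!ler_norml => /le_trans; apply.
    by rewrite ler_nat.
  - by move=> n; exact: measurable_itv.
  - by move=> n; apply/measurable_EFinP; exact: measurable_funTS.
rewrite FT => Fcvg.
apply: (@le_lt_trans _ _ (I + 1)%:E); last by rewrite ltry.
rewrite -(cvg_lim _ Fcvg)//; apply: lime_le; first by apply/cvg_ex; eexists; exact: Fcvg.
near=> n; rewrite (le_trans (Fn n))// lee_fin; near: n; exact: H1.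
Unshelve. all: by end_near. Qed.

(** Lebesgue's criterion gives the continuity; the improper integral of [|f|]
    bounds the Lebesgue integrals over bounded intervals. *)
Lemma Lc_borel f : Lc f -> {ae mu, forall y, {for y, continuous f}} /\
  exists f0 : R -> R, L1 mu f0 /\ {ae mu, forall y, f y = f0 y}.
Proof.
move=> [fI [I HI]]; have cf := riemann_ae_continuous fI; split => //.
have [f0 [mf0 ff0 fE]] := ae_continuous_borel cf.
exists f0; split => //; apply: (riemann_abs_L1 HI) => // y.
by case: (fE y) => ->; rewrite ?normr0.
Qed.

(** Equal cells of length [h] carry the bounds [f (x i) - K h] and
    [f (x i) + K h]. *)
Lemma lipschitz_riemann f K (a b : R) : measurable_fun setT f ->
  (forall y z, `|f y - f z| <= K * `|y - z|) -> a <= b ->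
  is_riemann_integral f a b (\int[mu]_y (\1_(`[a, b]%classic : set R) y * f y)).
Proof.
move=> mf fK ab e e0.
have K0 : 0 <= K.
  by have := fK 1 0; rewrite subr0 normr1 mulr1; apply: le_trans.
pose n := (Num.bound (2 * K * (b - a) ^+ 2 / e)).+1.
have n0 : 0 < n%:R :> R by rewrite ltr0n.
have nE : 2 * K * (b - a) ^+ 2 / e < n%:R.
  apply: lt_trans (archi_boundP _) _; last by rewrite ltr_nat.
  by rewrite divr_ge0 ?(ltW e0)// mulr_ge0 ?sqr_ge0// mulr_ge0.
pose h := (b - a) / n%:R.
have h0 : 0 <= h by rewrite divr_ge0 ?subr_ge0// ltW.
pose x i := a + i%:R * h.
have xS i : x i.+1 - x i = h by rewrite /x -natr1; ring.
pose m i := f (x i) - K * h.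
pose M i := f (x i) + K * h.
have x0 : x 0%N = a by rewrite /x mul0r addr0.
have xn : x n = b by rewrite /x /h mulrCA mulfV ?mulr1 ?gt_eqF//; ring.
have Hx i : x i <= x i.+1 by rewrite -subr_ge0 xS.
have H i y : x i <= y <= x i.+1 -> m i <= f y <= M i.
  move=> /andP[xy yx]; rewrite /m /M -ler_distl (le_trans (fK _ _))// ler_wpM2l//.
  by rewrite ger0_norm ?subr_ge0// -(xS i) lerB.
have lf : L1 mu (fun y => \1_(`[a, b]%classic : set R) y * f y).
  apply: (@L1_bounded_itv _ _ _ (`|f a| + K * (b - a))) => //.
  move=> y /andP[ay yb]; rewrite -[f y](subrK (f a)) addrC (le_trans (ler_normD _ _))// lerD2l.
  by rewrite (le_trans (fK _ _))// ler_wpM2l// ger0_norm ?subr_ge0// lerB.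
set I := Rintegral _ _ _.
have in1 i y : (i < n)%N -> x i <= y <= x i.+1 -> \1_(`[a, b]%classic : set R) y = 1 :> R.
  move=> iln /andP[xy yx]; rewrite indicE mem_set//= in_itv/= -x0 -xn.
  rewrite (le_trans _ xy) ?(le_trans yx)//; apply: (@chain_le x n) => //.
    by rewrite iln leqnn.
  by rewrite leq0n ltnW.
have out y : ~~ (x 0%N <= y <= x n) -> \1_(`[a, b]%classic : set R) y = 0 :> R.
  by rewrite x0 xn => Hy; rewrite indicE memNset//= in_itv/=; apply/negP.
have up : I <= \sum_(i < n) M i * (x i.+1 - x i).
  apply: Rintegral_le_darboux => //.
    by move=> y /out ->; rewrite mul0r.
  by move=> i iln y Hy; rewrite (in1 i)// mul1r; have /andP[] := H _ _ Hy.
have lo : - I <= \sum_(i < n) (- m i) * (x i.+1 - x i).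
  rewrite /I -mulN1r -RintegralZl//.
  apply: (@Rintegral_le_darboux (fun y => - 1 * (\1_(`[a, b]%classic : set R) y * f y))
    x (fun i => - m i) n) => //.
  - exact: L1Z.
  - by move=> y /out ->; rewrite mul0r mulr0.
  - move=> i iln y Hy; rewrite (in1 i)// mul1r mulN1r lerN2.
    by have /andP[] := H _ _ Hy.
have gap : \sum_(i < n) M i * (x i.+1 - x i) = \sum_(i < n) m i * (x i.+1 - x i) + 2 * K * h * h * n%:R.
  transitivity (\sum_(i < n) (m i * (x i.+1 - x i) + 2 * K * h * h)).
    by apply: eq_bigr => i _; rewrite xS /M /m; ring.
  by rewrite big_split/= sumr_const card_ord -[X in _ + X]mulr_natr.
have lo' : \sum_(i < n) m i * (x i.+1 - x i) <= I.
  by move: lo; under eq_bigr do rewrite mulNr; rewrite sumrN; lra.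
have small : 2 * K * h * h * n%:R < e.
  have -> : 2 * K * h * h * n%:R = 2 * K * (b - a) ^+ 2 / n%:R.
    by rewrite /h; field; rewrite gt_eqF.
  by move: nE; rewrite !ltr_pdivrMr// (mulrC e).
exists n, x, m, M; split; [exact: x0|exact: xn| |lra|lra].
by move=> i _; split; [exact: Hx|move=> y; exact: H].
Qed.

Lemma L1_indic_itv_mul f (a b : R) : L1 mu f ->
  L1 mu (fun y => \1_(`[a, b]%classic : set R) y * f y).
Proof.
apply: (@L1M_bounded _ _ _ mu _ _ 1); first exact: measurable_indic.
by move=> y; rewrite indicE; case: (_ \in _); rewrite ?normr1 ?normr0.
Qed.

Lemma L1_tail f e : L1 mu f -> 0 < e -> exists2 M : R, 0 < M & forall a b, a <= - M -> M <= b ->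
  \int[mu]_y `|f y| - e <= \int[mu]_y (\1_(`[a, b]%classic : set R) y * `|f y|) <= \int[mu]_y `|f y|.
Proof.
move=> lf e0; have lnf := L1_norm lf.
have C : \int[mu]_y (\1_(`[- n%:R, n%:R]%classic : set R) y * `|f y|) @[n --> \oo] --> \int[mu]_y `|f y|.
  apply: (@Rintegral_dominated _ _ _ mu _ _ (fun y => `|f y|)) => //.
  - by move=> n; have := L1_measurable (L1_indic_itv_mul (- n%:R) n%:R lnf).
  - by have := L1_measurable lnf.
  - apply: aeW => y; rewrite -[X in _ --> X]mul1r; apply: cvgM; last exact: cvg_cst.
    apply: cvg_near_cst; near=> n.
    rewrite indicE mem_set//= in_itv/= -ler_norml; near: n; exact: nbhs_infty_ger.
  - apply: aeW => y n; rewrite normrM normr_id ler_piMl// indicE.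
    by case: (_ \in _); rewrite ?normr1 ?normr0.
move/cvgrPdist_le: C => /(_ _ e0)[n _ /(_ n.+1 (leqnSn n))] /=.
rewrite ler_norml => /andP[_ Hn].
exists n.+1%:R => // a b aM Mb; apply/andP; split; last first.
  apply: le_Rintegral => //; first exact: L1_indic_itv_mul.
  by move=> y _; rewrite indicE; case: (_ \in _); rewrite ?mul1r ?mul0r.
rewrite lerBlDr addrC -lerBlDr (le_trans _ Hn)// lerB//.
apply: le_Rintegral => //; try exact: L1_indic_itv_mul.
move=> y _; rewrite ler_wpM2r// !indicE.
have [/set_mem/=|_] := boolP (y \in `[- n.+1%:R, n.+1%:R]%classic); last by rewrite ler0n.
rewrite in_itv/= => /andP[h1 h2]; rewrite mem_set//= in_itv/=.
by rewrite (le_trans aM)//= (le_trans h2).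
Unshelve. all: by end_near. Qed.

(** The converse of [Lc_borel] for smooth enough functions: the tails of an
    integrable function are small, so its improper integral converges. *)
Lemma lipschitz_Lc f K : (forall y z, `|f y - f z| <= K * `|y - z|) -> L1 mu f -> Lc f.
Proof.
move=> fK lf; have mf := L1_measurableR lf; split.
  by move=> a b ab; eexists; exact: lipschitz_riemann fK ab.
exists (\int[mu]_y `|f y|), (fun a b => \int[mu]_y (\1_(`[a, b]%classic : set R) y * `|f y|)); split.
  move=> a b ab; apply: (@lipschitz_riemann _ K) => //.
    exact: measurableT_comp.
  by move=> y z; rewrite (le_trans (ler_dist_dist _ _)).
apply/cvgrPdist_le => e e0; have [M M0 HM] := L1_tail lf e0.
exists ([set a : R | a < - M], [set b : R | M < b]); first split.
- by exists (- M); split => //; exact: num_real.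
- by exists M; split => //; exact: num_real.
move=> [a b] /= [aM bM]; have := HM a b (ltW aM) (ltW bM).
by rewrite ler_norml; lra.
Qed.

End RiemannLebesgue.

(** * Functions synthesised from a spectrum, and their averages *)

Lemma L1Zr {d : measure_display} {T : measurableType d} {R : realType}
  (m : {measure set T -> \bar R}) (f : T -> R) (c : R) :
  L1 m f -> L1 m (fun x => f x * c).
Proof. by move=> lf; apply: (L1_ext _ (L1Z c lf)) => x; rewrite mulrC. Qed.

Section Synthesis.
Context {R : realType}.
Local Notation mu := (@lebesgue_measure R).
Implicit Types (c s m f g h : R -> R) (C k b x y : R).

Lemma lipschitz_cos (a b : R) : `|cos a - cos b| <= `|a - b|.
Proof.
wlog ab : a b / a < b => [H|].
  have [ab|ab|->] := ltgtP a b; [exact: H| |by rewrite !subrr].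
  by rewrite distrC (distrC a); exact: H.
have [|r _ E] := @MVT R cos (fun x => - sin x) a b ab.
  by apply: continuous_subspaceT; exact: continuous_cos.
by rewrite distrC E normrM normrN (distrC a) ler_piMl// sin_le1_norm.
Qed.

Lemma lipschitz_sin (a b : R) : `|sin a - sin b| <= `|a - b|.
Proof.
wlog ab : a b / a < b => [H|].
  have [ab|ab|->] := ltgtP a b; [exact: H| |by rewrite !subrr].
  by rewrite distrC (distrC a); exact: H.
have [|r _ E] := @MVT R sin cos a b ab.
  by apply: continuous_subspaceT; exact: continuous_sin.
by rewrite distrC E normrM (distrC a) ler_piMl// cos_le1_norm.
Qed.

(** [synth c s m] is the function whose cosine and sine transforms on the
    positive frequencies are [m * c] and [m * s]. *)
Definition synth c s m x : R := pi^-1 * \int[mu]_xi (m xi * wave c s x xi).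

Lemma L1_wave c s x : L1 mu c -> L1 mu s -> L1 mu (wave c s x).
Proof.
move=> lc ls; apply: L1D; apply: (@L1M_bounded _ _ _ mu _ _ 1) => //.
- exact: measurable_cos_mul.
- by move=> xi; exact: cos_le1_norm.
- exact: measurable_sin_mul.
- by move=> xi; exact: sin_le1_norm.
Qed.

Definition multiplier m C := measurable_fun setT m /\ forall xi, `|m xi| <= C.

Lemma L1_mwave c s m C x : L1 mu c -> L1 mu s -> multiplier m C ->
  L1 mu (fun xi => m xi * wave c s x xi).
Proof.
by move=> lc ls [mm mC]; apply: (@L1M_bounded _ _ _ mu _ _ C) => //; exact: L1_wave.
Qed.

Definition mass c s : R := pi^-1 * \int[mu]_xi (`|c xi| + `|s xi|).

Lemma L1_normD c s : L1 mu c -> L1 mu s -> L1 mu (fun xi => `|c xi| + `|s xi|).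
Proof. by move=> lc ls; apply: L1D; exact: L1_norm. Qed.

Lemma mass_ge0 c s : 0 <= mass c s.
Proof.
by rewrite mulr_ge0// ?invr_ge0 ?pi_ge0// Rintegral_ge0// => xi _; rewrite addr_ge0.
Qed.

Lemma multiplier_ge0 m C : multiplier m C -> 0 <= C.
Proof. by move=> [_ /(_ 0)]; apply: le_trans. Qed.

Lemma synth_le c s m C x : L1 mu c -> L1 mu s -> multiplier m C ->
  `|synth c s m x| <= C * mass c s.
Proof.
move=> lc ls mm; have C0 := multiplier_ge0 mm.
rewrite /synth /mass normrM gtr0_norm ?invr_gt0 ?pi_gt0// mulrCA.
rewrite ler_wpM2l ?invr_ge0 ?pi_ge0// -RintegralZl//; last exact: L1_normD.
apply: Rintegral_le_dom.
- by have := L1_measurable (L1_mwave x lc ls mm).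
- by apply: L1Z; exact: L1_normD.
- by move=> xi; rewrite normrM ler_pM// ?wave_le//; case: mm.
Qed.

Lemma synth_ext c s m m' c' s' x :
  (forall xi, m xi * c xi = m' xi * c' xi) -> (forall xi, m xi * s xi = m' xi * s' xi) ->
  synth c s m x = synth c' s' m' x.
Proof.
move=> mc ms; congr (_ * _); apply: eq_Rintegral => xi _.
by rewrite /wave !mulrDr !(mulrCA (m xi)) !(mulrCA (m' xi)) mc ms.
Qed.

Lemma synthB c s m m' C C' x : L1 mu c -> L1 mu s -> multiplier m C -> multiplier m' C' ->
  synth c s (fun xi => m xi - m' xi) x = synth c s m x - synth c s m' x.
Proof.
move=> lc ls mm mm'; rewrite /synth -mulrBr -RintegralB//; last 2 first.
- exact: L1_mwave mm.
- exact: L1_mwave mm'.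
by congr (_ * _); apply: eq_Rintegral => xi _; rewrite mulrBl.
Qed.

Lemma synthD c s m m' C C' x : L1 mu c -> L1 mu s -> multiplier m C -> multiplier m' C' ->
  synth c s (fun xi => m xi + m' xi) x = synth c s m x + synth c s m' x.
Proof.
move=> lc ls mm mm'; rewrite /synth -mulrDr -RintegralD//; last 2 first.
- exact: L1_mwave mm.
- exact: L1_mwave mm'.
by congr (_ * _); apply: eq_Rintegral => xi _; rewrite mulrDl.
Qed.

Lemma synthZ c s m C k x : L1 mu c -> L1 mu s -> multiplier m C ->
  synth c s (fun xi => k * m xi) x = k * synth c s m x.
Proof.
move=> lc ls mm; rewrite /synth [RHS]mulrCA -[X in _ = _ * X]RintegralZl//; last exact: L1_mwave mm.
by congr (_ * _); apply: eq_Rintegral => xi _; rewrite mulrA.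
Qed.

Lemma synth_specB c s c' s' m C x : L1 mu c -> L1 mu s -> L1 mu c' -> L1 mu s' ->
  multiplier m C ->
  synth (fun xi => c xi - c' xi) (fun xi => s xi - s' xi) m x =
  synth c s m x - synth c' s' m x.
Proof.
move=> lc ls lc' ls' mm; rewrite /synth -mulrBr -RintegralB//; try exact: L1_mwave mm.
by congr (_ * _); apply: eq_Rintegral => xi _; rewrite /wave; ring.
Qed.

Lemma multiplier_cst k : multiplier (fun=> k) `|k|.
Proof. by split. Qed.

Lemma multiplierM m m' C C' : multiplier m C -> multiplier m' C' ->
  multiplier (fun xi => m xi * m' xi) (C * C').
Proof.
move=> [mm mC] [mm' mC']; split; first exact: measurable_funM.
by move=> xi; rewrite normrM ler_pM.
Qed.

Lemma multiplierD m m' C C' : multiplier m C -> multiplier m' C' ->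
  multiplier (fun xi => m xi + m' xi) (C + C').
Proof.
move=> [mm mC] [mm' mC']; split; first exact: measurable_funD.
by move=> xi; rewrite (le_trans (ler_normD _ _))// lerD.
Qed.

Lemma multiplierB m m' C C' : multiplier m C -> multiplier m' C' ->
  multiplier (fun xi => m xi - m' xi) (C + C').
Proof.
move=> [mm mC] [mm' mC']; split; first exact: measurable_funB.
by move=> xi; rewrite (le_trans (ler_normB _ _))// lerD.
Qed.

Lemma multiplierZ m C k : multiplier m C -> multiplier (fun xi => k * m xi) (`|k| * C).
Proof. by move=> mm; exact: (multiplierM (multiplier_cst k) mm). Qed.

Lemma multiplierX m C n : multiplier m C -> multiplier (fun xi => m xi ^+ n) (C ^+ n).
Proof.
move=> [mm mC]; split; first exact: measurable_funX.
by move=> xi; rewrite normrX lerXn2r// nnegrE// (le_trans _ (mC xi)).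
Qed.

(** A compactly supported spectrum bounds the derivative. *)
Lemma synth_lipschitz c s m C b : L1 mu c -> L1 mu s -> multiplier m C -> 0 <= b ->
  (forall xi, b < `|xi| -> c xi = 0 /\ s xi = 0) ->
  forall x y, `|synth c s m x - synth c s m y| <= C * b * mass c s * `|x - y|.
Proof.
move=> lc ls mm b0 supp x y; have C0 := multiplier_ge0 mm.
have lx := L1_mwave x lc ls mm; have ly := L1_mwave y lc ls mm.
rewrite /synth -mulrBr -RintegralB// normrM gtr0_norm ?invr_gt0 ?pi_gt0//.
have -> : C * b * mass c s * `|x - y| = pi^-1 * \int[mu]_xi (C * b * `|x - y| * (`|c xi| + `|s xi|)).
  by rewrite RintegralZl//; [rewrite /mass; ring|exact: L1_normD].
rewrite ler_wpM2l ?invr_ge0 ?pi_ge0//.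
apply: Rintegral_le_dom.
- by have := L1_measurable (L1B lx ly).
- by apply: L1Z; exact: L1_normD.
move=> xi; rewrite -mulrBr normrM -!mulrA ler_pM//; first by case: mm.
have [bxi|xib] := ltP b `|xi|.
  rewrite /wave; have [-> ->] := supp _ bxi.
  by rewrite !mulr0 addr0 subrr normr0 mulr_ge0// mulr_ge0// addr_ge0.
have -> : wave c s x xi - wave c s y xi =
    (cos (x * xi) - cos (y * xi)) * c xi + (sin (x * xi) - sin (y * xi)) * s xi.
  by rewrite /wave; ring.
have bx : `|x * xi - y * xi| <= b * `|x - y|.
  by rewrite -mulrBl normrM mulrC ler_wpM2r.
rewrite (le_trans (ler_normD _ _))// !normrM mulrA mulrDr lerD// ler_wpM2r//.
  exact: le_trans (lipschitz_cos _ _) bx.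
exact: le_trans (lipschitz_sin _ _) bx.
Qed.

End Synthesis.

Section Averages.
Context {R : realType} {d : measure_display} {Omega : measurableType d}.
Variable P : probability Omega R.
Local Notation mu := (@lebesgue_measure R).

Definition sym_charfun (Y : Omega -> R) (phi : R -> R) :=
  [/\ measurable_fun setT Y, forall xi, \int[P]_w cos (xi * Y w) = phi xi &
      forall xi, \int[P]_w sin (xi * Y w) = 0].

Definition average (Y : Omega -> R) (h : R -> R) (x : R) : R := \int[P]_w h (x - Y w).

Lemma L1_bounded (g : Omega -> R) C : measurable_fun setT g ->
  (forall w, `|g w| <= C) -> L1 P g.
Proof.
move=> mg gC; apply: (@L1_le _ _ _ P _ (cst C)) => //.
exact: finite_measure_integrable_cst.
Qed.

Lemma Rintegral_P_cst (k : R) : \int[P]_w (cst k w) = k.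
Proof.
transitivity (k * fine (P setT)); first exact: (@Rintegral_cst _ _ _ P setT measurableT k).
by rewrite probability_setT mulr1.
Qed.

Lemma Rintegral_P_le (g : Omega -> R) C : measurable_fun setT g ->
  (forall w, `|g w| <= C) -> `|\int[P]_w g w| <= C.
Proof.
move=> mg gC; rewrite -[leRHS](Rintegral_P_cst C).
by apply: Rintegral_le_dom => //; exact: finite_measure_integrable_cst.
Qed.

Lemma measurable_cosY (Y : Omega -> R) (xi : R) : measurable_fun setT Y ->
  measurable_fun setT (fun w => cos (xi * Y w)).
Proof. by move=> mY; apply: measurable_cos_comp; exact: measurable_funM. Qed.

Lemma measurable_sinY (Y : Omega -> R) (xi : R) : measurable_fun setT Y ->
  measurable_fun setT (fun w => sin (xi * Y w)).
Proof. by move=> mY; apply: measurable_sin_comp; exact: measurable_funM. Qed.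

Lemma L1_cosY (Y : Omega -> R) (xi : R) : measurable_fun setT Y -> L1 P (fun w => cos (xi * Y w)).
Proof.
move=> mY; apply: (@L1_bounded _ 1); first exact: measurable_cosY.
by move=> w; exact: cos_le1_norm.
Qed.

Lemma L1_sinY (Y : Omega -> R) (xi : R) : measurable_fun setT Y -> L1 P (fun w => sin (xi * Y w)).
Proof.
move=> mY; apply: (@L1_bounded _ 1); first exact: measurable_sinY.
by move=> w; exact: sin_le1_norm.
Qed.

Lemma average_wave Y phi c s x xi : sym_charfun Y phi ->
  \int[P]_w wave c s (x - Y w) xi = phi xi * wave c s x xi.
Proof.
move=> [mY cY sY]; have lc := L1_cosY xi mY; have ls := L1_sinY xi mY.
transitivity (\int[P]_w (wave c s x xi * cos (xi * Y w) +
    (sin (x * xi) * c xi - cos (x * xi) * s xi) * sin (xi * Y w))).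
  by apply: eq_Rintegral => w _; rewrite /wave mulrBl cosB sinB (mulrC (Y w)); ring.
rewrite RintegralD//; try exact: L1Z.
by rewrite !RintegralZl// cY sY mulr0 addr0 mulrC.
Qed.

(** Averaging over the random translates multiplies the spectrum by the
    characteristic function of [Y]. *)
Lemma average_synth Y phi c s m C x : sym_charfun Y phi ->
  L1 mu c -> L1 mu s -> multiplier m C ->
  average Y (synth c s m) x = synth c s (fun xi => phi xi * m xi) x.
Proof.
move=> cY lc ls mm; have C0 := multiplier_ge0 mm; have [mY _ _] := cY.
have mc := L1_measurableR lc; have ms := L1_measurableR ls.
have mw : measurable_fun setT (fun z : Omega * measurableTypeR R => wave c s (x - Y z.1) z.2).
  have m2 : measurable_fun setT (fun z : Omega * measurableTypeR R => (z.2 : R)).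
    by move: (@measurable_snd _ _ Omega (measurableTypeR R)).
  have m12 : measurable_fun setT (fun z : Omega * measurableTypeR R => (x - Y z.1) * z.2).
    apply: measurable_funM => //; apply: measurable_funB => //.
    exact: measurableT_comp.
  apply: measurable_funD; apply: measurable_funM.
  - exact: measurable_cos_comp.
  - exact: (measurableT_comp mc m2).
  - exact: measurable_sin_comp.
  - exact: (measurableT_comp ms m2).
have [] := @Fubini_dominated _ _ _ _ R P mu
  (fun w xi => m xi * wave c s (x - Y w) xi) (cst 1) (fun xi => C * (`|c xi| + `|s xi|)).
- apply: measurable_funM => //.
  have m2 : measurable_fun setT (fun z : Omega * measurableTypeR R => (z.2 : R)).
    by move: (@measurable_snd _ _ Omega (measurableTypeR R)).
  by case: mm => mm _; exact: (measurableT_comp mm m2).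
- exact: finite_measure_integrable_cst.
- by apply: L1Z; exact: L1_normD.
- by move=> w xi; rewrite mul1r normrM ler_pM// ?wave_le//; case: mm.
move=> lF _ F.
rewrite /average /synth RintegralZl//; congr (_ * _).
rewrite F; apply: eq_Rintegral => xi _.
rewrite RintegralZl//.
  by rewrite (average_wave c s x xi cY); ring.
apply: (@L1_bounded _ (`|c xi| + `|s xi|)); last by move=> w; exact: wave_le.
by apply: (measurable_slice2 (F := fun w xi => wave c s (x - Y w) xi) xi).
Qed.

Section BoundedAverage.
Variables (Y : Omega -> R) (phi h : R -> R) (C : R).
Hypotheses (cY : sym_charfun Y phi) (lh : L1 mu h) (hC : forall x, `|h x| <= C).

Let mY : measurable_fun setT Y. Proof. by case: cY. Qed.

Let mh2 : measurable_fun setT (fun z : Omega * measurableTypeR R => h (z.2 - Y z.1)).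
Proof.
have mh := L1_measurableR lh.
have m2 : measurable_fun setT (fun z : Omega * measurableTypeR R => (z.2 : R)).
  by move: (@measurable_snd _ _ Omega (measurableTypeR R)).
have m : measurable_fun setT (fun z : Omega * measurableTypeR R => z.2 - Y z.1).
  by apply: measurable_funB => //; exact: measurableT_comp.
exact: (measurableT_comp mh m).
Qed.

Lemma average_Fubini (k : R -> R) : measurable_fun setT k -> (forall x, `|k x| <= 1) ->
  [/\ L1 P (fun w => \int[mu]_x (k x * h (x - Y w))),
      L1 mu (fun x => k x * average Y h x) &
   \int[mu]_x (k x * average Y h x) = \int[P]_w \int[mu]_x (k (x + Y w) * h x)].
Proof.
move=> mk k1.
have lhw w : L1 mu (fun x => h (x - Y w)) by exact: (L1_shift (- Y w) lh).
have mF : measurable_fun setT (fun z : Omega * measurableTypeR R => k z.2 * h (z.2 - Y z.1)).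
  apply: measurable_funM => //.
  have m2 : measurable_fun setT (fun z : Omega * measurableTypeR R => (z.2 : R)).
    by move: (@measurable_snd _ _ Omega (measurableTypeR R)).
  exact: (measurableT_comp mk m2).
have lF w : L1 mu (fun x => k x * h (x - Y w)).
  by apply: (@L1M_bounded _ _ _ mu _ _ 1).
have lG x : L1 P (fun w => k x * h (x - Y w)).
  apply: (@L1_bounded _ (1 * C)); last by move=> w; rewrite normrM ler_pM.
  exact: (measurable_slice2 (F := fun w x => k x * h (x - Y w)) x).
have lh2 x : L1 P (fun w => h (x - Y w)).
  apply: (@L1_bounded _ C) => //.
  exact: (@measurable_slice2 _ _ Omega (measurableTypeR R) R (fun w x => h (x - Y w)) x mh2).
have [||| lP lmu F] := @Rintegral_Fubini _ _ _ _ R P mu (fun w x => k x * h (x - Y w)).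
- apply/integrable12ltyP; first exact/measurable_EFinP.
  apply: (@le_lt_trans _ _ (\int[P]_w (cst (\int[mu]_x `|h x|) w)%:E)%E); last first.
    exact/integrable_lty/finite_measure_integrable_cst.
  apply: ge0_le_integral => //.
  + by move=> w _; exact: integral_ge0.
  + apply: (@measurable_fun_fubini_tonelli_F _ _ Omega (measurableTypeR R) R mu (fun z => `|k z.2 * h (z.2 - Y z.1)|%:E)).
      by apply/measurable_EFinP; apply: measurableT_comp.
    by move=> z; rewrite lee_fin.
  + exact/measurable_EFinP.
  + move=> w _; rewrite /= -(Rintegral_shift (- Y w) (L1_norm lh)).
    rewrite EFin_Rintegral; last exact: L1_norm.
    apply: ge0_le_integral => //.
    * by apply/measurable_EFinP; apply: measurableT_comp => //; exact: L1_measurable (lF w).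
    * by apply/measurable_EFinP; apply: measurableT_comp => //; exact: L1_measurable (lhw w).
    * by move=> x _; rewrite lee_fin normrM ler_piMl.
- exact: lF.
- exact: lG.
have E x : k x * average Y h x = \int[P]_w (k x * h (x - Y w)) by rewrite RintegralZl.
split => //.
  by apply: L1_ext lmu => x; rewrite E.
transitivity (\int[mu]_x \int[P]_w (k x * h (x - Y w))).
  by apply: eq_Rintegral => x _; rewrite E.
rewrite -F; apply: eq_Rintegral => w _.
rewrite -(Rintegral_shift (Y w) (lF w)).
by apply: eq_Rintegral => x _; rewrite addrK.
Qed.

Lemma L1_average : L1 mu (average Y h).
Proof.
have [||_ + _] := @average_Fubini (cst 1); [by []|by move=> x; rewrite normr1|].
by apply: L1_ext => x; rewrite mul1r.
Qed.

Lemma fcos_average xi : fcos (average Y h) xi = phi xi * fcos h xi.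
Proof.
have [||_ _] := @average_Fubini (fun x => cos (x * xi)).
- exact: measurable_cos_mulr.
- by move=> x; exact: cos_le1_norm.
rewrite -/(fcos _ _) => ->.
have lc := L1_cosM xi lh; have ls := L1_sinM xi lh.
have [_ cE sE] := cY.
transitivity (\int[P]_w (fcos h xi * cos (xi * Y w) - fsin h xi * sin (xi * Y w))).
  apply: eq_Rintegral => w _; rewrite /fcos /fsin.
  rewrite -!RintegralZr// -RintegralB//; try exact: L1Zr.
  by apply: eq_Rintegral => x _; rewrite mulrDl cosD (mulrC (Y w)); ring.
rewrite RintegralB//; last 2 first.
- by apply: L1Z; exact: L1_cosY.
- by apply: L1Z; exact: L1_sinY.
rewrite !RintegralZl//; [|exact: L1_sinY|exact: L1_cosY].
by rewrite cE sE mulr0 subr0 mulrC.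
Qed.

Lemma fsin_average xi : fsin (average Y h) xi = phi xi * fsin h xi.
Proof.
have [||_ _] := @average_Fubini (fun x => sin (x * xi)).
- exact: measurable_sin_mulr.
- by move=> x; exact: sin_le1_norm.
rewrite -/(fsin _ _) => ->.
have lc := L1_cosM xi lh; have ls := L1_sinM xi lh.
have [_ cE sE] := cY.
transitivity (\int[P]_w (fsin h xi * cos (xi * Y w) + fcos h xi * sin (xi * Y w))).
  apply: eq_Rintegral => w _; rewrite /fcos /fsin.
  rewrite -!RintegralZr// -RintegralD//; try exact: L1Zr.
  by apply: eq_Rintegral => x _; rewrite mulrDl sinD (mulrC (Y w)); ring.
rewrite RintegralD//; last 2 first.
- by apply: L1Z; exact: L1_cosY.
- by apply: L1Z; exact: L1_sinY.
rewrite !RintegralZl//; [|exact: L1_sinY|exact: L1_cosY].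
by rewrite cE sE mulr0 addr0 mulrC.
Qed.

End BoundedAverage.

(** Averaging over translates is a contraction in mean. *)
Lemma average_norm_le Y phi h C : sym_charfun Y phi -> L1 mu h -> (forall x, `|h x| <= C) ->
  \int[mu]_x `|average Y h x| <= \int[mu]_x `|h x|.
Proof.
move=> cY lh hC; have lnh := L1_norm lh; have [mY _ _] := cY.
have nC x : `| `|h x| | <= C by rewrite normr_id.
have [||_ l1 E] := @average_Fubini _ _ _ _ cY lnh nC (cst 1); [by []|by move=> x; rewrite normr1|].
have -> : \int[mu]_x `|h x| = \int[mu]_x (cst 1 x * average Y (fun x => `|h x|) x).
  rewrite E -[LHS]Rintegral_P_cst; apply: eq_Rintegral => w _ /=.
  by apply: eq_Rintegral => x _; rewrite mul1r.
apply: le_Rintegral => //.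
  by apply: L1_norm; exact: L1_average cY lh hC.
move=> x _; rewrite mul1r; apply: le_normr_Rintegral => //.
apply: (@L1_bounded _ C) => //.
apply: (measurableT_comp (f := h) (g := fun w => x - Y w)); first exact: L1_measurableR.
exact: measurable_funB.
Qed.

End Averages.

Section LogSeries.
Context {R : realType}.

Definition log_sum N (z : R) : R := \sum_(1 <= n < N.+1) (- z) ^+ n / n%:R.

Lemma derive_log_sum N (z : R) :
  is_derive z 1 (log_sum N) (- \sum_(0 <= k < N) (- z) ^+ k).
Proof.
elim: N => [|N IH].
  rewrite big_nil oppr0 (_ : log_sum 0 = cst 0); first exact: is_derive_cst.
  by apply/funext => x; rewrite /log_sum big_nil.
have -> : log_sum N.+1 = log_sum N + (N.+1%:R^-1 \*: (fun x => (- x) ^+ N.+1)).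
  by apply/funext => x; rewrite /log_sum big_nat_recr//= mulrC.
have dX : is_derive z 1 (fun x : R => (- x) ^+ N.+1) ((N.+1%:R * (- z) ^+ N) *: (- 1)).
  rewrite (_ : (fun x => _) = (-%R : R -> R) ^+ N.+1); last first.
    by apply/funext => x; rewrite exprfctE.
  exact: (@is_deriveX _ _ -%R N.+1 z 1 (- 1)).
rewrite big_nat_recr//=; apply: is_derive_eq.
rewrite /GRing.scale/=; field.
by rewrite nat1r pnatr_eq0.
Qed.

Lemma geom_alt N (z : R) : (1 + z) * \sum_(0 <= k < N) (- z) ^+ k = 1 - (- z) ^+ N.
Proof.
elim: N => [|N IH]; first by rewrite big_nil mulr0 expr0 subrr.
by rewrite big_nat_recr//= mulrDr IH exprS; ring.
Qed.

(** On [[0, 1]] the alternating logarithmic series converges uniformly: the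
    error has derivative [(- z) ^+ N / (1 + z)], bounded by [z ^+ N]. *)
Lemma log_sum_approx N (z : R) : 0 <= z <= 1 -> `|log_sum N z + ln (1 + z)| <= N.+1%:R^-1.
Proof.
move=> /andP[z0 z1].
have key (sg : R) : `|sg| = 1 -> 0 <= z ^+ N.+1 / N.+1%:R + sg * (log_sum N z + ln (1 + z)).
  move=> sg1; pose G (t : R) := t ^+ N.+1 / N.+1%:R + sg * (log_sum N t + ln (1 + t)).
  have G0 : G 0 = 0.
    rewrite /G expr0n/= mul0r add0r addr0 ln1 addr0 /log_sum big1_seq ?mulr0// => n.
    by rewrite mem_index_iota => /andP[_ /andP[n0 _]]; rewrite oppr0 expr0n gtn_eqF// mul0r.
  have dG (t : R) : 0 <= t -> is_derive t 1 G (t ^+ N + sg * ((- t) ^+ N / (1 + t))).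
    move=> t0; have t1 : 0 < 1 + t by rewrite ltr_pwDl.
    have d1 := derive_log_sum N t.
    have d2 : is_derive t 1 (fun t => ln (1 + t)) (1 + t)^-1.
      have d3 := is_derive1_ln t1.
      apply: is_derive_eq.
      by rewrite add0r /GRing.scale/= mulr1.
    have dX : is_derive t 1 (fun x : R => x ^+ N.+1) ((N.+1%:R * t ^+ N) *: 1).
      rewrite (_ : (fun x => _) = (id : R -> R) ^+ N.+1); last first.
        by apply/funext => x; rewrite exprfctE.
      exact: (@is_deriveX _ _ id N.+1 t 1 1).
    have -> : G = (N.+1%:R^-1 \*: (fun x => x ^+ N.+1)) +
        (sg \*: (log_sum N + (fun t => ln (1 + t)))).
      by apply/funext => x; rewrite /G mulrC.
    apply: is_derive_eq; rewrite /GRing.scale/=.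
    have := geom_alt N t; set s := \sum_(0 <= k < N) _ => gE.
    have -> : (- t) ^+ N = 1 - (1 + t) * s by rewrite gE; ring.
    field.
    by rewrite nat1r pnatr_eq0 andbT gt_eqF.
  rewrite -[X in 0 <= X]/(G z).
  move: z0; rewrite le_eqVlt => /predU1P[<-|z0]; first by rewrite G0.
  have [t||t] := @MVT R G (fun t => t ^+ N + sg * ((- t) ^+ N / (1 + t))) 0 z z0.
  - by rewrite in_itv/= => /andP[/ltW t0 _]; exact: dG.
  - apply: derivable_within_continuous => t; rewrite in_itv/= => /andP[t0 _].
    exact: (@ex_derive _ _ _ _ _ _ _ (dG _ t0)).
  rewrite in_itv/= => /andP[t0 _]; rewrite G0 !subr0 => ->.
  rewrite mulr_ge0 ?(ltW z0)// -lerBlDr sub0r.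
  rewrite (le_trans (ler_norm _))// normrN normrM sg1 mul1r normrM normrX normrN.
  rewrite (gtr0_norm t0) normfV gtr0_norm ?ltr_pwDl// ?(ltW t0)//.
  by rewrite ler_pdivrMr ?ltr_pwDl ?(ltW t0)// ler_peMr ?exprn_ge0 ?(ltW t0)// lerDl ltW.
have zN : z ^+ N.+1 / N.+1%:R <= N.+1%:R^-1.
  by rewrite ler_pdivrMr// mulVf ?pnatr_eq0// exprn_ile1.
have k1 := key 1 (normr1 _); have k2 := key (-1) (normrN1 _).
move: k1 k2; rewrite mul1r mulN1r addrC -lerBlDr sub0r subr_ge0 => k1 k2.
rewrite ler_norml lerNl; apply/andP; split; apply: le_trans zN => //.
by rewrite lerNl.
Qed.

End LogSeries.

(** * Band limitation of the iterated Riesz derivatives *)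

Section UniformConvergence.
Context {R : realType}.

Lemma uniform_cvgP (F : nat -> R -> R) (g : R -> R) :
  {uniform, F @ \oo --> g} <->
  forall e : R, 0 < e -> \forall n \near \oo, forall x, `|g x - F n x| < e.
Proof.
split=> [Fg e e0|Fg P].
  apply: (Fg [set h : R -> R | forall x, `|g x - h x| < e]).
  apply/uniform_nbhs; exists [set xy : R * R | ball xy.1 e xy.2]; split.
    by rewrite -entourage_ballE; exists e.
  by move=> h /= H x; exact: H.
move=> /uniform_nbhs [E [+ EP]]; rewrite -entourage_ballE => -[e e0 eE].
apply: filterS (Fg e e0) => n Hn; apply: EP => x _; apply: eE => /=.
exact: Hn.
Qed.

End UniformConvergence.

Section Iterates.
Context {R : realType}.
Local Notation mu := (@lebesgue_measure R).
Variables (alpha rho : R).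
Hypotheses (alpha0 : 0 < alpha) (rho0 : 0 < rho).
Implicit Types (f g h : R -> R) (x xi : R).

Lemma Lc_L1 f : Lc f -> measurable_fun setT f -> L1 mu f.
Proof.
move=> /Lc_borel[_ [f0 [lf0 ff0]]] mf; apply/integrableP; split.
  exact/measurable_EFinP.
move: lf0 => /integrableP[_]; rewrite (@integral_ae_eqT _ _ _ mu (fun x => `|f0 x|%:E) (fun x => `|f x|%:E))//.
by apply: (aeS _ ff0) => x ->.
Qed.

Lemma fcos_ae f g : {ae mu, forall x, f x = g x} -> fcos f = fcos g.
Proof.
move=> fg; apply/funext => xi; apply: (@Rintegral_ae_eq _ _ _ mu).
by apply: (aeS _ fg) => x ->.
Qed.

Lemma fsin_ae f g : {ae mu, forall x, f x = g x} -> fsin f = fsin g.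
Proof.
move=> fg; apply/funext => xi; apply: (@Rintegral_ae_eq _ _ _ mu).
by apply: (aeS _ fg) => x ->.
Qed.

Lemma wave_le2 c s x xi K P : `|c xi| <= K * P -> `|s xi| <= K * P ->
  `|wave c s x xi| <= 2 * K * P.
Proof.
move=> cB sB; rewrite (le_trans (wave_le _ _ _ _))// -mulrA mulr_natl mulr2n.
exact: lerD.
Qed.

Lemma L1_indicM (D : set R) f : measurable D -> L1 mu f -> L1 mu (fun x => \1_D x * f x).
Proof.
move=> mD lf; have mI : measurable_fun setT (\1_D : R -> R) by exact: measurable_indic.
apply: (@L1M_bounded _ _ _ mu _ _ 1); [exact: mI| |exact: lf].
by move=> x; rewrite indicE; case: (_ \in _); rewrite ?normr1 ?normr0.
Qed.

Lemma riesz_fcos f g xi : is_riesz_derivative alpha f g ->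
  fcos g xi = - (`|xi| `^ alpha) * fcos f xi /\ fsin g xi = - (`|xi| `^ alpha) * fsin f xi.
Proof.
move=> [_ _ /(_ xi)]; rewrite /fourier -/(fcos _ _) -/(fsin _ _) -/(fcos f xi) -/(fsin f xi).
move=> /eqP; rewrite eq_complex /= => /andP[/eqP -> /eqP ->].
by split; ring.
Qed.

Lemma riesz_of_fcos f g : Lc f -> Lc g ->
  (forall xi, fcos g xi = - (`|xi| `^ alpha) * fcos f xi) ->
  (forall xi, fsin g xi = - (`|xi| `^ alpha) * fsin f xi) ->
  is_riesz_derivative alpha f g.
Proof.
move=> Lf Lg cg sg; split => // xi.
rewrite /fourier -/(fcos _ _) -/(fsin _ _) -/(fcos f xi) -/(fsin f xi) cg sg.
by apply/eqP; rewrite eq_complex /=; apply/andP; split; apply/eqP; ring.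
Qed.

(** The set of frequencies where the logarithmic series of [- |xi|^alpha] with
    parameter [1 / rho] converges. *)
Definition inband xi := `|xi| `^ alpha <= rho.
Definition symb xi : R := if inband xi then `|xi| `^ alpha else 0.
Definition bandcut h xi : R := if (0 <= xi) && inband xi then h xi else 0.
Definition bandwidth : R := rho `^ alpha^-1.

Lemma symb_ge0 xi : 0 <= symb xi.
Proof. by rewrite /symb; case: ifP => // _; exact: powR_ge0. Qed.

Lemma symb_le xi : symb xi <= rho.
Proof. by rewrite /symb; case: ifP => // _; exact: ltW. Qed.

Lemma measurable_powabs : measurable_fun setT (fun xi : R => `|xi| `^ alpha).
Proof.
apply: (measurableT_comp (f := @powR R ^~ alpha) (g := fun x : R => `|x|)) => //.
Qed.

Lemma measurable_symb : measurable_fun setT symb.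
Proof.
apply: measurable_fun_ifT => //; last exact: measurable_powabs.
by apply: measurable_fun_ler => //; exact: measurable_powabs.
Qed.

Lemma multiplier_symb : multiplier symb rho.
Proof.
split; first exact: measurable_symb.
by move=> xi; rewrite ger0_norm ?symb_ge0 ?symb_le.
Qed.

Lemma inband_le xi : inband xi -> `|xi| <= bandwidth.
Proof.
rewrite /inband /bandwidth => H.
have -> : `|xi| = (`|xi| `^ alpha) `^ alpha^-1.
  by rewrite -powRrM mulfV ?gt_eqF// powRr1.
by apply: ge0_ler_powR; rewrite ?nnegrE ?powR_ge0 ?invr_ge0 ?(ltW alpha0) ?(ltW rho0).
Qed.

Lemma cut_supp h xi : bandwidth < `|xi| -> bandcut h xi = 0.
Proof.
rewrite /bandcut; case: ifP => // /andP[_ /inband_le].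
by move=> /le_lt_trans h1 /h1; rewrite ltxx.
Qed.

Lemma measurable_cut h : measurable_fun setT h -> measurable_fun setT (bandcut h).
Proof.
move=> mh; apply: measurable_fun_ifT => //.
apply: measurable_and; first by apply: measurable_fun_ler => //; exact: measurable_cst.
by apply: measurable_fun_ler => //; exact: measurable_powabs.
Qed.

Lemma L1_cut h C : measurable_fun setT h -> (forall xi, `|h xi| <= C) -> L1 mu (bandcut h).
Proof.
move=> mh hC.
apply: (@L1_le _ _ _ mu _ (fun xi => C * \1_(`[- bandwidth, bandwidth]%classic : set R) xi)).
- by have := measurable_cut mh.
- by apply: L1Z; exact: (integrable_indic_itv _ _ true false).
move=> xi; have C0 : 0 <= C by apply: le_trans (hC 0).
rewrite /bandcut; case: ifP => [/andP[_ /inband_le xib]|_]; last first.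
  by rewrite normr0 mulr_ge0// indicE ler0n.
by rewrite indicE mem_set ?mulr1//= in_itv/= -ler_norml.
Qed.

Section Decay.
Variables (F : nat -> R -> R).
Hypotheses (lF : forall n, L1 mu (F n))
  (FC : forall n xi, fcos (F n.+1) xi = - (`|xi| `^ alpha) * fcos (F n) xi)
  (FS : forall n xi, fsin (F n.+1) xi = - (`|xi| `^ alpha) * fsin (F n) xi).

Let A n := \int[mu]_x `|F n x|.
Let s xi := `|xi| `^ alpha.

Lemma iter_fcos n k xi : fcos (F (n + k)) xi = (- s xi) ^+ k * fcos (F n) xi.
Proof.
elim: k => [|k IH]; first by rewrite addn0 expr0 mul1r.
by rewrite addnS FC IH mulrA exprS.
Qed.

Lemma iter_fsin n k xi : fsin (F (n + k)) xi = (- s xi) ^+ k * fsin (F n) xi.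
Proof.
elim: k => [|k IH]; first by rewrite addn0 expr0 mul1r.
by rewrite addnS FS IH mulrA exprS.
Qed.

Let decay_aux (a : nat -> R) n k xi : 2 <= k%:R * alpha ->
  `|a n| <= A n -> `|a (n + k)%N| <= A (n + k) -> a (n + k)%N = (- s xi) ^+ k * a n ->
  `|a n| <= 2 * (A n + A (n + k)) * poisson 1 xi.
Proof.
move=> ka an ank E.
have An m : 0 <= A m by apply: Rintegral_ge0.
have x2 : 0 < 1 + xi ^+ 2 by rewrite ltr_pwDl// sqr_ge0.
rewrite /poisson expr1n mul1r ler_pdivlMr//.
have [x1|x1] := leP `|xi| 1.
  have : xi ^+ 2 <= 1 by rewrite -(real_normK (num_real xi)) exprn_ile1.
  move=> h; rewrite (@le_trans _ _ (`|a n| * 2))//.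
    by rewrite ler_wpM2l//; lra.
  by rewrite mulrC ler_wpM2l// (le_trans an)// lerDl.
have x1' := ltW x1.
have sk : xi ^+ 2 <= `|(- s xi) ^+ k|.
  have skE : s xi ^+ k = `|xi| `^ (alpha * k%:R) by rewrite powRrM powR_mulrn ?powR_ge0.
  rewrite normrX normrN (ger0_norm (powR_ge0 _ _)) skE.
  by rewrite -(real_normK (num_real xi)) -powR_mulrn// ler_powR// mulrC.
have xx : 1 <= xi ^+ 2 by rewrite -(real_normK (num_real xi)) exprn_ege1.
rewrite (@le_trans _ _ (`|a n| * (2 * xi ^+ 2)))//.
  by rewrite ler_wpM2l//; lra.
rewrite mulrCA ler_wpM2l// (@le_trans _ _ `|a (n + k)%N|)//.
  by rewrite E normrM mulrC ler_wpM2r.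
by rewrite (le_trans ank)// lerDr.
Qed.

(** Each application of the Riesz derivative improves the integrability of the
    spectrum at infinity. *)
Lemma iter_decay n : exists2 K, 0 <= K & forall xi,
  `|fcos (F n) xi| <= K * poisson 1 xi /\ `|fsin (F n) xi| <= K * poisson 1 xi.
Proof.
pose k := Num.bound (2 / alpha).
have ka : 2 <= k%:R * alpha.
  by rewrite -ler_pdivrMr// ltW// archi_boundP// divr_ge0// ltW.
exists (2 * (A n + A (n + k))).
  by rewrite mulr_ge0// addr_ge0// Rintegral_ge0.
move=> xi; split.
  apply: (decay_aux (a := fun n => fcos (F n) xi) ka); [exact: fcos_le|exact: fcos_le|exact: iter_fcos].
apply: (decay_aux (a := fun n => fsin (F n) xi) ka); [exact: fsin_le|exact: fsin_le|exact: iter_fsin].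
Qed.

Let half h xi : R := \1_(`[0, +oo[%classic : set R) xi * h xi.

(** By [iter_decay] every iterate has an integrable spectrum, to which Fourier
    inversion applies. *)
Lemma iter_inversion n x L : ae_near (F n) x L ->
  L = synth (half (fcos (F 0%N))) (half (fsin (F 0%N))) (fun xi => (- s xi) ^+ n) x.
Proof.
move=> FL; have [K K0 HK] := iter_decay n.
have lK : L1 mu (fun xi => 2 * K * poisson 1 xi) by apply: L1Z; exact: L1_poisson.
have B xi : 0 <= xi -> `|wave (fcos (F n)) (fsin (F n)) x xi| <= 2 * K * poisson 1 xi.
  move=> _; have [h1 h2] := HK xi.
  exact: wave_le2.
have E := fourier_inversion (lF n) FL lK B.
rewrite /synth -[LHS](mulKf (lt0r_neq0 (pi_gt0 R))) -E; congr (_ * _).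
apply: eq_Rintegral => xi _.
have := iter_fcos 0 n xi; have := iter_fsin 0 n xi.
by rewrite add0n /wave /half => -> ->; ring.
Qed.

Let p xi : R := half (fun xi => fcos (F 0%N) xi ^+ 2 + fsin (F 0%N) xi ^+ 2) xi.

Let p_ge0 xi : 0 <= p xi.
Proof. by rewrite /p /half mulr_ge0 ?addr_ge0 ?sqr_ge0// indicE ler0n. Qed.

Let mp : measurable_fun setT p.
Proof.
apply: measurable_funM; first exact: measurable_indic.
apply: measurable_funD; apply: measurable_funX.
  exact: measurable_fcos.
exact: measurable_fsin.
Qed.

Let indic01 (D : set R) xi : 0 <= (\1_D xi : R) <= 1.
Proof. by rewrite indicE; case: (_ \in _); rewrite ?lexx ?ler01. Qed.

Let half_le h xi (B : R) : `|h xi| <= B -> `|half h xi| <= B.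
Proof.
move=> hB; rewrite /half normrM; have /andP[i0 i1] := indic01 `[0, +oo[%classic xi.
by rewrite (ger0_norm i0) (le_trans _ hB)// ler_piMl.
Qed.

Let L1_power n : L1 mu (fun xi => s xi ^+ n * p xi).
Proof.
have [K K0 HK] := iter_decay n.
apply: (@L1_le _ _ _ mu _ (fun xi => (A 0%N * K * 2) * poisson 1 xi)).
- have : measurable_fun setT (fun xi => s xi ^+ n * p xi).
    by apply: measurable_funM => //; apply: measurable_funX; exact: measurable_powabs.
  by [].
- by apply: L1Z; exact: L1_poisson.
move=> xi; have [] := HK xi; move: (poisson 1 xi) => P h1 h2.
have E1 := iter_fcos 0 n xi; have E2 := iter_fsin 0 n xi; rewrite add0n in E1 E2.
have k1 := fcos_le xi (lF 0); have k2 := fsin_le xi (lF 0).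
have sn : `|s xi ^+ n| = `|(- s xi) ^+ n| by rewrite !normrX normrN.
rewrite normrM sn (ger0_norm (p_ge0 _)) /p /half.
have /andP[i0 i1] := indic01 `[0, +oo[%classic xi.
rewrite (@le_trans _ _ (`|(- s xi) ^+ n| * (fcos (F 0%N) xi ^+ 2 + fsin (F 0%N) xi ^+ 2)))//.
  by rewrite ler_wpM2l// ler_piMl// addr_ge0 ?sqr_ge0.
rewrite mulrDr -(real_normK (num_real (fcos _ _))) -(real_normK (num_real (fsin _ _))) !expr2 !mulrA -!normrM -E1 -E2.
have -> : A 0%N * K * 2 * P = (K * P) * A 0%N + (K * P) * A 0%N by ring.
by rewrite lerD// normrM ler_pM.
Qed.

Lemma measurable_wave_comp {d : measure_display} {T : measurableType d} (X Xi : T -> R) (c r : R -> R) :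
  measurable_fun setT X -> measurable_fun setT Xi -> measurable_fun setT c ->
  measurable_fun setT r -> measurable_fun setT (fun z => wave c r (X z) (Xi z)).
Proof.
move=> mX mXi mc mr; have mXXi : measurable_fun setT (fun z => X z * Xi z).
  exact: measurable_funM.
apply: measurable_funD; apply: measurable_funM.
- exact: measurable_cos_comp.
- exact: (measurableT_comp mc mXi).
- exact: measurable_sin_comp.
- exact: (measurableT_comp mr mXi).
Qed.

Let L1_half_wave n x : L1 mu (half (wave (fcos (F n)) (fsin (F n)) x)).
Proof.
have [K K0 HK] := iter_decay n.
have mc := measurable_fcos (lF n); have ms := measurable_fsin (lF n).
apply: (@L1_le _ _ _ mu _ (fun xi => 2 * K * poisson 1 xi)).
- have : measurable_fun setT (half (wave (fcos (F n)) (fsin (F n)) x)).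
    by apply: measurable_funM; [exact: measurable_indic|exact: measurable_wave].
  by [].
- by apply: L1Z; exact: L1_poisson.
- by move=> xi; apply: half_le; have [h1 h2] := HK xi; exact: wave_le2.
Qed.

Let iter_inv n x : ae_near (F n) x (F n x) ->
  \int[mu]_xi half (wave (fcos (F n)) (fsin (F n)) x) xi = pi * F n x.
Proof.
move=> FL; have [K K0 HK] := iter_decay n.
have lK : L1 mu (fun xi => 2 * K * poisson 1 xi) by apply: L1Z; exact: L1_poisson.
apply: (fourier_inversion (lF n) FL lK) => xi _; have [h1 h2] := HK xi.
exact: wave_le2.
Qed.

Let iter_bounded n : (forall x, ae_near (F n) x (F n x)) ->
  exists C, forall x, `|F n x| <= C.
Proof.
move=> FL; have [K K0 HK] := iter_decay n; exists (2 * K) => x.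
rewrite -(mulKf (lt0r_neq0 (pi_gt0 R)) (F n x)) -(iter_inv (FL x)) normrM.
rewrite gtr0_norm ?invr_gt0 ?pi_gt0// mulrC ler_pdivrMr ?pi_gt0//.
rewrite -(Rintegral_poisson (@ltr01 R)) -(RintegralZl _ measurableT (L1_poisson (@ltr01 R))).
apply: Rintegral_le_dom.
- by have := L1_measurable (L1_half_wave n x).
- by apply: L1Z; exact: L1_poisson.
- by move=> xi; apply: half_le; have [h1 h2] := HK xi; exact: wave_le2.
Qed.

Let L1_iter_mul n : (forall x, ae_near (F n) x (F n x)) -> L1 mu (fun x => F 0%N x * F n x).
Proof.
move=> /iter_bounded[C HC].
apply: (@L1_ext _ _ _ mu (fun x => F n x * F 0%N x)); first by move=> x; rewrite mulrC.
apply: (@L1M_bounded _ _ _ mu _ _ C); [|exact: HC|exact: lF].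
by have := L1_measurable (lF n).
Qed.

(** Parseval's identity, by Fourier inversion of [F n] under the integral and
    Fubini's theorem. The spectral integrand is nonnegative, so that a bound on
    [F n] bounds the spectrum. *)
Lemma iter_parseval n : (forall x, ae_near (F n) x (F n x)) ->
  \int[mu]_x (F 0%N x * F n x) = pi^-1 * ((- 1) ^+ n * \int[mu]_xi (s xi ^+ n * p xi)).
Proof.
move=> FL; have [K K0 HK] := iter_decay n.
have lc := L1_measurableR (lF 0).
have mc := measurable_fcos (lF n); have ms := measurable_fsin (lF n).
have [] := @Fubini_dominated _ _ _ _ R mu mu
  (fun x xi => F 0%N x * half (wave (fcos (F n)) (fsin (F n)) x) xi)
  (fun x => `|F 0%N x|) (fun xi => 2 * K * poisson 1 xi).
- apply: measurable_funM; first exact: (measurable_comp_fst lc).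
  apply: measurable_funM.
    apply: (measurable_comp_snd (f := \1_(`[0, +oo[%classic : set R))).
    exact: measurable_indic.
  by apply: measurable_wave_comp => //.
- exact/L1_norm/lF.
- by apply: L1Z; exact: L1_poisson.
- move=> x xi; rewrite normrM ler_wpM2l//.
  by apply: half_le; have [h1 h2] := HK xi; exact: wave_le2.
move=> _ _ E.
transitivity (pi^-1 * \int[mu]_x \int[mu]_xi (F 0%N x * half (wave (fcos (F n)) (fsin (F n)) x) xi)).
  rewrite -(mulKf (lt0r_neq0 (pi_gt0 R)) (\int[mu]_x (F 0%N x * F n x))); congr (_ * _).
  have -> : \int[mu]_x \int[mu]_xi (F 0%N x * half (wave (fcos (F n)) (fsin (F n)) x) xi) =
      \int[mu]_x (pi * (F 0%N x * F n x)).
    by apply: eq_Rintegral => x _; rewrite (RintegralZl _ measurableT (L1_half_wave n x)) (iter_inv (FL x)) mulrCA.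
  by rewrite (RintegralZl _ measurableT (L1_iter_mul FL)).
congr (_ * _); rewrite E -(RintegralZl _ measurableT (L1_power n)).
apply: eq_Rintegral => xi _.
have l0 := lF 0%N.
transitivity (half (fun xi => fcos (F n) xi * fcos (F 0%N) xi + fsin (F n) xi * fsin (F 0%N) xi) xi).
  transitivity (\int[mu]_x (\1_(`[0, +oo[%classic : set R) xi * (fcos (F n) xi * (cos (x * xi) * F 0%N x) +
     fsin (F n) xi * (sin (x * xi) * F 0%N x)))).
    by apply: eq_Rintegral => x _; rewrite /half /wave; ring.
  have lc0 := L1_cosM xi l0; have ls0 := L1_sinM xi l0.
  rewrite (RintegralZl _ measurableT (L1D (L1Z _ lc0) (L1Z _ ls0))).
  rewrite (RintegralD measurableT (L1Z _ lc0) (L1Z _ ls0)).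
  by rewrite (RintegralZl _ measurableT lc0) (RintegralZl _ measurableT ls0).
have := iter_fcos 0 n xi; have := iter_fsin 0 n xi.
by rewrite add0n /p /half => -> ->; rewrite -(mulN1r (s xi)) exprMn; ring.
Qed.

Let bernoulli (g : R) n : 0 <= g -> 1 + n%:R * g <= (1 + g) ^+ n.
Proof.
move=> g0; elim: n => [|n IH]; first by rewrite mul0r addr0 expr0.
rewrite exprS -natr1; have : (1 + g) * (1 + n%:R * g) <= (1 + g) * (1 + g) ^+ n.
  by rewrite ler_wpM2l// addr_ge0.
apply: le_trans; have : 0 <= n%:R * g * g by rewrite !mulr_ge0.
lra.
Qed.

(** A converse of Bernstein's inequality. Where the symbol exceeds
    [rho * (1 + g) ^ 2] the spectral integral of [iter_parseval] is at least
    [rho ^ n * (1 + g) ^ (2 * n)] times the mass of the spectrum there, while the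
    bound on [F n] makes it at most of order [n * rho ^ n]; so this mass is 0. *)
Lemma iter_band_limit N0 :
  (forall n x, (N0 <= n)%N -> ae_near (F n) x (F n x)) ->
  (forall n x, (N0 <= n)%N -> `|F n x| <= n%:R * rho ^+ n) ->
  {ae mu, forall xi, rho < s xi -> half (fcos (F 0%N)) xi = 0 /\ half (fsin (F 0%N)) xi = 0}.
Proof.
move=> FL Fbd.
have Ibd n : (N0 <= n)%N -> \int[mu]_xi (s xi ^+ n * p xi) <= pi * A 0%N * (n%:R * rho ^+ n).
  move=> Nn; have E := iter_parseval (fun x => FL n x Nn).
  have sg : `|(-1) ^+ n| = 1 :> R by rewrite normrX normrN1 expr1n.
  have I0 : 0 <= \int[mu]_xi (s xi ^+ n * p xi).
    by apply: Rintegral_ge0 => xi _; rewrite mulr_ge0// exprn_ge0// powR_ge0.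
  have -> : \int[mu]_xi (s xi ^+ n * p xi) = `|(-1) ^+ n * \int[mu]_xi (s xi ^+ n * p xi)|.
    by rewrite normrM sg mul1r ger0_norm.
  rewrite -[X in `|X|](mulVKf (lt0r_neq0 (pi_gt0 R))) -E normrM (gtr0_norm (pi_gt0 R)) -mulrA.
  rewrite ler_wpM2l ?pi_ge0// mulrC -RintegralZl//; last exact/L1_norm/lF.
  have mF n' : measurable_fun setT (F n') by exact: L1_measurableR.
  apply: Rintegral_le_dom.
  - by have : measurable_fun setT (fun x => F 0%N x * F n x) by exact: measurable_funM.
  - exact/L1Z/L1_norm/lF.
  - by move=> x; rewrite normrM mulrC ler_wpM2r// Fbd.
pose E j : set R := [set xi | rho * (1 + j.+1%:R^-1) ^+ 2 <= s xi].
have mE j : measurable (E j).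
  have ms : measurable_fun setT s by exact: measurable_powabs.
  have mb : measurable_fun setT (fun xi => rho * (1 + j.+1%:R^-1) ^+ 2 <= s xi).
    exact: measurable_fun_ler.
  have -> : E j = setT `&` (fun xi => rho * (1 + j.+1%:R^-1) ^+ 2 <= s xi) @^-1` [set true].
    by rewrite setTI; apply/seteqP; split.
  by apply: mb.
have Q0 j : \int[mu]_xi (\1_(E j) xi * p xi) = 0.
  set g : R := j.+1%:R^-1; have g0 : 0 < g by rewrite invr_gt0.
  have lp : L1 mu p by apply: L1_ext (L1_power 0) => xi; rewrite expr0 mul1r.
  have lq : L1 mu (fun xi => \1_(E j) xi * p xi).
    exact: L1_indicM.
  have q0 : 0 <= \int[mu]_xi (\1_(E j) xi * p xi).
    by apply: Rintegral_ge0 => xi _; rewrite mulr_ge0//; case/andP: (indic01 (E j) xi).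
  have B n : (N0 <= n.+1)%N -> \int[mu]_xi (\1_(E j) xi * p xi) <= pi * A 0%N / g ^+ 2 * n.+1%:R^-1.
    move=> Nn; set q := Rintegral _ _ _ in q0 *.
    have r0 : 0 < rho ^+ n.+1 by rewrite exprn_gt0.
    have h1 : (rho * (1 + g) ^+ 2) ^+ n.+1 * q <= pi * A 0%N * (n.+1%:R * rho ^+ n.+1).
      rewrite (le_trans _ (Ibd _ Nn))// /q -RintegralZl//.
      apply: le_Rintegral => //; first exact: L1Z.
      move=> xi _; rewrite indicE; have [/set_mem/= xiE|_] := boolP (xi \in E j).
        rewrite mul1r ler_wpM2r// lerXn2r// ?nnegrE ?powR_ge0//.
        by rewrite mulr_ge0 ?(ltW rho0)// exprn_ge0// addr_ge0// ltW.
      by rewrite mul0r mulr0 mulr_ge0// exprn_ge0// powR_ge0.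
    have h2 : n.+1%:R * g <= (1 + g) ^+ n.+1.
      by rewrite (le_trans _ (bernoulli n.+1 (ltW g0)))// lerDr.
    have ng : 0 < n.+1%:R * g by rewrite mulr_gt0.
    have h3 : (n.+1%:R * g) ^+ 2 <= (1 + g) ^+ n.+1 ^+ 2.
      by rewrite lerXn2r// nnegrE ltW// (lt_le_trans ng).
    have h4 : (n.+1%:R * g) ^+ 2 * q <= pi * A 0%N * n.+1%:R.
      rewrite (le_trans (ler_wpM2r q0 h3))//.
      rewrite -(ler_pM2r r0) -[leRHS]mulrA; apply: le_trans h1.
      rewrite exprMn exprAC le_eqVlt; apply/orP; left; apply/eqP; ring.
    have -> : pi * A 0%N / g ^+ 2 * n.+1%:R^-1 = pi * A 0%N * n.+1%:R / (n.+1%:R * g) ^+ 2.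
      by field; rewrite nat1r pnatr_eq0 gt_eqF.
    by rewrite ler_pdivlMr ?exprn_gt0// mulrC.
  apply/eqP; rewrite eq_le q0 andbT; apply/ler_addgt0Pr => e e0; rewrite add0r.
  set D := pi * A 0%N / g ^+ 2 in B.
  have D0 : 0 <= D by rewrite divr_ge0 ?exprn_ge0 ?(ltW g0)// mulr_ge0 ?pi_ge0// Rintegral_ge0.
  pose n := (N0 + Num.bound (D / e))%N.
  rewrite (le_trans (B n _))//; first by rewrite /n leqW// leq_addr.
  rewrite ler_pdivrMr// mulrC -ler_pdivrMr// ltW//.
  rewrite (lt_le_trans (archi_boundP _))//; first by rewrite divr_ge0// ltW.
  by rewrite ler_nat /n leqW// leq_addl.
have Qae j : {ae mu, forall xi, \1_(E j) xi * p xi = 0}.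
  have lp : L1 mu p by apply: L1_ext (L1_power 0) => xi; rewrite expr0 mul1r.
  have lq : L1 mu (fun xi => \1_(E j) xi * p xi).
    exact: L1_indicM.
  have /(ae_eq_integral_abs mu measurableT (measurable_int _ lq)) :
    (\int[mu]_xi `|(EFin \o (fun xi => (\1_(E j) xi * p xi)%R)) xi| = 0)%E.
    rewrite -[RHS]/(0%:E) -(Q0 j) EFin_Rintegral//; apply: eq_integral => xi _ /=.
    by rewrite ger0_norm// mulr_ge0//; case/andP: (indic01 (E j) xi).
  by apply: aeS => xi /(_ I) [].
have := ae_foralln Qae; apply: aeS => xi H xirho.
have [j Ej] : exists j, E j xi.
  have d0 : 0 < (s xi - rho) / (3 * rho) by rewrite divr_gt0 ?subr_gt0// mulr_gt0.
  have [j _ /(_ j (leqnn j)) je] := near_infty_natSinv_lt (PosNum d0).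
  exists j; rewrite /E/=; move: je => /=; set g := j.+1%:R^-1 => je.
  have g0 : 0 < g by rewrite invr_gt0.
  have g1 : g <= 1 by rewrite invf_le1// ler1n.
  have : g * (3 * rho) < s xi - rho by rewrite -ltr_pdivlMr// mulr_gt0.
  have : rho * (g * g) <= rho * g by rewrite ler_pM2l// ler_piMr// ltW.
  rewrite expr2; lra.
have := H j; rewrite indicE mem_set// mul1r /p /half indicE.
case: (_ \in _); rewrite ?mul0r// !mul1r => /eqP.
by rewrite paddr_eq0 ?sqr_ge0// !sqrf_eq0 => /andP[/eqP -> /eqP ->].
Qed.

End Decay.

Lemma log_symb xi : 0 <= ln (1 + symb xi / rho) <= ln 2.
Proof.
have z0 : 0 <= symb xi / rho by rewrite divr_ge0 ?symb_ge0// ltW.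
have z1 : symb xi / rho <= 1 by rewrite ler_pdivrMr// mul1r symb_le.
have h1 : 1 <= 1 + symb xi / rho by rewrite lerDl.
rewrite ln_ge0//= ler_ln ?posrE//; last by rewrite (lt_le_trans _ h1).
by rewrite [leRHS](_ : _ = 1 + 1)// lerD2l.
Qed.

Lemma measurable_log_symb : measurable_fun setT (fun xi => ln (1 + symb xi / rho)).
Proof.
apply: (measurableT_comp (@measurable_ln R)); apply: measurable_funD; first exact: measurable_cst.
by apply: measurable_funM; [exact: measurable_symb|exact: measurable_cst].
Qed.

Lemma multiplier_log : multiplier (fun xi => - ln (1 + symb xi / rho)) (ln 2).
Proof.
split; first by apply: measurable_funN; exact: measurable_log_symb.
by move=> xi; have /andP[l0 l1] := log_symb xi; rewrite normrN ger0_norm.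
Qed.

Lemma frac_log_sumS c Df N x : frac_log_sum c Df N.+1 x =
  frac_log_sum c Df N x + c ^+ N.+1 / N.+1%:R * Df N.+1 x :> R.
Proof. by rewrite /frac_log_sum big_nat_recr. Qed.

(** The scalar estimate [log_sum_approx] inside the spectral integral: on the
    band its argument [symb xi / rho] lies in [[0, 1]]. *)
Lemma frac_log_synth c r e C : L1 mu c -> L1 mu r -> multiplier e C ->
  is_frac_log rho^-1 (fun n => synth c r (fun xi => e xi * (- symb xi) ^+ n))
    (synth c r (fun xi => e xi * - ln (1 + symb xi / rho))).
Proof.
move=> lc lr me; have C0 := multiplier_ge0 me.
have z01 xi : 0 <= symb xi / rho <= 1.
  by rewrite divr_ge0 ?symb_ge0 ?(ltW rho0)//= ler_pdivrMr// mul1r symb_le.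
have msymb := measurable_symb; have mln := multiplier_log.
have mz : measurable_fun setT (fun xi => symb xi / rho).
  by apply: measurable_funM => //; exact: measurable_cst.
have mlog N : multiplier (fun xi => log_sum N (symb xi / rho)) (ln 2 + N.+1%:R^-1).
  split.
    apply: measurable_sum => n; apply: measurable_funM; last exact: measurable_cst.
    by apply: measurable_funX; exact: measurable_funN.
  move=> xi; rewrite addrC -[X in `|X|](addrK (ln (1 + symb xi / rho))).
  rewrite (le_trans (ler_normD _ _))// lerD//; first exact: log_sum_approx.
  by have [_ ->] := mln.
have sumE N x : frac_log_sum rho^-1 (fun n => synth c r (fun xi => e xi * (- symb xi) ^+ n)) N x =
    synth c r (fun xi => e xi * log_sum N (symb xi / rho)) x.
  elim: N => [|N IH].
    rewrite /frac_log_sum big_nil /synth.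
    rewrite (_ : (fun xi => _) = cst 0) ?Rintegral_cst0 ?mulr0//.
      by rewrite Rintegral_cst// mul0r mulr0.
    by apply/funext => xi; rewrite /log_sum big_nil mulr0 mul0r.
  rewrite frac_log_sumS IH.
  have mX := multiplierM me (multiplierX N.+1 (multiplierZ (-1) multiplier_symb)).
  have -> : synth c r (fun xi => e xi * (- symb xi) ^+ N.+1) x =
      synth c r (fun xi => e xi * (-1 * symb xi) ^+ N.+1) x.
    by apply: synth_ext => xi; rewrite mulN1r.
  rewrite -(synthZ _ x lc lr mX) -(synthD x lc lr (multiplierM me (mlog N)) (multiplierZ _ mX)).
  apply: synth_ext => xi; congr (_ * _); rewrite /log_sum [in RHS]big_nat_recr//= mulrDr; congr (_ + _).
    rewrite -[in RHS](mulN1r (_ / _)) !exprMn exprVn; ring.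
  rewrite -[in RHS](mulN1r (_ / _)) !exprMn exprVn; ring.
apply/uniform_cvgP => d d0.
have mass0 := mass_ge0 c r.
pose N0 := Num.bound (C * mass c r / d).
exists N0 => // N /= NN x; rewrite sumE.
rewrite -(synthB x lc lr (multiplierM me mln) (multiplierM me (mlog N))).
have mB : multiplier (fun xi => e xi * - ln (1 + symb xi / rho) - e xi * log_sum N (symb xi / rho)) (C * N.+1%:R^-1).
  split; first by have [] := multiplierB (multiplierM me mln) (multiplierM me (mlog N)).
  move=> xi; rewrite -mulrBr normrM ler_pM//; first by have [_ ->] := me.
  by rewrite -opprD normrN addrC log_sum_approx.
rewrite (le_lt_trans (synth_le x lc lr mB))// mulrAC ltr_pdivrMr//.
rewrite [ltRHS]mulrC -ltr_pdivrMr// (lt_le_trans (archi_boundP _))//.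
  by apply: divr_ge0; [exact: mulr_ge0|exact: ltW].
by rewrite ler_nat leqW.
Qed.

Lemma frac_log_unique Df Pf Pf' : is_frac_log rho^-1 Df Pf -> is_frac_log rho^-1 Df Pf' ->
  forall x, Pf x = Pf' x.
Proof.
move=> /uniform_cvgP H /uniform_cvgP H' x; apply/eqP; rewrite -subr_eq0 -normr_le0.
apply/ler_addgt0Pr => e e0; rewrite add0r.
have e20 : 0 < e / 2 by rewrite divr_gt0.
have [N _ HN] : \forall n \near \oo, (forall x, `|Pf x - frac_log_sum rho^-1 Df n x| < e / 2) /\
   (forall x, `|Pf' x - frac_log_sum rho^-1 Df n x| < e / 2).
  by near=> n; split; near: n; [exact: H|exact: H'].
have [h h'] := HN N (leqnn N); have {}h := h x; have {}h' := h' x.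
rewrite -(subrKA (frac_log_sum rho^-1 Df N x)) (le_trans (ler_normD _ _))//.
rewrite [`|frac_log_sum _ _ _ _ - _|]distrC; lra.
Unshelve. all: by end_near. Qed.

(** The general term of a uniformly convergent series tends to 0 uniformly. *)
Lemma frac_log_bounded Df Pf : is_frac_log rho^-1 Df Pf ->
  exists N0, forall n x, (N0 <= n)%N -> `|Df n x| <= n%:R * rho ^+ n.
Proof.
move=> /uniform_cvgP /(_ (1/2)) []; first by lra.
move=> N _ HN; exists N.+2 => n x; case: n => // n; rewrite ltnS => Nn.
have h1 := HN n (ltnW Nn) x; have h2 := HN n.+1 (leqW (ltnW Nn)) x.
have n0 : 0 < n.+1%:R :> R by rewrite ltr0n.
have r0 : 0 < rho ^+ n.+1 by rewrite exprn_gt0.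
have : `|rho^-1 ^+ n.+1 / n.+1%:R * Df n.+1 x| <= 1.
  have -> : rho^-1 ^+ n.+1 / n.+1%:R * Df n.+1 x =
      (Pf x - frac_log_sum rho^-1 Df n x) - (Pf x - frac_log_sum rho^-1 Df n.+1 x).
    by rewrite frac_log_sumS; ring.
  by rewrite (le_trans (ler_normB _ _))//; lra.
rewrite normrM ger0_norm; last by rewrite divr_ge0 ?exprn_ge0 ?invr_ge0 ?(ltW rho0).
by rewrite exprVn -invfM mulrC ler_pdivrMr ?mulr_gt0// mul1r mulrC.
Qed.

Lemma continuous_ae_near f x : {for x, continuous f} -> ae_near f x (f x).
Proof.
move=> /cvgrPdist_le fx e e0; have /nbhs_ballP[d d0 Hd] := fx e e0.
exists d => //; apply: aeW => y yx; rewrite distrC; apply: Hd.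
by rewrite /ball /= distrC.
Qed.

Section Representation.
Variables (f Pf : R -> R) (Df : nat -> R -> R).
Hypotheses (hD : riesz_iterates alpha f Df) (hP : is_frac_log rho^-1 Df Pf).
Let c := bandcut (fcos f).
Let r := bandcut (fsin f).

(** Convergence of the logarithmic series bounds the iterates, hence confines
    the spectrum to the band, where the symbol is bounded: there the Riesz
    derivative and its logarithmic series are bounded spectral multipliers. *)
Lemma spectral_representation :
  [/\ L1 mu c /\ L1 mu r,
     forall n x, Df n.+1 x = synth c r (fun xi => (- symb xi) ^+ n.+1) x,
     forall x, {for x, continuous f} -> f x = synth c r (fun=> 1) x &
     forall x, Pf x = synth c r (fun xi => - ln (1 + symb xi / rho)) x].
Proof.
have [D0 DR DC] := hD.
have Lf : Lc f by rewrite -D0; case: (DR 0%N).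
have [cf [f0 [lf0 ff0]]] := Lc_borel Lf.
pose F n := if n is 0%N then f0 else Df n.
have mD n : measurable_fun setT (Df n.+1) by exact: continuous_measurable_fun.
have lF n : L1 mu (F n).
  case: n => [//|n]; apply: Lc_L1; [by case: (DR n)|exact: mD].
have cF n : fcos (F n) = fcos (Df n) by case: n => [|//]; rewrite D0; apply: fcos_ae; apply: aeS ff0 => x ->.
have sF n : fsin (F n) = fsin (Df n) by case: n => [|//]; rewrite D0; apply: fsin_ae; apply: aeS ff0 => x ->.
have FC n xi : fcos (F n.+1) xi = - (`|xi| `^ alpha) * fcos (F n) xi.
  by rewrite !cF; have [] := riesz_fcos xi (DR n).
have FS n xi : fsin (F n.+1) xi = - (`|xi| `^ alpha) * fsin (F n) xi.
  by rewrite !sF; have [] := riesz_fcos xi (DR n).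
have [N0 HN0] := frac_log_bounded hP.
have nearF n x : ae_near (F n.+1) x (F n.+1 x) by apply: continuous_ae_near; exact: DC.
have band := @iter_band_limit F lF FC FS N0.+1.
have {}band : {ae mu, forall xi, rho < `|xi| `^ alpha ->
    \1_(`[0, +oo[%classic : set R) xi * fcos f xi = 0 /\ \1_(`[0, +oo[%classic : set R) xi * fsin f xi = 0}.
  rewrite -D0 -cF -sF; apply: band; first by case=> // n x _; exact: nearF.
  by case=> // n x Nn; apply: HN0; exact: ltnW.
have mc := measurable_fcos (lF 0); have ms := measurable_fsin (lF 0).
rewrite cF D0 in mc; rewrite sF D0 in ms.
have lc : L1 mu c.
  apply: (L1_cut mc) => xi; rewrite -D0 -cF; exact: fcos_le.
have lr : L1 mu r.
  apply: (L1_cut ms) => xi; rewrite -D0 -sF; exact: fsin_le.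
have rep n x L : ae_near (F n) x L -> L = synth c r (fun xi => (- symb xi) ^+ n) x.
  move=> /(iter_inversion lF FC FS) ->; rewrite cF sF D0 /synth; congr (_ * _).
  apply: (@Rintegral_ae_eq _ _ _ mu); apply: aeS band => xi bxi.
  rewrite /wave /c /r /bandcut /symb /inband indicE.
  rewrite (_ : (xi \in _) = (0 <= xi)); last first.
    by apply/idP/idP; rewrite ?inE /= in_itv/= andbT.
  have [b|b] := leP (`|xi| `^ alpha) rho.
    by rewrite andbT; case: ifP => _; rewrite ?mul1r ?mul0r.
  have [] := bxi b; rewrite indicE (_ : (xi \in _) = (0 <= xi)); last first.
    by apply/idP/idP; rewrite ?inE /= in_itv/= andbT.
  by move=> h1 h2; rewrite andbF h1 h2 !mulr0 addr0 !mulr0.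
have repD n x : Df n.+1 x = synth c r (fun xi => (- symb xi) ^+ n.+1) x by exact: rep.
split => //.
  move=> x fx; apply: (rep 0%N) => e e0; have [d d0 Hd] := continuous_ae_near fx e0.
  by exists d => //; move: (aeI Hd ff0); apply: aeS => y [h E]; rewrite /F /= -E.
move=> x; have E := frac_log_synth lc lr (multiplier_cst 1).
rewrite (@frac_log_unique Df Pf (synth c r (fun xi => 1 * - ln (1 + symb xi / rho)))) //.
  by apply: synth_ext => xi; rewrite mul1r.
apply/uniform_cvgP => e e0; have /uniform_cvgP/(_ e e0) := E.
apply: filterS => N HN y; have := HN y.
rewrite (_ : frac_log_sum rho^-1 Df N y = frac_log_sum rho^-1 (fun n => synth c r (fun xi => 1 * (- symb xi) ^+ n)) N y)//.
apply: eq_big_nat => -[//|n] _; rewrite repD; congr (_ * _).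
by apply: synth_ext => xi; rewrite mul1r.
Qed.
End Representation.
End Iterates.

(** * Subordination to an independent random clock *)

Section Independence.
Context {d : measure_display} {Omega : measurableType d} {R : realType}.
Variable P : probability Omega R.
Implicit Types X Y : Omega -> R.

Definition independent X Y := forall A B : set R, measurable A -> measurable B ->
  P (X @^-1` A `&` Y @^-1` B) = (P (X @^-1` A) * P (Y @^-1` B))%E.

(** The joint law is the product of the marginals. *)
Lemma Rintegral_independent X Y (F G : R -> R) (C D : R) :
  measurable_fun setT X -> measurable_fun setT Y -> independent X Y ->
  measurable_fun setT F -> measurable_fun setT G ->
  (forall x, `|F x| <= C) -> (forall y, `|G y| <= D) ->
  \int[P]_w (F (X w) * G (Y w)) = (\int[P]_w F (X w)) * (\int[P]_w G (Y w)).
Proof.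
move=> mX mY XY mF mG FC GD.
pose X' : {RV P >-> R} := HB.pack X (isMeasurableFun.Build _ _ _ _ X mX).
pose Y' : {RV P >-> R} := HB.pack Y (isMeasurableFun.Build _ _ _ _ Y mY).
pose Z w := (X w, Y w).
have mZ : measurable_fun setT Z by exact: measurable_fun_pair.
pose Z' : {mfun Omega >-> (R * R)%type} := HB.pack Z (isMeasurableFun.Build _ _ _ _ Z mZ).
pose mx := distribution P X'; pose my := distribution P Y'.
have joint := @product_measure_unique _ _ _ _ R mx my (distribution P Z').
have {}joint A : measurable A -> (mx \x my)%E A = distribution P Z' A.
  by apply: joint => A' B' mA mB; rewrite -XY.
have mFG : measurable_fun setT (fun z : R * R => F z.1 * G z.2).
  by apply: measurable_funM; exact: measurableT_comp.
have mFX : measurable_fun setT (fun w => F (X w)) by exact: measurableT_comp.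
have mGY : measurable_fun setT (fun w => G (Y w)) by exact: measurableT_comp.
have lF : L1 mx F by apply: (@L1_bounded _ _ _ mx _ C).
have lG : L1 my G by apply: (@L1_bounded _ _ _ my _ D).
have C0 : 0 <= C by apply: le_trans (FC 0).
have b x y : `|F x * G y| <= cst C x * cst D y by rewrite normrM ler_pM.
have lC : L1 mx (cst C) by exact: finite_measure_integrable_cst.
have lD : L1 my (cst D) by exact: finite_measure_integrable_cst.
have lFG := @L1_prod _ _ _ _ R mx my (fun x y => F x * G y) (cst C) (cst D) mFG lC lD b.
have EX : \int[mx]_x F x = \int[P]_w F (X w).
  by rewrite /Rintegral integral_distribution//; [exact/measurable_EFinP|apply: L1_bounded mFX _ => w; exact: FC].
have EY : \int[my]_x G x = \int[P]_w G (Y w).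
  by rewrite /Rintegral integral_distribution//; [exact/measurable_EFinP|apply: L1_bounded mGY _ => w; exact: GD].
rewrite -EX -EY.
transitivity (\int[(mx \x my)%E]_z (F z.1 * G z.2)).
  rewrite /Rintegral (@eq_measure_integral _ _ _ setT (distribution P Z') (mx \x my)%E); last first.
    by move=> A mA _; exact: joint.
  rewrite integral_distribution//; first exact/measurable_EFinP.
  apply: (@L1_bounded _ _ _ P (fun w => F (X w) * G (Y w)) (C * D)).
    exact: measurable_funM.
  by move=> w; exact: b.
transitivity (\int[mx]_x \int[my]_y (F x * G y)).
  rewrite {1}/Rintegral -(integral12_prod_meas1 lFG) /Rintegral; congr fine.
  apply: eq_integral => x _; rewrite [RHS]EFin_Rintegral//.
  exact: L1Z.
rewrite -(RintegralZr _ measurableT lF); apply: eq_Rintegral => x _.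
exact: (RintegralZl _ measurableT lG).
Qed.

End Independence.

Section Subordination.
Context {d : measure_display} {Omega : measurableType d} {R : realType}.
Variable P : probability Omega R.
Variables (S : R -> Omega -> R) (T : Omega -> R).
Hypotheses (mS : forall s, 0 <= s -> measurable_fun setT (S s))
  (mT : measurable_fun setT T) (T0 : forall w, 0 <= T w)
  (ST : forall s, 0 <= s -> independent P (S s) T)
  (rcS : {ae P, forall w, forall t, 0 <= t -> S s w @[s --> t^'+] --> S t w}).

(** The grid of mesh [1 / n.+1] meets the half-line [> t] first at [grid n t]. *)
Let node n k : R := k.+1%:R / n.+1%:R.
Let grid n (t : R) := node n (Num.truncn (t * n.+1%:R)).
Let cell n k : set R := [set t | k%:R <= t * n.+1%:R < k.+1%:R].

Let node_ge0 n k : 0 <= node n k.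
Proof. by rewrite divr_ge0. Qed.

Let measurable_cell n k : measurable (cell n k).
Proof.
have m1 : measurable_fun setT (fun t : R => k%:R <= t * n.+1%:R < k.+1%:R).
  have m2 : measurable_fun setT (fun t : R => t * n.+1%:R).
    by apply: measurable_funM => //; exact: measurable_cst.
  apply: measurable_and; [apply: measurable_fun_ler => //; exact: measurable_cst|].
  by apply: measurable_fun_ltr => //; exact: measurable_cst.
rewrite (_ : cell n k = setT `&` (fun t : R => k%:R <= t * n.+1%:R < k.+1%:R) @^-1` [set true]).
  exact: m1.
by rewrite setTI; apply/seteqP; split.
Qed.

Let measurable_Tcell n k : measurable (T @^-1` cell n k).
Proof. by rewrite -[X in measurable X]setTI; apply: mT => //; exact: measurable_cell. Qed.

Let measurable_Tindic n k : measurable_fun setT (fun w => \1_(cell n k) (T w) : R).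
Proof.
rewrite (_ : (fun w => _) = \1_(T @^-1` cell n k)); first exact: measurable_indic.
by apply/funext => w; rewrite !indicE.
Qed.

Let grid_cell n k t : cell n k t -> grid n t = node n k.
Proof. by move=> /= H; rewrite /grid (truncn_def H). Qed.

Let cell_cover n t : 0 <= t -> cell n (Num.truncn (t * n.+1%:R)) t.
Proof. by move=> t0; apply: truncn_itv; rewrite mulr_ge0. Qed.

Let bigcup_cell n : \bigcup_k (T @^-1` cell n k) = setT.
Proof.
apply/seteqP; split => // w _; exists (Num.truncn (T w * n.+1%:R)) => //.
exact: cell_cover.
Qed.

Let trivIset_cell n : trivIset setT (fun k => T @^-1` cell n k).
Proof.
apply/trivIsetP => j k _ _ jk; apply/seteqP; split => // w /= [/truncn_def jw /truncn_def kw].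
by move: jk; rewrite -jw kw eqxx.
Qed.

Let grid_gt n t : 0 <= t -> t < grid n t.
Proof.
by move=> /(cell_cover n) /andP[_ h]; rewrite /grid /node ltr_pdivlMr.
Qed.

Let grid_cvg t : 0 <= t -> grid n t @[n --> \oo] --> t.
Proof.
move=> t0; apply/cvgrPdist_le => e e0.
have [N _ HN] := near_infty_natSinv_lt (PosNum e0).
exists N => // n /= Nn; have {}HN : n.+1%:R^-1 < e := HN n Nn.
rewrite distrC gtr0_norm ?subr_gt0 ?grid_gt//; apply: ltW; apply: le_lt_trans HN.
rewrite lerBlDr /grid /node -natr1 mulrDl mul1r addrC lerD2l ler_pdivrMr//.
by have /andP[] := cell_cover n t0.
Qed.

Let grid_limit t (p : R -> R) : p s @[s --> t^'+] --> p t -> 0 <= t ->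
  p (grid n t) @[n --> \oo] --> p t.
Proof.
move=> /cvg_at_rightP pt t0; apply: (pt (fun n => grid n t)); split.
  by move=> n; exact: grid_gt.
exact: grid_cvg.
Qed.

Let measurable_grid n (H : R -> Omega -> R) : (forall s, 0 <= s -> measurable_fun setT (H s)) ->
  measurable_fun setT (fun w => H (grid n (T w)) w).
Proof.
move=> mH _ B mB; rewrite setTI.
have -> : (fun w => H (grid n (T w)) w) @^-1` B =
    \bigcup_k (T @^-1` cell n k `&` (H (node n k) @^-1` B)).
  apply/seteqP; split => [w /= Bw|w [k _ [/grid_cell E /=]]]; last by rewrite E.
  by exists (Num.truncn (T w * n.+1%:R)) => //; split => //; exact: cell_cover.
apply: bigcupT_measurable => k; apply: measurableI => //.
by rewrite -[X in measurable X]setTI; apply: mH.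
Qed.

Let grid_eq n (G H : R -> Omega -> R) C D : 
  (forall s, 0 <= s -> measurable_fun setT (G s)) -> (forall s w, `|G s w| <= C) ->
  (forall s, 0 <= s -> measurable_fun setT (H s)) -> (forall s w, `|H s w| <= D) ->
  (forall k, \int[P]_w (\1_(cell n k) (T w) * G (node n k) w) =
             \int[P]_w (\1_(cell n k) (T w) * H (node n k) w)) ->
  \int[P]_w G (grid n (T w)) w = \int[P]_w H (grid n (T w)) w.
Proof.
move=> mG GC mH HD GH.
have main (K : R -> Omega -> R) B : (forall s, 0 <= s -> measurable_fun setT (K s)) ->
    (forall s w, `|K s w| <= B) ->
    (\int[P]_w (K (grid n (T w)) w)%:E =
     \sum_(k <oo) (\int[P]_w (\1_(cell n k) (T w) * K (node n k) w))%:E)%E.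
  move=> mK KB; rewrite -[in LHS](bigcup_cell n) integral_bigcup//; last first.
    rewrite bigcup_cell; apply: L1_bounded => //; exact: measurable_grid.
  apply: eq_eseriesr => k _; rewrite EFin_Rintegral; last first.
    apply: (@L1M_bounded _ _ _ P _ _ 1).
    - exact: measurable_Tindic.
    - by move=> w; rewrite indicE; case: (_ \in _); rewrite ?normr1 ?normr0.
    - apply: L1_bounded; [exact: mK|exact: KB].
  rewrite integral_mkcond; apply: eq_integral => w _.
  rewrite patchE indicE (_ : (T w \in cell n k) = (w \in T @^-1` cell n k))//.
  case: ifPn => [/set_mem/grid_cell ->|_].
    by rewrite mul1r.
  by rewrite mul0r.
rewrite /Rintegral (main G C)// (main H D)//; congr fine.
by apply: eq_eseriesr => k _; rewrite GH.
Qed.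

(** By right-continuity the value at the random time is the limit of the values
    at its grid approximations, which are measurable cell by cell. *)
Lemma measurable_subordinate : exists Y, measurable_fun setT Y /\
  {ae P, forall w, Y w = S (T w) w}.
Proof.
have [N [mN N0 HN]] := rcS.
have rc w : ~ N w -> forall t, 0 <= t -> S s w @[s --> t^'+] --> S t w.
  by move=> Nw; apply: contrapT => H; apply: Nw; exact: HN.
exists (fun w => \1_(~` N) w * S (T w) w); split; last first.
  exists N; split => // w; apply: contra_notP => wN.
  by rewrite /= indicE mem_set// mul1r.
apply: (@measurable_fun_cvg _ _ _ setT (fun n w => \1_(~` N) w * S (grid n (T w)) w)).
  move=> n; apply: measurable_funM; first by apply: measurable_indic; exact: measurableC.
  exact: measurable_grid.
move=> w _; rewrite indicE; have [/set_mem /rc wN|_] := boolP (w \in ~` N); last first.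
  by under eq_cvg do rewrite mul0r; rewrite mul0r; exact: cvg_cst.
under eq_cvg do rewrite mul1r; rewrite mul1r.
exact: grid_limit (wN _ (T0 w)) _.
Qed.

(** Conditioning on the clock. For the grid approximations of the clock the
    identity is the product rule on each of countably many cells; dominated
    convergence removes the grid. *)
Lemma subordination_mean Y (F psi q : R -> R) (C D E : R) : measurable_fun setT Y ->
  {ae P, forall w, Y w = S (T w) w} ->
  continuous F -> (forall x, `|F x| <= C) ->
  continuous psi -> (forall s, 0 <= s -> `|psi s| <= D) ->
  measurable_fun setT q -> (forall x, 0 <= x -> `|q x| <= E) ->
  (forall s, 0 <= s -> \int[P]_w F (S s w) = psi s) ->
  \int[P]_w (F (Y w) * q (T w)) = \int[P]_w (psi (T w) * q (T w)).
Proof.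
move=> mY YS cF FC cpsi psiD mq qE Fpsi.
have mF : measurable_fun setT F by exact: continuous_measurable_fun.
have mpsi : measurable_fun setT psi by exact: continuous_measurable_fun.
have mqT : measurable_fun setT (fun w => q (T w)) by exact: measurableT_comp.
have C0 : 0 <= C by apply: le_trans (FC 0).
have D0 : 0 <= D by apply: le_trans (psiD 0 _).
have E0 : 0 <= E by apply: le_trans (qE 0 _).
have lC k : L1 P (cst k : Omega -> R) by exact: finite_measure_integrable_cst.
have mFS s : 0 <= s -> measurable_fun setT (fun w => F (S s w)) by move=> /mS mSs; exact: measurableT_comp.
have bF s w : `|F (S s w) * q (T w)| <= C * E by rewrite normrM ler_pM// qE.
have mG s : 0 <= s -> measurable_fun setT (fun w => F (S s w) * q (T w)).
  by move=> s0; apply: measurable_funM => //; exact: mFS.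
pose psi0 s := psi (Num.max s 0).
have bP s w : `|psi0 s * q (T w)| <= D * E.
  by rewrite normrM ler_pM// ?qE// psiD// le_max lexx orbT.
have mH s : 0 <= s -> measurable_fun setT (fun w => psi0 s * q (T w)).
  by move=> s0; apply: measurable_funM => //; exact: measurable_cst.
have psi0E s : 0 <= s -> psi0 s = psi s by move=> s0; rewrite /psi0 max_l.
have eqn n : \int[P]_w (F (S (grid n (T w)) w) * q (T w)) =
    \int[P]_w (psi0 (grid n (T w)) * q (T w)).
  apply: (@grid_eq n (fun s w => F (S s w) * q (T w)) (fun s w => psi0 s * q (T w)) _ _ mG bF mH bP) => k.
  have s0 := node_ge0 n k; set s := node n k in s0 *.
  pose G t : R := \1_(cell n k) t * (if 0 <= t then q t else 0).
  have mGq : measurable_fun setT G.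
    apply: measurable_funM; first by apply: measurable_indic; exact: measurable_cell.
    by apply: measurable_fun_ifT => //; apply: measurable_fun_ler => //; exact: measurable_cst.
  have GE t : `|G t| <= E.
    rewrite /G indicE; case: (_ \in _); rewrite ?mul1r ?mul0r ?normr0//.
    by case: ifP => [/qE//|_]; rewrite normr0.
  have := Rintegral_independent (mS s0) mT (ST s0) mF mGq FC GE.
  rewrite Fpsi// => H.
  transitivity (\int[P]_w (F (S s w) * G (T w))).
    by apply: eq_Rintegral => w _; rewrite /G T0; ring.
  rewrite H psi0E//; rewrite -RintegralZl//; last first.
    apply: (@L1_bounded _ _ _ P _ E); first exact: measurableT_comp.
    by move=> w; exact: GE.
  by apply: eq_Rintegral => w _; rewrite /G T0; ring.
have lim1 : \int[P]_w (F (S (grid n (T w)) w) * q (T w)) @[n --> \oo] --> \int[P]_w (F (Y w) * q (T w)).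
  apply: (@Rintegral_dominated _ _ _ P _ _ (cst (C * E))) => //.
  - by move=> n; exact: (measurable_grid _ mG).
  - by apply: measurable_funM => //; exact: measurableT_comp.
  - have := aeI YS rcS; apply: aeS => w [-> /(_ _ (T0 w)) cw].
    apply: cvgM; last exact: cvg_cst.
    exact: cvg_comp (grid_limit cw (T0 w)) (cF _).
  - by apply: aeW => w n; exact: bF.
have lim2 : \int[P]_w (psi0 (grid n (T w)) * q (T w)) @[n --> \oo] --> \int[P]_w (psi (T w) * q (T w)).
  apply: (@Rintegral_dominated _ _ _ P _ _ (cst (D * E))) => //.
  - by move=> n; exact: (measurable_grid _ mH).
  - by apply: measurable_funM => //; exact: measurableT_comp.
  - apply: aeW => w; apply: cvgM; last exact: cvg_cst.
    under eq_cvg do rewrite psi0E ?node_ge0//.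
    exact: cvg_comp (grid_cvg (T0 w)) (cpsi _).
  - by apply: aeW => w n; exact: bP.
rewrite (funext eqn) in lim1; exact: (cvg_unique _ lim1 lim2).
Qed.

End Subordination.

Section AbsoluteContinuity.
Context {d : measure_display} {Omega : measurableType d} {R : realType}.
Variable P : probability Omega R.
Local Notation mu := (@lebesgue_measure R).
Variables (Y Q : Omega -> R) (E : R) (B : R -> R).
Hypotheses (mY : measurable_fun setT Y) (mQ : measurable_fun setT Q)
  (Q0 : forall w, 0 <= Q w) (QE : forall w, Q w <= E) (lB : L1 mu B)
  (cosQ : forall xi, `|\int[P]_w (cos (xi * Y w) * Q w)| <= B xi)
  (sinQ : forall xi, `|\int[P]_w (sin (xi * Y w) * Q w)| <= B xi).

Let nQ w : `|Q w| <= E. Proof. by rewrite ger0_norm. Qed.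

Let E0 : 0 <= E. Proof. by apply: le_trans (Q0 point) _. Qed.

Let lcos xi : L1 P (fun w => cos (xi * Y w) * Q w).
Proof.
apply: (@L1_bounded _ _ _ P _ E).
  by apply: measurable_funM => //; exact: measurable_cosY.
by move=> w; rewrite normrM -[leRHS]mul1r ler_pM// cos_le1_norm.
Qed.

Let lsin xi : L1 P (fun w => sin (xi * Y w) * Q w).
Proof.
apply: (@L1_bounded _ _ _ P _ E).
  by apply: measurable_funM => //; exact: measurable_sinY.
by move=> w; rewrite normrM -[leRHS]mul1r ler_pM// sin_le1_norm.
Qed.

(* The Poisson kernel is a superposition of cosines. *)
Let poisson_mean c h : 0 < h ->
  \int[P]_w (poisson h (c - Y w) * Q w) <= 2 * \int[mu]_xi B xi.
Proof.
move=> h0; have lh := L1_exp_half h0.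
have m2 : measurable_fun setT (fun z : Omega * measurableTypeR R => (z.2 : R)).
  by move: (@measurable_snd _ _ Omega (measurableTypeR R)).
have [] := @Fubini_dominated _ _ _ _ R P mu
  (fun w xi => exp_half h xi * cos ((c - Y w) * xi) * Q w) (cst E) (exp_half h).
- apply: measurable_funM; last exact: measurableT_comp.
  apply: measurable_funM; first exact: (measurableT_comp (measurable_exp_half h) m2).
  apply: measurable_cos_comp; apply: measurable_funM => //.
  by apply: measurable_funB => //; exact: measurableT_comp.
- exact: finite_measure_integrable_cst.
- exact: lh.
- move=> w xi; rewrite mulrC normrM ler_pM// normrM -[leRHS]mulr1 ler_pM ?cos_le1_norm//.
  by rewrite ger0_norm// exp_half_ge0.
move=> _ l2 F.
have -> : \int[P]_w (poisson h (c - Y w) * Q w) =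
    \int[P]_w \int[mu]_xi (exp_half h xi * cos ((c - Y w) * xi) * Q w).
  apply: eq_Rintegral => w _; rewrite -Rintegral_exp_half_cos// -RintegralZr//.
  apply: (@L1_ext _ _ _ mu (fun xi => cos ((c - Y w) * xi) * exp_half h xi)).
    by move=> xi; rewrite mulrC.
  apply: (@L1M_bounded _ _ _ mu _ _ 1) => //.
    exact: measurable_cos_mul.
  by move=> xi; exact: cos_le1_norm.
rewrite F -(RintegralZl _ measurableT lB).
apply: le_Rintegral => //; first exact: L1Z.
move=> xi _; have e0 := exp_half_ge0 h xi.
have e1 : exp_half h xi <= 1.
  rewrite /exp_half indicE; have [/set_mem/=|_] := boolP (xi \in _).
    by rewrite in_itv/= andbT mul1r => x0; rewrite -expR0 ler_expR oppr_le0 mulr_ge0// ltW.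
  by rewrite mul0r.
have -> : \int[P]_w (exp_half h xi * cos ((c - Y w) * xi) * Q w) =
    exp_half h xi * (cos (c * xi) * \int[P]_w (cos (xi * Y w) * Q w) +
      sin (c * xi) * \int[P]_w (sin (xi * Y w) * Q w)).
  rewrite -(RintegralZl _ measurableT (lcos xi)) -(RintegralZl _ measurableT (lsin xi)).
  rewrite -(RintegralD measurableT (L1Z _ (lcos xi)) (L1Z _ (lsin xi))).
  rewrite -(RintegralZl _ measurableT (L1D (L1Z _ (lcos xi)) (L1Z _ (lsin xi)))).
  by apply: eq_Rintegral => w _; rewrite mulrBl cosB (mulrC (Y w)); ring.
have B0 : 0 <= B xi by apply: le_trans (cosQ xi).
rewrite (le_trans (ler_norm _))// normrM (ger0_norm e0).
rewrite -[leRHS]mul1r ler_pM// (le_trans (ler_normD _ _))// !normrM mulr2n mulrDl !mul1r lerD//.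
  by rewrite -[leRHS]mul1r ler_pM ?cos_le1_norm.
by rewrite -[leRHS]mul1r ler_pM ?sin_le1_norm.
Qed.

Let K : R := 2 * \int[mu]_xi B xi.

Let K0 : 0 <= K.
Proof.
rewrite mulr_ge0// Rintegral_ge0// => xi _.
by apply: le_trans (cosQ xi).
Qed.

Let charge (A : set R) : \bar R := (\int[P]_(w in Y @^-1` A) (Q w)%:E)%E.

(* The indicator of an interval of half-length [h] is at most [2 * h] times a
   Poisson kernel of parameter [h]. *)
Let charge_itv a b : a < b -> (charge `]a, b]%classic <= (2 * K * (b - a))%:E)%E.
Proof.
move=> ab; pose h := (b - a) / 2; pose c := (a + b) / 2.
have h0 : 0 < h by rewrite divr_gt0// subr_gt0.
have mA : measurable (Y @^-1` `]a, b]) by rewrite -[X in measurable X]setTI; exact: mY.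
have mp : measurable_fun setT (fun w => poisson h (c - Y w)).
  have m1 : measurable_fun setT (fun w => c - Y w) by exact: measurable_funB.
  exact: (measurableT_comp (measurable_poisson h0) m1).
have lq : L1 P (fun w => poisson h (c - Y w) * Q w).
  apply: (@L1_bounded _ _ _ P _ (h^-1 * E)); first exact: measurable_funM.
  move=> w; rewrite normrM ler_pM//.
  rewrite ger0_norm ?poisson_ge0// /poisson ler_pdivrMr; last first.
    by rewrite ltr_pwDl ?exprn_gt0// sqr_ge0.
  by rewrite mulrDr expr2 mulKf ?gt_eqF// lerDl mulr_ge0 ?sqr_ge0// invr_ge0 ltW.
have le1 w : \1_(Y @^-1` `]a, b]) w * Q w <= 2 * h * (poisson h (c - Y w) * Q w).
  rewrite mulrA ler_wpM2r// indicE; have [/set_mem /=|_] := boolP (w \in _); last first.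
    by rewrite mulr_ge0 ?poisson_ge0// mulr_ge0// ltW.
  rewrite in_itv/= => /andP[aY Yb]; rewrite /poisson mulrA ler_pdivlMr ?mul1r; last first.
    by rewrite ltr_pwDl ?exprn_gt0// sqr_ge0.
  have : (c - Y w) ^+ 2 <= h ^+ 2.
    rewrite -[leLHS]real_normK ?num_real// lerXn2r ?nnegrE ?(ltW h0)// ler_norml /c /h; lra.
  rewrite !expr2; lra.
have l1 : L1 P (fun w => \1_(Y @^-1` `]a, b]) w * Q w).
  apply: (@L1_bounded _ _ _ P _ E).
    by apply: measurable_funM => //; exact: measurable_indic.
  by move=> w; rewrite indicE; case: (_ \in _); rewrite ?mul1r ?mul0r ?normr0.
have -> : charge `]a, b]%classic = (\int[P]_w (\1_(Y @^-1` `]a, b]) w * Q w))%:E.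
  rewrite (EFin_Rintegral l1) /charge [LHS]integral_mkcond; apply: eq_integral => w _.
  by rewrite patchE indicE; case: ifP => _; rewrite ?mul1r ?mul0r.
rewrite lee_fin.
have -> : 2 * K * (b - a) = 2 * (2 * h * K) by rewrite /h; field.
apply: (@le_trans _ _ (2 * h * \int[P]_w (poisson h (c - Y w) * Q w))).
  rewrite -(RintegralZl _ measurableT lq); apply: le_Rintegral => //.
  exact: L1Z.
apply: (@le_trans _ _ (2 * h * K)).
  by rewrite ler_wpM2l ?poisson_mean// mulr_ge0// ltW.
have h1 : 0 <= 2 * h * K by rewrite mulr_ge0// mulr_ge0// ltW.
by rewrite -[leLHS]mul1r ler_wpM2r// ler1n.
Qed.

(** A weighted law with integrable characteristic function gives to intervals a
    mass proportional to their length, hence does not charge null sets. *)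
Lemma weighted_law_null N : {ae P, forall w, 0 < Q w} -> mu.-negligible N ->
  {ae P, forall w, ~ N (Y w)}.
Proof.
move=> Qpos [M [mM M0 NM]].
have mYA A : measurable A -> measurable (Y @^-1` A).
  by move=> mA; rewrite -[X in measurable X]setTI; exact: mY.
have mI A : measurable A -> measurable_fun setT (fun w => \1_(Y @^-1` A) w * Q w).
  by move=> mA; apply: measurable_funM => //; apply: measurable_indic; exact: mYA.
have chargeE A : charge A = (\int[P]_w (\1_(Y @^-1` A) w * Q w)%:E)%E.
  rewrite /charge [LHS]integral_mkcond; apply: eq_integral => w _.
  by rewrite patchE indicE; case: ifP => _; rewrite ?mul1r ?mul0r.
have I0 A w : 0 <= \1_(Y @^-1` A) w * Q w by rewrite mulr_ge0// indicE ler0n.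
have cover e : 0 < e -> exists A : (set R)^nat, [/\ forall k, ocitv (A k),
    M `<=` \bigcup_k A k & (\sum_(k <oo) wlength idfun (A k) <= e%:E)%E].
  move=> e0.
  have fM : mu M \is a fin_num by rewrite M0.
  have [_ [A [mA MA] <-] Ae] := lb_ereal_inf_adherent e0 fM.
  exists A; split => //; apply: ltW.
  by move: Ae; rewrite -[X in (_ < X + _)%E -> _]/(mu M) M0 add0e.
have charge0 : charge M = 0%E.
  apply/eqP; rewrite eq_le; apply/andP; split; last first.
    by rewrite chargeE integral_ge0// => w _; rewrite lee_fin.
  apply/lee_addgt0Pr => e e0; rewrite add0e.
  have K1 : 0 < 2 * K + 1 by rewrite ltr_wpDl// mulr_ge0.
  have [|A [oA MA Ale]] := cover (e / (2 * K + 1)); first exact: divr_gt0.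
  have mA k : measurable (A k) by have [ab _ <-] := oA k; exact: measurable_itv.
  have cA k : (charge (A k) <= (2 * K + 1)%:E * wlength idfun (A k))%E.
    have [[a b] _ <-] := oA k; rewrite wlength_itv /= lte_fin; case: ltP => ab.
      rewrite (le_trans (charge_itv ab))// lee_fin ler_wpM2r ?subr_ge0 ?(ltW ab)//.
      by rewrite lerDl.
    by rewrite set_itv_ge ?bnd_simp -?leNgt// mule0 /charge preimage_set0 integral_set0.
  apply: (@le_trans _ _ (\sum_(k <oo) charge (A k))%E).
    under eq_eseriesr do rewrite chargeE.
    rewrite -integral_nneseries//; last 2 first.
    - by move=> k; apply/measurable_EFinP; exact: mI.
    - by move=> k w _; rewrite lee_fin.
    rewrite chargeE; apply: ge0_le_integral => //.
    - by move=> w _; rewrite lee_fin.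
    - by apply/measurable_EFinP; exact: mI.
    - apply: ge0_emeasurable_sum => [k w _ _|k _]; first by rewrite lee_fin.
      by apply/measurable_EFinP; exact: mI.
    move=> w _; rewrite {1}indicE; have [/set_mem /= /MA [k _ Ak]|_] := boolP (w \in _); last first.
      by rewrite mul0r; apply: nneseries_ge0 => k _ _; rewrite lee_fin.
    have nn n : (0 <= n)%N -> true -> (0 <= (\1_(Y @^-1` A n) w * Q w)%:E)%E by rewrite lee_fin.
    apply: le_trans (nneseries_lim_ge k.+1 nn).
    rewrite big_nat_recr//= indicE mem_set// leeDr// sume_ge0// => n _.
    by rewrite lee_fin.
  apply: (@le_trans _ _ (\sum_(k <oo) ((2 * K + 1)%:E * wlength idfun (A k)))%E).
    apply: lee_nneseries => [k _ _|k _]; last exact: cA.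
    by rewrite chargeE; apply: integral_ge0 => w _; rewrite lee_fin.
  rewrite nneseriesZl; last first.
    by move=> k _; have [ab _ <-] := oA k; exact: wlength_itv_ge0.
  apply: (@le_trans _ _ ((2 * K + 1)%:E * (e / (2 * K + 1))%:E)%E).
    by rewrite lee_pmul2l// lte_fin.
  by rewrite -EFinM lee_fin mulrC divfK ?gt_eqF.
have : (\int[P]_w `|(\1_(Y @^-1` M) w * Q w)%:E| = 0)%E.
  by rewrite -charge0 chargeE; apply: eq_integral => w _; rewrite /= ger0_norm.
have mIM : measurable_fun setT (fun w => (\1_(Y @^-1` M) w * Q w)%:E).
  by apply/measurable_EFinP; exact: mI.
move=> /(ae_eq_integral_abs P measurableT mIM) H.
have := aeI H Qpos; apply: aeS => w [/(_ I) [+] Qw] /NM Mw.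
by rewrite indicE mem_set// mul1r => E0'; move: Qw; rewrite E0' ltxx.
Qed.

End AbsoluteContinuity.

Section DensityLaw.
Context {d : measure_display} {Omega : measurableType d} {R : realType}.
Variable P : probability Omega R.
Local Notation mu := (@lebesgue_measure R).
Import HBNNSimple.

Lemma ge0_expectation_density (X : Omega -> R) (p f : R -> R) :
  measurable_fun setT X -> measurable_fun setT p -> (forall x, 0 <= p x) ->
  (forall B : set R, measurable B -> P (X @^-1` B) = (\int[mu]_(x in B) (p x)%:E)%E) ->
  measurable_fun setT f -> (forall x, 0 <= f x) ->
  (\int[P]_w (f (X w))%:E = \int[mu]_x (f x * p x)%:E)%E.
Proof.
move=> mX mp p0 law mf f0.
have mef : measurable_fun setT (fun x : measurableTypeR R => (f x)%:E) by exact/measurable_EFinP.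
have mp' : measurable_fun setT (p : measurableTypeR R -> R) by [].
pose s := nnsfun_approx measurableT mef.
have ms n : measurable_fun setT (s n : R -> R) by exact: (measurable_funP (s n)).
have cvs x : EFin \o s ^~ x @ \oo --> (f x)%:E.
  by apply: cvg_nnsfun_approx => // y _; rewrite lee_fin.
have s0 n x : 0 <= s n x by [].
have msX n : measurable_fun setT (fun w => s n (X w)) by exact: (measurableT_comp (ms n) mX).
have mono x m n : (m <= n)%N -> s m x <= s n x.
  by move=> mn; move/lefP: (nd_nnsfun_approx measurableT mef mn).
transitivity (limn (fun n => \int[P]_w (s n (X w))%:E)%E).
  rewrite -monotone_convergence//.
  - by apply: eq_integral => w _; apply/esym/cvg_lim => //; exact: cvs.
  - by move=> n; exact/measurable_EFinP.
  - by move=> n w _; rewrite lee_fin.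
  - by move=> w _ m n mn; rewrite lee_fin mono.
transitivity (limn (fun n => \int[mu]_x (s n x * p x)%:E)%E); last first.
  rewrite -monotone_convergence//.
  - apply: eq_integral => x _; apply/cvg_lim => //.
    have cr : s ^~ x @ \oo --> f x by exact: (fine_cvg (cvs x)).
    apply: (@cvg_EFin _ _ _ _ (fun n => (s n x * p x)%:E)); first exact: nearW.
    by apply: cvgM => //; exact: cvg_cst.
  - by move=> n; apply/measurable_EFinP/measurable_funM => //; exact: measurable_funP.
  - by move=> n x _; rewrite lee_fin mulr_ge0.
  - by move=> x _ m n mn; rewrite lee_fin ler_wpM2r ?mono.
congr (limn _); apply/funext => n.
have mA r : measurable (s n @^-1` [set r]) by exact: measurable_funPTI.
have mI r : measurable_fun setT (\1_(s n @^-1` [set r]) : R -> R).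
  by have := @measurable_indic _ _ R setT _ (mA r).
have snE x : s n x = \sum_(r \in range (s n)) r * \1_(s n @^-1` [set r]) x by rewrite fimfunE.
have r0 r x : 0 <= r * \1_(s n @^-1` [set r]) x :> R.
  rewrite indicE; have [/set_mem /= <-|_] := boolP (x \in _); last by rewrite mulr0.
  by rewrite mulr_ge0.
have mXA r : measurable (X @^-1` (s n @^-1` [set r])).
  by rewrite -[X in measurable X]setTI; apply: mX => //; exact: mA.
transitivity (\sum_(r \in range (s n)) \int[P]_w (r * \1_(s n @^-1` [set r]) (X w))%:E)%E.
  rewrite -ge0_integral_fsum//; last 2 first.
  - move=> r; apply/measurable_EFinP/measurable_funM; first exact: measurable_cst.
    exact: (measurableT_comp (mI r) mX).
  - by move=> r w _; rewrite lee_fin.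
  by apply: eq_integral => w _; rewrite [in LHS]snE -fsumEFin.
transitivity (\sum_(r \in range (s n)) \int[mu]_x (r * \1_(s n @^-1` [set r]) x * p x)%:E)%E; last first.
  rewrite -ge0_integral_fsum//; last 2 first.
  - move=> r; have : measurable_fun setT (fun x : R => r * \1_(s n @^-1` [set r]) x * p x).
      by apply: measurable_funM => //; apply: measurable_funM => //; exact: measurable_cst.
    by move=> m; apply/measurable_EFinP.
  - by move=> r x _; rewrite lee_fin mulr_ge0.
  apply: eq_integral => x _; rewrite fsumEFin//; congr EFin.
  by rewrite -mulr_fsuml -snE.
apply: eq_fsbigr => r /set_mem [x0 _ sr].
have r00 : 0 <= r by rewrite -sr.
transitivity (r%:E * P (X @^-1` (s n @^-1` [set r])))%E.
  under eq_integral do rewrite EFinM.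
  rewrite ge0_integralZl_EFin//; last first.
    by apply/measurable_EFinP; exact: (measurableT_comp (mI r) mX).
  congr (_ * _)%E; rewrite -[in RHS](setIT (X @^-1` _)) -(integral_indic P measurableT (mXA r)).
  by apply: eq_integral => w _; rewrite !indicE.
rewrite (law _ (mA r)); apply/esym; under eq_integral do rewrite -mulrA EFinM.
rewrite ge0_integralZl_EFin//; last 2 first.
- by move=> x _; rewrite lee_fin mulr_ge0.
- have : measurable_fun setT (fun x : R => \1_(s n @^-1` [set r]) x * p x) by exact: measurable_funM.
  by move=> m; apply/measurable_EFinP.
congr (_ * _)%E; rewrite [RHS]integral_mkcond; apply: eq_integral => x _.
by rewrite patchE indicE; case: ifP => _; rewrite ?mul1r ?mul0r.
Qed.

Section GammaLaw.
Variables (m rho t : R) (X : Omega -> R).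
Hypotheses (rho0 : 0 < rho) (mX : measurable_fun setT X)
  (law : forall B : set R, measurable B ->
    P (X @^-1` B) = (\int[mu]_(x in B) (gamma_density m rho t x)%:E)%E).
Local Notation p := (gamma_density m rho t).
Local Notation k := (m * t).

Let p_ge0 x : 0 <= p x.
Proof.
rewrite /gamma_density; case: ifP => // _.
rewrite !mulr_ge0 ?powR_ge0 ?expR_ge0// invr_ge0 /gamma_fun Rintegral_ge0// => y _.
by rewrite mulr_ge0 ?powR_ge0 ?expR_ge0.
Qed.

Let mp : measurable_fun setT p.
Proof.
apply: measurable_fun_ifT => //.
  by apply: measurable_fun_ler => //; exact: measurable_cst.
apply: measurable_funM.
  apply: measurable_funM; first exact: measurable_cst.
  exact: measurable_powR.
apply: measurableT_comp => //; apply: measurable_funM => //; exact: measurable_cst.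
Qed.

Let mass1 : (\int[mu]_x (p x)%:E = 1)%E.
Proof. by rewrite -law// preimage_setT probability_setT. Qed.

(** The Laplace transform rescales the density by [c := 1 + s / rho]; total mass
    one then gives the normalisation, whatever the value of the Gamma function. *)
Lemma gamma_laplace s : 0 <= s ->
  \int[P]_w expR (- (X w * s)) = expR (- (k * ln (1 + s / rho))).
Proof.
move=> s0; set c := 1 + s / rho.
have c0 : 0 < c by rewrite ltr_pwDl// divr_ge0// ltW.
have scale x : expR (- (x * s)) * p x = c * expR (- (k * ln c)) * p (c * x + 0).
  rewrite addr0 /gamma_density pmulr_rge0//; case: ifPn => x0; last by rewrite !mulr0.
  rewrite powRM ?(ltW c0)//.
  have -> : c `^ (k - 1) = expR (k * ln c) * c^-1.
    by rewrite /powR gt_eqF// mulrBl mul1r expRD expRN lnK.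
  have -> : - rho * (c * x) = - rho * x + - (x * s) by rewrite /c; field; rewrite gt_eqF.
  rewrite expRD expRN; move: ((gamma_fun k)^-1) => G; field.
  by rewrite gt_eqF// gt_eqF ?expR_gt0.
have mf : measurable_fun setT (fun x : R => expR (- (x * s))).
  apply: measurableT_comp => //; apply: measurable_funN; exact: measurable_funM.
have := ge0_expectation_density mX mp p_ge0 law mf (fun x => expR_ge0 _).
rewrite /Rintegral => ->; under eq_integral do rewrite scale EFinM.
have mp' : measurable_fun setT (fun x : measurableTypeR R => (p (c * x + 0))%:E).
  have h : measurable_fun setT (fun x : R => p (c * x + 0)).
    by apply: (measurableT_comp mp); exact: measurable_affine.
  by apply/measurable_EFinP.
rewrite ge0_integralZl_EFin//; last 2 first.
- by move=> x _; rewrite lee_fin.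
- by rewrite mulr_ge0 ?expR_ge0// ltW.
have mpe : measurable_fun setT (fun x : measurableTypeR R => (p x)%:E).
  by apply/measurable_EFinP; have := mp.
have p0e x : (0 <= (p x)%:E)%E by rewrite lee_fin.
have := ge0_integral_affine 0 c0 mpe p0e; rewrite mass1 => E.
by rewrite mulrC EFinM -muleA -E mule1.
Qed.

Lemma gamma_gt0 : {ae P, forall w, 0 < X w}.
Proof.
exists (X @^-1` `]-oo, 0]); split.
- by rewrite -[Y in measurable Y]setTI; apply: mX => //.
- rewrite law// [LHS]integral_mkcond (@integral_ae_eqT _ _ _ mu _ (cst 0%E)) ?integral_cst0//.
    by rewrite integral0.
  exists [set 0]; split; [exact: measurable_set1|exact: lebesgue_measure_set1|].
  move=> x; apply: contra_notP => /= x0.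
  rewrite patchE; case: ifP => // /set_mem /=; rewrite in_itv/= => xle.
  rewrite /gamma_density ifF//; apply/negbTE; rewrite -ltNge lt_neqAle xle andbT.
  exact/eqP.
- by move=> w /= /negP; rewrite -leNgt in_itv.
Qed.

End GammaLaw.
End DensityLaw.

(** * The law of the subordinated process *)

Lemma fine_expectation {d} {Omega : measurableType d} {R : realType}
  (P : probability Omega R) (X : Omega -> R) : fine 'E_P[X] = \int[P]_w X w.
Proof. by rewrite unlock. Qed.

Section SubordinatedLaw.
Context {d : measure_display} {Omega : measurableType d} {R : realType}.
Variable P : probability Omega R.
Local Notation mu := (@lebesgue_measure R).
Variables (alpha a m rho : R) (S Gam : R -> {RV P >-> R}).
Hypotheses (alpha0 : 0 < alpha) (a0 : 0 <= a) (m0 : 0 < m) (rho0 : 0 < rho)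
  (hS : symmetric_stable_process alpha S) (hG : gamma_subordinator m rho Gam)
  (SG : independent_processes S Gam).

(** The clock at time [t], made nonnegative everywhere. *)
Let T t w : R := Num.max (a * t + Gam t w) 0.

Let gamma_ge0 t : 0 <= t -> {ae P, forall w, 0 <= Gam t w}.
Proof.
move=> t0; have [[G0 _ _ _] mono _] := hG.
have := aeI G0 mono; apply: aeS => w [E h].
by rewrite -E; exact: h.
Qed.

Let clockE t : 0 <= t -> {ae P, forall w, T t w = a * t + Gam t w}.
Proof.
move=> t0; apply: aeS (gamma_ge0 t0) => w h.
by rewrite /T max_l// addr_ge0// mulr_ge0.
Qed.

Let clock_ge0 t w : 0 <= T t w.
Proof. by rewrite le_max lexx orbT. Qed.

Let max_affine t : measurable_fun setT (fun x : R => Num.max (a * t + x) 0).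
Proof.
apply: measurable_maxr; last exact: measurable_cst.
by apply: measurable_funD => //; exact: measurable_cst.
Qed.

Let measurable_clock t : measurable_fun setT (T t).
Proof. exact: (measurableT_comp (max_affine t) (measurable_funP (Gam t))). Qed.

Let clock_indep t s : 0 <= t -> 0 <= s -> independent P (S s) (T t).
Proof.
move=> t0 s0 A B mA mB; apply: SG; apply: sub_sigma_algebra.
  by exists s, A.
exists t, ((fun x : R => Num.max (a * t + x) 0) @^-1` B); split => //.
by rewrite -[X in measurable X]setTI; exact: max_affine.
Qed.

Let rcS : {ae P, forall w, forall t, 0 <= t -> S s w @[s --> t^'+] --> S t w}.
Proof. by have [[_ _ _ +] _] := hS; apply: aeS => w h t /h[]. Qed.

Let stable_charfun s : 0 <= s ->
  sym_charfun P (S s) (fun xi => expR (- (s * `|xi| `^ alpha))).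
Proof.
move=> s0; have [_ H] := hS; split; first exact: measurable_funP.
  move=> xi; have /eqP := H s xi s0; rewrite eq_complex /= => /andP[/eqP + _].
  by rewrite mulNr fine_expectation.
move=> xi; have /eqP := H s xi s0; rewrite eq_complex /= => /andP[_ /eqP].
by rewrite fine_expectation.
Qed.

Section Clock.
Variables (t : R) (Y : Omega -> R).
Hypotheses (t0 : 0 <= t) (mY : measurable_fun setT Y)
  (YS : {ae P, forall w, Y w = S (T t w) w}).

Let bT (sg : R) w : 0 <= sg -> `|expR (- (T t w * sg))| <= 1.
Proof.
by move=> sg0; rewrite ger0_norm ?expR_ge0// -expR0 ler_expR oppr_le0 mulr_ge0.
Qed.

(** Given the clock, the mean of a wave at the translated point is damped by the
    characteristic function of the stable process. Stating this for waves covers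
    sine and cosine at once. *)
Lemma clock_wave (c s x xi E : R) (q : R -> R) : measurable_fun setT q ->
  (forall u, 0 <= u -> `|q u| <= E) ->
  \int[P]_w (wave (cst c) (cst s) (x - Y w) xi * q (T t w)) =
  wave (cst c) (cst s) x xi * \int[P]_w (expR (- (T t w * `|xi| `^ alpha)) * q (T t w)).
Proof.
move=> mq qE; set sg := `|xi| `^ alpha.
have sg0 : 0 <= sg by exact: powR_ge0.
have mqT : measurable_fun setT (fun w => q (T t w)) by exact: measurableT_comp.
pose k := wave (cst c) (cst s) x xi.
pose psi u : R := k * expR (- (u * sg)).
rewrite (@subordination_mean _ _ _ P (fun s => S s) (T t) _ _ _ _ _ Y
  (fun y => wave (cst c) (cst s) (x - y) xi) psi q (`|c| + `|s|) `|k| E) => //.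
- rewrite -RintegralZl//; first by apply: eq_Rintegral => w _; rewrite /psi mulrA.
  apply: (@L1_bounded _ _ _ P _ E).
    apply: measurable_funM => //; apply: measurableT_comp => //; apply: measurable_funN.
    by apply: measurable_funM => //; exact: measurable_cst.
  by move=> w; rewrite normrM -[leRHS]mul1r ler_pM ?bT ?qE.
- by move=> s' s0; exact: clock_indep.
- move=> y; apply: cvgD; apply: cvgM; try exact: cvg_cst.
    apply: continuous_comp; last exact: continuous_cos.
    by apply: cvgM; [apply: cvgB; [exact: cvg_cst|exact: cvg_id]|exact: cvg_cst].
  apply: continuous_comp; last exact: continuous_sin.
  by apply: cvgM; [apply: cvgB; [exact: cvg_cst|exact: cvg_id]|exact: cvg_cst].
- by move=> y; exact: wave_le.
- move=> u; apply: cvgM; first exact: cvg_cst.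
  apply: continuous_comp; last exact: continuous_expR.
  by apply: continuousN; apply: cvgM; [exact: cvg_id|exact: cvg_cst].
- move=> u u0; rewrite /psi normrM ler_piMr// ger0_norm ?expR_ge0//.
  by rewrite -expR0 ler_expR oppr_le0 mulr_ge0.
- by move=> u u0; rewrite (average_wave (cst c) (cst s) x xi (stable_charfun u0)) mulrC.
Qed.

Lemma clock_laplace sg : 0 <= sg ->
  \int[P]_w expR (- (T t w * sg)) = expR (- (t * (a * sg + m * ln (1 + sg / rho)))).
Proof.
move=> sg0.
have mL (X : Omega -> R) : measurable_fun setT X -> measurable_fun setT (fun w => expR (- (X w * sg))).
  move=> mX; apply: measurableT_comp => //; apply: measurable_funN.
  by apply: measurable_funM => //; exact: measurable_cst.
transitivity (\int[P]_w (expR (- (a * t * sg)) * expR (- (Gam t w * sg)))).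
  apply: (@Rintegral_ae_eq _ _ _ P); apply: aeS (clockE t0) => w ->.
  by rewrite -expRD; congr expR; ring.
have G1 : \int[P]_w expR (- (Gam t w * sg)) = expR (- (m * t * ln (1 + sg / rho))).
  have [[G0 _ _ _] _ law] := hG.
  move: t0; rewrite le_eqVlt => /orP[/eqP <-|tpos].
    rewrite mulr0 mul0r oppr0 expR0 -[RHS](@Rintegral_P_cst _ _ _ P 1).
    by apply: (@Rintegral_ae_eq _ _ _ P); apply: aeS G0 => w ->; rewrite mul0r oppr0 expR0.
  by apply: (gamma_laplace rho0 (measurable_funP (Gam t))) => //; exact: law.
rewrite (Rintegral_ae_eq (g := fun w => expR (- (a * t * sg)) * expR (- (Num.max (Gam t w) 0 * sg)))).
  rewrite RintegralZl//; last first.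
    apply: (@L1_bounded _ _ _ P _ 1); first by apply: mL; apply: measurable_maxr => //; exact: measurable_cst.
    by move=> w; rewrite ger0_norm ?expR_ge0// -expR0 ler_expR oppr_le0 mulr_ge0// le_max lexx orbT.
  rewrite (Rintegral_ae_eq (g := fun w => expR (- (Gam t w * sg)))).
    rewrite G1 -expRD; congr expR; ring.
  by apply: aeS (gamma_ge0 t0) => w h; rewrite max_l.
by apply: aeS (gamma_ge0 t0) => w h; rewrite max_l.
Qed.

Lemma clock_charfun : sym_charfun P Y
  (fun xi => expR (- (t * (a * `|xi| `^ alpha + m * ln (1 + `|xi| `^ alpha / rho))))).
Proof.
have q1 (u : R) : 0 <= u -> `|1 : R| <= 1 by rewrite normr1.
split => // xi.
  have := @clock_wave 1 0 0 xi 1 (fun=> 1) (measurable_cst _) q1.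
  have -> : \int[P]_w (expR (- (T t w * `|xi| `^ alpha)) * 1) = \int[P]_w expR (- (T t w * `|xi| `^ alpha)).
    by apply: eq_Rintegral => w _; rewrite mulr1.
  rewrite clock_laplace ?powR_ge0// [in RHS]/wave mul0r cos0 !mulr0 addr0 !mul1r => <-.
  by apply: eq_Rintegral => w _; rewrite /wave mulr0 addr0 !mulr1 sub0r mulNr cosN mulrC.
have := @clock_wave 0 1 0 xi 1 (fun=> 1) (measurable_cst _) q1.
rewrite [in RHS]/wave mul0r sin0 mulr0 mul0r addr0 mul0r => H.
have lw : L1 P (fun w => wave (cst 0) (cst 1) (0 - Y w) xi * 1).
  apply: (@L1_ext _ _ _ P (fun w => -1 * sin (xi * Y w))).
    by move=> w; rewrite /wave mulr0 add0r !mulr1 sub0r [in RHS]mulNr sinN mulN1r (mulrC xi).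
  by apply: L1Z; exact: L1_sinY.
rewrite -[RHS](mulr0 (-1)) -H -(RintegralZl _ measurableT lw).
by apply: eq_Rintegral => w _; rewrite mulN1r /wave mulr0 add0r !mulr1 sub0r mulNr sinN opprK (mulrC xi).
Qed.

(** The weight [q u := u ^ k * exp (- u)] is positive at positive times, and the
    mean of [exp (- T sg) * q T] is at most [k! / (1 + sg) ^ k], which for
    [sg = |xi| ^ alpha] is integrable in [xi] as soon as [k * alpha >= 2]. *)
Lemma clock_null : 0 < t -> forall Q : R -> Prop, {ae mu, forall y, Q y} ->
  forall x, {ae P, forall w, Q (x - Y w)}.
Proof.
move=> tpos Q [N [mN N0 QN]] x.
pose k := Num.bound (2 / alpha).
have ka : 2 <= k%:R * alpha.
  by rewrite -ler_pdivrMr// ltW// archi_boundP// divr_ge0// ltW.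
pose q u : R := u ^+ k * expR (- u).
have mq : measurable_fun setT q.
  apply: measurable_funM; first exact: exprn_measurable.
  by apply: measurableT_comp => //; exact: measurable_funN.
have pw u sg : 0 <= u -> 0 <= sg -> expR (- (u * sg)) * q u <= k`!%:R / (1 + sg) ^+ k.
  move=> u0 sg0; rewrite ler_pdivlMr ?exprn_gt0 ?ltr_pwDl//.
  have v0 : 0 <= u * (1 + sg) by rewrite mulr_ge0// addr_ge0.
  have : (u * (1 + sg)) ^+ k <= k`!%:R * expR (u * (1 + sg)).
    move: (u * (1 + sg)) v0 => v v0.
    case: k {ka q mq} => [|k]; first by rewrite expr0 fact0 mul1r -[leLHS]expR0 ler_expR.
    rewrite mulrC -ler_pdivrMr ?ltr0n ?fact_gt0//.
    by rewrite (le_trans _ (expR_ge1Dxn k v0))// lerDr.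
  rewrite -(ler_pM2r (expR_gt0 (- (u * (1 + sg))))) -mulrA -expRD subrr expR0 mulr1.
  apply: le_trans; rewrite le_eqVlt; apply/orP; left; apply/eqP.
  by rewrite /q exprMn mulrDr mulr1 opprD expRD; ring.
have qE u : 0 <= u -> `|q u| <= k`!%:R.
  move=> u0; have := pw u 0 u0 (lexx 0).
  by rewrite mulr0 oppr0 expR0 mul1r addr0 expr1n divr1 ger0_norm// mulr_ge0 ?exprn_ge0 ?expR_ge0.
have pwp u xi : 0 <= u -> expR (- (u * `|xi| `^ alpha)) * q u <= 2 * k`!%:R * poisson 1 xi.
  move=> u0; have sg0 : 0 <= `|xi| `^ alpha by exact: powR_ge0.
  apply: le_trans (pw u _ u0 sg0) _.
  rewrite /poisson expr1n mul1r (mulrC 2) -mulrA ler_wpM2l//.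
  have x2 : 0 < 1 + xi ^+ 2 by rewrite ltr_pwDl// sqr_ge0.
  have s1 : 1 <= 1 + `|xi| `^ alpha by rewrite lerDl.
  rewrite -[leLHS]mul1r ler_pdivrMr ?exprn_gt0 ?(lt_le_trans _ s1)//.
  rewrite mulrAC ler_pdivlMr// mul1r.
  have [x1|x1] := leP `|xi| 1.
    have : xi ^+ 2 <= 1 by rewrite -(real_normK (num_real xi)) exprn_ile1.
    by have := exprn_ege1 k s1; lra.
  have : xi ^+ 2 <= (1 + `|xi| `^ alpha) ^+ k.
    apply: (@le_trans _ _ (`|xi| `^ alpha ^+ k)); last by rewrite lerXn2r ?nnegrE ?lerDr ?addr_ge0.
    rewrite -(powR_mulrn _ sg0) -powRrM -(real_normK (num_real xi)) -powR_mulrn//.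
    by rewrite ler_powR ?(ltW x1)// mulrC.
  have : 1 <= xi ^+ 2 by rewrite -(real_normK (num_real xi)) exprn_ege1// ltW.
  lra.
have q0 u : 0 <= u -> 0 <= q u by move=> u0; rewrite mulr_ge0 ?exprn_ge0 ?expR_ge0.
have mqT : measurable_fun setT (fun w => q (T t w)) by exact: measurableT_comp.
have mean xi : `|\int[P]_w (expR (- (T t w * `|xi| `^ alpha)) * q (T t w))| <= 2 * k`!%:R * poisson 1 xi.
  apply: Rintegral_P_le.
    apply: measurable_funM => //; apply: measurableT_comp => //; apply: measurable_funN.
    by apply: measurable_funM => //; exact: measurable_cst.
  by move=> w; rewrite ger0_norm ?pwp// mulr_ge0 ?expR_ge0 ?q0.
have mean' c s xi : `|wave (cst c) (cst s) x xi| <= 1 ->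
    `|\int[P]_w (wave (cst c) (cst s) (x - Y w) xi * q (T t w))| <= 2 * k`!%:R * poisson 1 xi.
  move=> w1; rewrite (clock_wave c s x xi mq qE) normrM -[leRHS]mul1r.
  by apply: ler_pM => //; exact: mean.
have := @weighted_law_null _ _ _ P (fun w => x - Y w) (fun w => q (T t w)) k`!%:R
   (fun xi => 2 * k`!%:R * poisson 1 xi) _ mqT _ _ _ _ _ [set y | ~ Q y].
case.
- exact: measurable_funB.
- by move=> w; exact: q0.
- by move=> w; rewrite -[leLHS]ger0_norm ?q0// qE.
- by apply: L1Z; exact: L1_poisson.
- move=> xi; apply: le_trans (mean' 1 0 xi _).
    rewrite le_eqVlt; apply/orP; left; apply/eqP; congr `|_|.
    by apply: eq_Rintegral => w _; rewrite /wave mulr0 addr0 mulr1 (mulrC xi).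
  by rewrite /wave mulr0 addr0 mulr1 cos_le1_norm.
- move=> xi; apply: le_trans (mean' 0 1 xi _).
    rewrite le_eqVlt; apply/orP; left; apply/eqP; congr `|_|.
    by apply: eq_Rintegral => w _; rewrite /wave mulr0 add0r mulr1 (mulrC xi).
  by rewrite /wave mulr0 add0r mulr1 sin_le1_norm.
- have [_ _ law] := hG.
  have := aeI (clockE t0) (gamma_gt0 (measurable_funP (Gam t)) (law t tpos)).
  apply: aeS => w [E Gw]; rewrite /q mulr_gt0 ?expR_gt0// exprn_gt0// E.
  by rewrite ltr_wpDl// mulr_ge0.
- by exists N; split.
move=> N' [mN' N'0 NN']; exists N'; split => // w nQ; apply: NN' => H.
exact: H nQ.
Qed.

End Clock.

(** The process is only known to have a measurable version, as it is evaluated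
    at a random time. Absolute continuity is what allows [f] to be changed on a
    null set under the expectation. *)
Theorem subordinated_law t : 0 <= t -> exists Y : Omega -> R,
  [/\ {ae P, forall w, subordinated a S Gam t w = Y w},
     sym_charfun P Y
       (fun xi => expR (- (t * (a * `|xi| `^ alpha + m * ln (1 + `|xi| `^ alpha / rho))))) &
     0 < t -> forall Q : R -> Prop, {ae mu, forall y, Q y} ->
       forall x, {ae P, forall w, Q (x - Y w)}].
Proof.
move=> t0; have mS s : 0 <= s -> measurable_fun setT (S s) by move=> _; exact: measurable_funP.
have [Y [mY YS]] := @measurable_subordinate _ _ _ P (fun s => S s) (T t) mS
  (measurable_clock t) (clock_ge0 t) rcS.
exists Y; split; [|exact: clock_charfun|exact: clock_null].
have := aeI YS (clockE t0); apply: aeS => w [-> E].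
by rewrite /subordinated -E.
Qed.

Lemma subordinated_time0 : {ae P, forall w, subordinated a S Gam 0 w = 0}.
Proof.
have [[S0 _ _ _] _] := hS; have [[G0 _ _ _] _ _] := hG.
have := aeI S0 G0; apply: aeS => w [Sw Gw].
by rewrite /subordinated Gw mulr0 addr0 Sw.
Qed.

End SubordinatedLaw.

(** * Generator, existence and uniqueness *)

Section Remainder.
Context {R : realType}.

Lemma expR_remainder (z : R) : `|z| <= 2^-1 -> `|expR z - 1 - z| <= 2 * z ^+ 2.
Proof.
move=> z1; have z2 : z <= 2^-1 by rewrite (le_trans (ler_norm z)).
have h1 : 0 <= expR z - 1 - z by have := expR_ge1Dx z; lra.
rewrite ger0_norm//.
have h2 : 1 - z <= expR (- z) by have := expR_ge1Dx (- z); lra.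
have h3 : expR z * (1 - z) <= 1.
  by rewrite (le_trans (ler_wpM2l (expR_ge0 z) h2))// -expRD subrr expR0.
have h4 : expR z <= 1 + z + 2 * z ^+ 2.
  have p : 0 < 1 - z by lra.
  rewrite -(ler_pM2r p) (le_trans h3)//.
  have : 0 <= z ^+ 2 * (1 - 2 * z) by rewrite mulr_ge0 ?sqr_ge0//; lra.
  rewrite expr2; lra.
lra.
Qed.

Lemma expR_lipschitz (z : R) : z <= 0 -> `|expR z - 1| <= - z.
Proof.
move=> z0; have : expR z <= 1 by rewrite -expR0 ler_expR.
by move=> h; have := expR_ge1Dx z; rewrite ler0_norm; lra.
Qed.

Lemma is_derive_littleo (F : R -> R) (t l : R) :
  (forall e, 0 < e -> exists2 d, 0 < d & forall h, `|h| <= d -> `|F (t + h) - F t - h * l| <= e * `|h|) ->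
  is_derive t 1 F l.
Proof.
move=> H.
have cv : (fun h : R => h^-1 *: (F (h *: 1 + t) - F t)) @ 0^' --> l.
  apply/cvgrPdist_le => e e0; have [d d0 Hd] := H e e0.
  near=> h.
  have h0 : h != 0 by near: h; exact: nbhs_dnbhs_neq.
  have hd : `|h| <= d.
    near: h; apply: dnbhs0_le; exact: d0.
  have := Hd h hd; rewrite /GRing.scale /= mulr1 (addrC h) => E.
  rewrite distrC -(ler_pM2r (_ : 0 < `|h|)) ?normr_gt0// -normrM.
  rewrite (_ : _ * h = F (t + h) - F t - h * l)//.
  by field.
apply: DeriveDef; first by apply: cvgP; exact: cv.
by apply/cvg_lim => //; exact: cv.
Unshelve. all: by end_near. Qed.

Lemma mul_small (M D e : R) : 0 <= M -> 0 <= D -> D <= e / (M + 1) -> M * D <= e.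
Proof.
move=> M0 D0; rewrite ler_pdivlMr ?ltr_wpDl// => h; apply: le_trans h.
by rewrite mulrC ler_wpM2l// lerDl.
Qed.

Lemma dist_le_min (A B b : R) : `|A - B| <= b -> `|A - B| <= `|A| - `|B| + 2 * Num.min `|B| b.
Proof.
move=> ABb; have t1 := ler_normB A B.
have t2 : `|B| <= `|A| + `|A - B| by rewrite -{1}(subKr A B) (le_trans (ler_normB _ _)).
by case: (leP `|B| b) => _; lra.
Qed.

Lemma increment_error (A B g k h : R) : A - B = k * h -> A - B - h * g = (k - g) * h.
Proof. by move=> ->; ring. Qed.

End Remainder.

Section Generator.
Context {R : realType}.
Local Notation mu := (@lebesgue_measure R).
Variables (alpha a m rho : R).
Hypotheses (alpha0 : 0 < alpha) (a0 : 0 <= a) (m0 : 0 < m) (rho0 : 0 < rho).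
Local Notation symb := (symb alpha rho).
Local Notation bandcut := (bandcut alpha rho).
Local Notation inband := (inband alpha rho).

Definition banded (c : R -> R) := forall xi, ~~ inband xi -> c xi = 0.

Lemma banded_cut h : banded (bandcut h).
Proof. by move=> xi /negbTE nb; rewrite /bandcut nb andbF. Qed.

(** The symbol of the generator [a D + m P], the characteristic function of the
    process, and the multiplier of the semigroup; the last two agree on the
    band. *)
Definition psi (xi : R) : R := - (a * symb xi + m * ln (1 + symb xi / rho)).
Definition charf (t xi : R) : R :=
  expR (- (t * (a * `|xi| `^ alpha + m * ln (1 + `|xi| `^ alpha / rho)))).
Definition evol (t xi : R) : R := expR (t * psi xi).
Definition psi_bound : R := a * rho + m * ln 2.

Lemma charf_banded t c xi : banded c -> charf t xi * c xi = evol t xi * c xi.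
Proof.
move=> bc; have [b|nb] := boolP (inband xi); last by rewrite bc// !mulr0.
by rewrite /charf /evol /psi /symb b mulrN.
Qed.

Lemma psi_le0 xi : psi xi <= 0.
Proof.
have /andP[l0 _] := log_symb alpha rho0 xi.
by rewrite oppr_le0 addr_ge0 ?mulr_ge0 ?symb_ge0// ltW.
Qed.

Lemma multiplier_psi : multiplier psi psi_bound.
Proof.
split.
  apply: measurable_funN; apply: measurable_funD; apply: measurable_funM; try exact: measurable_cst.
    exact: measurable_symb.
  exact: (measurable_log_symb _ _).
move=> xi; rewrite ler0_norm ?psi_le0// opprK /psi_bound lerD//.
  by rewrite ler_wpM2l// symb_le.
by rewrite ler_pM2l//; case/andP: (log_symb alpha rho0 xi).
Qed.

Lemma psi_bound_ge0 : 0 <= psi_bound.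
Proof. exact: multiplier_ge0 multiplier_psi. Qed.

Lemma evol_gt0 t xi : 0 < evol t xi. Proof. exact: expR_gt0. Qed.

Lemma evol_le1 t xi : 0 <= t -> evol t xi <= 1.
Proof. by move=> t0; rewrite -expR0 ler_expR mulr_ge0_le0 ?psi_le0. Qed.

Lemma evolD s t xi : evol (s + t) xi = evol s xi * evol t xi.
Proof. by rewrite /evol mulrDl expRD. Qed.

Lemma evol0 xi : evol 0 xi = 1. Proof. by rewrite /evol mul0r expR0. Qed.

Lemma multiplier_evol t : 0 <= t -> multiplier (evol t) 1.
Proof.
move=> t0; split; last by move=> xi; rewrite gtr0_norm ?evol_gt0 ?evol_le1.
apply: measurableT_comp => //; apply: measurable_funM; first exact: measurable_cst.
by case: multiplier_psi.
Qed.

Lemma evol_lipschitz s t : 0 <= s -> 0 <= t ->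
  multiplier (fun xi => evol t xi - evol s xi) (psi_bound * `|t - s|).
Proof.
move=> s0 t0; split; first by have [] := multiplierB (multiplier_evol t0) (multiplier_evol s0).
move=> xi; wlog st : s t s0 t0 / s <= t => [H|].
  by have [st|/ltW ts] := leP s t; [exact: H|rewrite distrC (distrC t); exact: H].
have -> : evol t xi - evol s xi = evol s xi * (evol (t - s) xi - 1).
  by rewrite mulrBr mulr1 -evolD (addrC s) subrK.
rewrite normrM gtr0_norm ?evol_gt0// -[leRHS]mul1r ler_pM ?(ltW (evol_gt0 _ _)) ?evol_le1//.
have ts0 : 0 <= t - s by rewrite subr_ge0.
rewrite (le_trans (expR_lipschitz _))//; first by rewrite mulr_ge0_le0 ?psi_le0.
rewrite ger0_norm// mulrC -mulNr ler_wpM2r//.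
by have [_ /(_ xi)] := multiplier_psi; rewrite ler0_norm ?psi_le0.
Qed.

Lemma evol_remainder t h : 0 <= t -> 0 <= t + h -> `|h| * psi_bound <= 2^-1 ->
  multiplier (fun xi => evol (t + h) xi - evol t xi - h * (psi xi * evol t xi))
    (2 * psi_bound ^+ 2 * h ^+ 2).
Proof.
move=> t0 th0 hK; have mp := multiplier_psi; have [_ pb] := mp.
split.
  have [] := multiplierB (multiplierB (multiplier_evol th0) (multiplier_evol t0))
    (multiplierZ h (multiplierM mp (multiplier_evol t0))).
  by [].
move=> xi.
have -> : evol (t + h) xi - evol t xi - h * (psi xi * evol t xi) =
    evol t xi * (expR (h * psi xi) - 1 - h * psi xi) by rewrite evolD /(evol h); ring.
have hp : `|h * psi xi| <= 2^-1.
  by rewrite normrM (le_trans _ hK)// ler_wpM2l.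
rewrite normrM gtr0_norm ?evol_gt0// -[leRHS]mul1r ler_pM ?(ltW (evol_gt0 _ _)) ?evol_le1//.
rewrite (le_trans (expR_remainder hp))// exprMn -mulrA ler_wpM2l// mulrC ler_wpM2r ?sqr_ge0//.
by rewrite -(real_normK (num_real (psi xi))) lerXn2r ?nnegrE ?psi_bound_ge0.
Qed.

Lemma multiplier_symbN n : multiplier (fun xi => (- symb xi) ^+ n) (rho ^+ n).
Proof.
apply: multiplierX; split; first by apply: measurable_funN; exact: measurable_symb.
by move=> xi; rewrite normrN ger0_norm ?symb_ge0 ?symb_le.
Qed.

Lemma synth_banded_lipschitz c r e C : L1 mu (bandcut c) -> L1 mu (bandcut r) -> multiplier e C ->
  exists K, forall x y, `|synth (bandcut c) (bandcut r) e x - synth (bandcut c) (bandcut r) e y| <= K * `|x - y|.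
Proof.
move=> lc lr me; exists (C * bandwidth alpha rho * mass (bandcut c) (bandcut r)).
apply: (synth_lipschitz lc lr me); first exact: powR_ge0.
by move=> xi h; rewrite !cut_supp.
Qed.

Lemma lipschitz_continuous (f : R -> R) K : (forall x y, `|f x - f y| <= K * `|x - y|) -> continuous f.
Proof.
move=> fK x; apply/cvgrPdist_le => e e0.
have K0 : 0 < `|K| + 1 by rewrite ltr_wpDl.
apply/nbhs_ballP; exists (e / (`|K| + 1)) => /=; first exact: divr_gt0.
move=> y; rewrite /ball /= => /ltW xy; rewrite (le_trans (fK _ _))//.
apply: (@le_trans _ _ (`|K| * `|x - y|)); last exact: mul_small.
by rewrite ler_wpM2r// ler_norm.
Qed.

Section Evolution.
Context {d : measure_display} {Omega : measurableType d}.
Variable P : probability Omega R.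
Hypothesis law : forall t, 0 <= t -> exists Y, sym_charfun P Y (charf t).

Lemma average_banded t Y c r e C x : sym_charfun P Y (charf t) -> L1 mu c -> L1 mu r ->
  banded c -> banded r -> multiplier e C ->
  average P Y (synth c r e) x = synth c r (fun xi => evol t xi * e xi) x.
Proof.
move=> cY lc lr bc br me; rewrite (average_synth x cY lc lr me).
by apply: synth_ext => xi; rewrite -!mulrA ![e xi * _]mulrC !mulrA charf_banded.
Qed.

Lemma averageB Y phi h k C D x : sym_charfun P Y phi -> continuous h -> continuous k ->
  (forall y, `|h y| <= C) -> (forall y, `|k y| <= D) ->
  average P Y (fun y => h y - k y) x = average P Y h x - average P Y k x.
Proof.
move=> [mY _ _] ch ck hC kD.
have L (g : R -> R) E : continuous g -> (forall y, `|g y| <= E) -> L1 P (fun w => g (x - Y w)).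
  move=> cg gE; apply: (@L1_bounded _ _ _ P _ E) => //.
  apply: (measurableT_comp (f := g) (g := fun w => x - Y w)); last exact: measurable_funB.
  exact: continuous_measurable_fun.
by rewrite /average (RintegralB measurableT (L _ _ ch hC) (L _ _ ck kD)).
Qed.

Lemma synth_evol_remainder c r t h x : L1 mu c -> L1 mu r -> 0 <= t -> 0 <= t + h ->
  `|h| * psi_bound <= 2^-1 ->
  `|synth c r (evol (t + h)) x - synth c r (evol t) x -
     h * synth c r (fun xi => psi xi * evol t xi) x| <=
  2 * psi_bound ^+ 2 * h ^+ 2 * mass c r.
Proof.
move=> lc lr t0 th0 hK; have mpe := multiplierM multiplier_psi (multiplier_evol t0).
have mB := multiplierB (multiplier_evol th0) (multiplier_evol t0).
rewrite -(synthB x lc lr (multiplier_evol th0) (multiplier_evol t0)) -(synthZ h x lc lr mpe).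
rewrite -(synthB x lc lr mB (multiplierZ h mpe)).
exact: synth_le lc lr (evol_remainder t0 th0 hK).
Qed.

Lemma average_sup Y phi (h : R -> R) C x : sym_charfun P Y phi -> continuous h ->
  (forall y, `|h y| <= C) -> `|average P Y h x| <= C.
Proof.
move=> [mY _ _] ch hC; apply: Rintegral_P_le => //.
apply: (measurableT_comp (f := h) (g := fun w => x - Y w)); last exact: measurable_funB.
exact: continuous_measurable_fun.
Qed.

Section Orbit.
Variables (f Pf : R -> R) (Df : nat -> R -> R).
Hypotheses (hD : riesz_iterates alpha f Df) (hP : is_frac_log rho^-1 Df Pf).
Local Notation c := (bandcut (fcos f)).
Local Notation r := (bandcut (fsin f)).

(** The iterates evolved up to time [t]; at time [0] the first one is the
    continuous version of [f]. *)
Definition orbit t n : R -> R := synth c r (fun xi => evol t xi * (- symb xi) ^+ n).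

Let lc : L1 mu c. Proof. by have [[]] := spectral_representation alpha0 rho0 hD hP. Qed.
Let lr : L1 mu r. Proof. by have [[]] := spectral_representation alpha0 rho0 hD hP. Qed.

Let multiplier_orbit t n : 0 <= t -> multiplier (fun xi => evol t xi * (- symb xi) ^+ n) (1 * rho ^+ n).
Proof. by move=> t0; apply: multiplierM; [exact: multiplier_evol|exact: multiplier_symbN]. Qed.

Lemma orbit_bounded t n : 0 <= t -> exists C, forall x, `|orbit t n x| <= C.
Proof. by move=> t0; eexists => x; exact: (synth_le x lc lr (multiplier_orbit n t0)). Qed.

Lemma orbit_lipschitz t n : 0 <= t -> exists K, forall x y, `|orbit t n x - orbit t n y| <= K * `|x - y|.
Proof. by move=> t0; exact: (synth_banded_lipschitz lc lr (multiplier_orbit n t0)). Qed.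

Lemma continuous_orbit t n : 0 <= t -> continuous (orbit t n).
Proof. by move=> /(orbit_lipschitz n) [K]; exact: lipschitz_continuous. Qed.

Lemma orbit0 n x : orbit 0 n x = synth c r (fun xi => (- symb xi) ^+ n) x.
Proof. by apply: synth_ext => xi; rewrite evol0 mul1r. Qed.

Lemma orbit0_iterate n x : orbit 0 n.+1 x = Df n.+1 x.
Proof. by have [_ -> _ _] := spectral_representation alpha0 rho0 hD hP; rewrite orbit0. Qed.

Lemma orbit0_ae : {ae mu, forall x, f x = orbit 0 0 x}.
Proof.
have [_ _ fE _] := spectral_representation alpha0 rho0 hD hP.
have [D0 DR _] := hD; have Lf : Lc f by rewrite -D0; case: (DR 0%N).
have [cf _] := Lc_borel Lf; apply: aeS cf => x cx.
by rewrite fE// orbit0; apply: synth_ext => xi.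
Qed.

Lemma L1_orbit0 n : L1 mu (orbit 0 n).
Proof.
have c0 := @continuous_orbit 0 n (lexx 0).
have mo : measurable_fun setT (orbit 0 n) by exact: continuous_measurable_fun.
have [D0 DR _] := hD; case: n mo c0 => [|n] mo c0; last first.
  by apply: Lc_L1 => //; rewrite (funext (orbit0_iterate n)); case: (DR n).
have Lf : Lc f by rewrite -D0; case: (DR 0%N).
have [_ [f0 [lf0 ff0]]] := Lc_borel Lf.
apply/integrableP; split; first exact/measurable_EFinP.
move: lf0 => /integrableP[_]; rewrite (@integral_ae_eqT _ _ _ mu (fun x => `|f0 x|%:E) (fun x => `|orbit 0 0 x|%:E))//.
by have := aeI ff0 orbit0_ae; apply: aeS => x [<- <-].
Qed.

Lemma fcos_orbit0 n xi : fcos (orbit 0 n.+1) xi = - (`|xi| `^ alpha) * fcos (orbit 0 n) xi /\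
  fsin (orbit 0 n.+1) xi = - (`|xi| `^ alpha) * fsin (orbit 0 n) xi.
Proof.
have [D0 DR _] := hD; have [E1 E2] := riesz_fcos xi (DR n).
rewrite (funext (orbit0_iterate n)); case: n E1 E2 => [|n] E1 E2; last first.
  by rewrite (funext (orbit0_iterate n)).
by rewrite -(fcos_ae orbit0_ae) -(fsin_ae orbit0_ae) E1 E2 D0.
Qed.

Lemma average_orbit t s Y n x : 0 <= s -> sym_charfun P Y (charf t) ->
  average P Y (orbit s n) x = orbit (t + s) n x.
Proof.
move=> s0 cY; rewrite (average_banded x cY lc lr (@banded_cut _) (@banded_cut _) (multiplier_orbit n s0)).
by apply: synth_ext => xi; rewrite evolD !mulrA.
Qed.

Lemma L1_orbit t n : 0 <= t -> L1 mu (orbit t n).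
Proof.
move=> t0; have [Y cY] := law t0; have [C HC] := orbit_bounded n (lexx 0).
have := L1_average cY (L1_orbit0 n) HC.
by apply: L1_ext => x; rewrite (average_orbit n x (lexx 0) cY) addr0.
Qed.

Lemma Lc_orbit t n : 0 <= t -> Lc (orbit t n).
Proof.
by move=> t0; have [K HK] := orbit_lipschitz n t0; apply: (lipschitz_Lc HK); exact: L1_orbit.
Qed.

(** Evolving is averaging over translates, which multiplies all transforms by
    the same function. *)
Lemma riesz_orbit t n : 0 <= t -> is_riesz_derivative alpha (orbit t n) (orbit t n.+1).
Proof.
move=> t0; have [Y cY] := law t0.
have E k : average P Y (orbit 0 k) = orbit t k.
  by apply/funext => x; rewrite (average_orbit k x (lexx 0) cY) addr0.
have EC k xi : fcos (orbit t k) xi = charf t xi * fcos (orbit 0 k) xi.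
  have [C HC] := orbit_bounded k (lexx 0).
  by have := fcos_average cY (L1_orbit0 k) HC xi; rewrite E.
have ES k xi : fsin (orbit t k) xi = charf t xi * fsin (orbit 0 k) xi.
  have [C HC] := orbit_bounded k (lexx 0).
  by have := fsin_average cY (L1_orbit0 k) HC xi; rewrite E.
apply: riesz_of_fcos; [exact: Lc_orbit|exact: Lc_orbit| |] => xi; have [E1 E2] := fcos_orbit0 n xi.
  by rewrite EC EC E1 mulrCA.
by rewrite ES ES E2 mulrCA.
Qed.

Lemma frac_log_orbit t : 0 <= t ->
  is_frac_log rho^-1 (orbit t) (synth c r (fun xi => evol t xi * - ln (1 + symb xi / rho))).
Proof. by move=> t0; exact: (@frac_log_synth R alpha rho rho0 _ _ _ _ lc lr (multiplier_evol t0)). Qed.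

Lemma orbit_time_lipschitz s t x : 0 <= s -> 0 <= t ->
  `|orbit t 0 x - orbit s 0 x| <= psi_bound * `|t - s| * mass c r.
Proof.
move=> s0 t0; rewrite -(synthB x lc lr (multiplier_orbit 0 t0) (multiplier_orbit 0 s0)).
have -> : synth c r (fun xi => evol t xi * (- symb xi) ^+ 0 - evol s xi * (- symb xi) ^+ 0) x =
    synth c r (fun xi => evol t xi - evol s xi) x.
  by apply: synth_ext => xi; rewrite expr0 !mulr1.
exact: synth_le lc lr (evol_lipschitz s0 t0).
Qed.

(** Convergence of [orbit h 0] to [orbit 0 0] in mean, from uniform convergence
    and the fact that averaging does not increase the norm: this is Scheffe's
    argument, based on [|A - B| <= |A| - |B| + 2 min(|B|, |A - B|)]. *)
Lemma orbit_L1_start e : 0 < e -> exists2 dl, 0 < dl &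
  forall h, 0 <= h <= dl -> \int[mu]_x `|orbit h 0 x - orbit 0 0 x| <= e.
Proof.
move=> e0; pose g := orbit 0 0; pose M := psi_bound * mass c r.
have M0 : 0 <= M by rewrite mulr_ge0 ?psi_bound_ge0 ?mass_ge0.
have lg : L1 mu g := L1_orbit0 0.
have mg : measurable_fun setT g by exact: L1_measurableR.
pose mn b x : R := Num.min `|g x| b.
have mmn b : measurable_fun setT (mn b).
  apply: measurable_minr; last exact: measurable_cst.
  exact: measurableT_comp.
have lmn b : 0 <= b -> L1 mu (mn b).
  move=> b0; apply: (@L1_le _ _ _ mu _ (fun x => `|g x|)).
  - by have := mmn b.
  - exact: L1_norm.
  - by move=> x; rewrite ger0_norm ?le_min ?b0 ?normr_ge0// ge_min lexx.
have cv : \int[mu]_x mn (M / k.+1%:R) x @[k --> \oo] --> \int[mu]_x (0 : R).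
  apply: (@Rintegral_dominated _ _ _ mu _ _ (fun x => `|g x|)).
  - by move=> k; have := mmn (M / k.+1%:R).
  - exact: measurable_cst.
  - apply: aeW => x; apply/cvgrPdist_le => u u0.
    have d0 : 0 < u / (M + 1) by rewrite divr_gt0// ltr_wpDl.
    have [N _ HN] := near_infty_natSinv_lt (PosNum d0).
    exists N => // k /= Nk; rewrite sub0r normrN ger0_norm; last first.
      by rewrite le_min normr_ge0 divr_ge0.
    rewrite /mn ge_min; apply/orP; right.
    have {}HN : k.+1%:R^-1 < u / (M + 1) := HN k Nk.
    rewrite (@le_trans _ _ ((M + 1) * k.+1%:R^-1))//.
      by rewrite ler_wpM2r// lerDl.
    by rewrite mulrC -ler_pdivlMr ?ltr_wpDl// ltW.
  - exact: L1_norm.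
  - apply: aeW => x k; rewrite ger0_norm; last by rewrite le_min normr_ge0 divr_ge0.
    by rewrite ge_min lexx.
have e2 : 0 < e / 2 by rewrite divr_gt0.
move: cv => /cvgrPdist_le /(_ _ e2) [N _ /(_ N (leqnn N))].
rewrite (_ : \int[mu]_x (0 : R) = 0) ?sub0r ?normrN; last by rewrite /Rintegral integral0.
rewrite ger0_norm; last first.
  by apply: Rintegral_ge0 => x _; rewrite le_min normr_ge0 divr_ge0.
move=> small; exists N.+1%:R^-1; first by rewrite invr_gt0.
move=> h /andP[h0 hN]; pose u := orbit h 0.
have lu : L1 mu u := L1_orbit 0 h0.
have contraction : \int[mu]_x `|u x| <= \int[mu]_x `|g x|.
  have [Y cY] := law h0; have [C HC] := orbit_bounded 0 (lexx 0).
  have := average_norm_le cY lg HC; apply: le_trans.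
  rewrite le_eqVlt; apply/orP; left; apply/eqP; apply: eq_Rintegral => x _.
  by rewrite (average_orbit 0 x (lexx 0) cY) addr0.
have b0 : 0 <= M / N.+1%:R by rewrite divr_ge0.
have l1 := L1B (L1_norm lu) (L1_norm lg); have l2 := L1Z 2 (lmn _ b0).
have : \int[mu]_x `|u x - g x| <= \int[mu]_x (`|u x| - `|g x| + 2 * mn (M / N.+1%:R) x).
  apply: (le_Rintegral measurableT (L1_norm (L1B lu lg)) (L1D l1 l2)).
  move=> x _; have ug : `|u x - g x| <= M / N.+1%:R.
    rewrite (le_trans (orbit_time_lipschitz x (lexx 0) h0))// subr0 ger0_norm//.
    by rewrite mulrAC ler_wpM2l.
  exact: dist_le_min.
move=> /le_trans; apply.
rewrite (RintegralD measurableT l1 l2) (RintegralB measurableT (L1_norm lu) (L1_norm lg)).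
rewrite (RintegralZl _ measurableT (lmn _ b0)).
have -> : e = 0 + 2 * (e / 2) by field.
by apply: lerD; [rewrite subr_le0|rewrite ler_pM2l].
Qed.

Lemma orbit_L1_continuous e : 0 < e -> exists2 dl, 0 < dl &
  forall s t, 0 <= s -> 0 <= t -> `|t - s| <= dl -> \int[mu]_x `|orbit t 0 x - orbit s 0 x| <= e.
Proof.
move=> /orbit_L1_start[dl dl0 H]; exists dl => // s t s0 t0.
wlog st : s t s0 t0 / s <= t => [W|].
  have [st|/ltW ts] := leP s t; first exact: W.
  rewrite distrC => /(W _ _ t0 s0 ts) E; apply: le_trans E.
  by rewrite le_eqVlt; apply/orP; left; apply/eqP; apply: eq_Rintegral => x _; rewrite (distrC (orbit t 0 x)).
have ts0 : 0 <= t - s by rewrite subr_ge0.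
rewrite ger0_norm// => tsd.
have [Y cY] := law s0; have [C HC] := orbit_bounded 0 (lexx 0); have [C' HC'] := orbit_bounded 0 ts0.
have lB : L1 mu (fun x => orbit (t - s) 0 x - orbit 0 0 x) by apply: L1B; exact: L1_orbit.
have bB x : `|orbit (t - s) 0 x - orbit 0 0 x| <= C' + C.
  by rewrite (le_trans (ler_normB _ _))// lerD.
apply: le_trans (H (t - s) _); last by rewrite ts0.
apply: le_trans (average_norm_le cY lB bB).
rewrite le_eqVlt; apply/orP; left; apply/eqP; apply: eq_Rintegral => x _.
rewrite (averageB x cY (continuous_orbit (n := 0) ts0) (continuous_orbit (n := 0) (lexx 0)) HC' HC).
by rewrite (average_orbit 0 x ts0 cY) (average_orbit 0 x (lexx 0) cY) addr0 (addrC s) subrK.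
Qed.

Lemma orbitE t x : orbit t 0 x = synth c r (evol t) x.
Proof. by apply: synth_ext => xi; rewrite expr0 mulr1. Qed.

Lemma orbit_generator t x : 0 <= t ->
  a * orbit t 1 x + m * synth c r (fun xi => evol t xi * - ln (1 + symb xi / rho)) x =
  synth c r (fun xi => psi xi * evol t xi) x.
Proof.
move=> t0; have m1 := multiplier_orbit 1 t0.
have m2 := multiplierM (multiplier_evol t0) (multiplier_log alpha rho0).
rewrite /orbit -(synthZ a x lc lr m1) -(synthZ m x lc lr m2).
rewrite -(synthD x lc lr (multiplierZ a m1) (multiplierZ m m2)).
by apply: synth_ext => xi; rewrite /psi expr1; ring.
Qed.

Lemma orbit_derive t x : 0 < t -> forall e, 0 < e -> exists2 dl, 0 < dl & forall h, `|h| <= dl ->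
  0 < t + h /\ `|orbit (t + h) 0 x - orbit t 0 x -
     h * (a * orbit t 1 x + m * synth c r (fun xi => evol t xi * - ln (1 + symb xi / rho)) x)|
  <= e * `|h|.
Proof.
move=> t0 e e0; pose K := 2 * psi_bound ^+ 2 * mass c r.
have K0 : 0 <= K by rewrite mulr_ge0 ?mass_ge0// mulr_ge0// sqr_ge0.
pose dl := Num.min (t / 2) (Num.min (2^-1 / (psi_bound + 1)) (e / (K + 1))).
have p1 : 0 < psi_bound + 1 by rewrite ltr_wpDl// psi_bound_ge0.
have K1 : 0 < K + 1 by rewrite ltr_wpDl.
exists dl; first by rewrite !lt_min !divr_gt0// invr_gt0.
move=> h; rewrite !le_min => /andP[h1 /andP[h2 h3]].
have th0 : 0 < t + h by move: h1; rewrite ler_norml => /andP[h1 _]; lra.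
split => //; rewrite (orbit_generator x (ltW t0)) !orbitE.
have hp : `|h| * psi_bound <= 2^-1.
  by rewrite mulrC mul_small ?psi_bound_ge0.
rewrite (le_trans (synth_evol_remainder x lc lr (ltW t0) (ltW th0) hp))//.
rewrite mulrAC -/K -(real_normK (num_real h)) expr2 mulrA ler_wpM2r//.
exact: mul_small.
Qed.

Section Existence.
Variable X : R -> Omega -> R.
Hypotheses (X0 : {ae P, forall w, X 0 w = 0})
  (Xlaw : forall t, 0 < t -> exists Y, [/\ {ae P, forall w, X t w = Y w},
     sym_charfun P Y (charf t) &
     forall Q : R -> Prop, {ae mu, forall y, Q y} -> forall x, {ae P, forall w, Q (x - Y w)}]).
Local Notation u := (semigroup P X f).

Lemma semigroup0 x : u x 0 = f x.
Proof.
rewrite /semigroup fine_expectation -[RHS](@Rintegral_P_cst _ _ _ P (f x)).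
by apply: (@Rintegral_ae_eq _ _ _ P); apply: aeS X0 => w ->; rewrite subr0.
Qed.

(** As the law of [X t] charges no null set, [f] may be replaced by its
    continuous version. *)
Lemma semigroup_orbit t x : 0 < t -> u x t = orbit t 0 x.
Proof.
move=> t0; have [Y [XY cY null]] := Xlaw t0.
rewrite /semigroup fine_expectation -[t in RHS]addr0 -(average_orbit 0 x (lexx 0) cY).
apply: (@Rintegral_ae_eq _ _ _ P); have := aeI XY (null _ orbit0_ae x).
by apply: aeS => w [-> ->].
Qed.

Lemma semigroup_ae t : 0 <= t -> {ae mu, forall x, u x t = orbit t 0 x}.
Proof.
rewrite le_eqVlt => /orP[/eqP <-|t0]; last by apply: aeW => x; exact: semigroup_orbit.
by apply: aeS orbit0_ae => x <-; exact: semigroup0.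
Qed.

Theorem semigroup_solution : is_solution alpha a m rho f u.
Proof.
have uE t : 0 < t -> u ^~ t = orbit t 0 by move=> t0; apply/funext => x; exact: semigroup_orbit.
split.
- exact: semigroup0.
- move=> t; rewrite le_eqVlt => /orP[/eqP <-|t0]; last by rewrite uE//; exact: Lc_orbit (ltW t0).
  by have [D0 DR _] := hD; rewrite (funext semigroup0) -D0; case: (DR 0%N).
- by move=> t t0; rewrite uE//; exact: continuous_orbit (ltW t0).
- move=> s s0.
  have E t : 0 <= t -> (\int[mu]_x (`|u x t - u x s|%R)%:E)%E =
      (\int[mu]_x `|orbit t 0 x - orbit s 0 x|)%:E.
    move=> t0; rewrite EFin_Rintegral; last by apply/L1_norm/L1B; exact: L1_orbit.
    apply: (@integral_ae_eqT _ _ _ mu); have := aeI (semigroup_ae t0) (semigroup_ae s0).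
    by apply: aeS => x [-> ->].
  apply/fine_cvgP; split.
    by rewrite near_withinE; apply: nearW => t t0; rewrite E.
  apply/cvgrPdist_le => e e0; have [dl dl0 H] := orbit_L1_continuous e0.
  rewrite near_withinE; apply/nbhs_ballP; exists dl => //= t st t0.
  rewrite sub0r normrN E//= ger0_norm ?Rintegral_ge0//.
  by apply: H => //; rewrite distrC; exact: ltW.
move=> t t0; exists (orbit t), (synth c r (fun xi => evol t xi * - ln (1 + symb xi / rho))).
split.
- split; first by rewrite uE.
    by move=> n; exact: riesz_orbit (ltW t0).
  by move=> n; exact: continuous_orbit (ltW t0).
- exact: frac_log_orbit (ltW t0).
- move=> x; apply: is_derive_littleo => e e0; have [dl dl0 H] := orbit_derive x t0 e0.
  exists dl => // h hd; have [th0] := H h hd.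
  by rewrite !semigroup_orbit.
Qed.

End Existence.
End Orbit.

Section Uniqueness.
Variable w : R -> R -> R.
Local Notation c t := (bandcut (fcos (w t))).
Local Notation r t := (bandcut (fsin (w t))).
Local Notation dist s t := (\int[mu]_x `|w t x - w s x|).
Hypotheses (lw : forall t : R, 0 <= t -> L1 mu (w t))
  (w_cont : forall s : R, 0 <= s -> forall e : R, 0 < e -> exists2 dl : R, 0 < dl &
     forall t : R, 0 <= t -> `|t - s| < dl -> dist s t <= e)
  (w_rep : forall t : R, 0 < t -> forall x : R, w t x = synth (c t) (r t) (fun=> 1) x)
  (w_derive : forall t : R, 0 < t -> forall x : R,
     is_derive t 1 (w ^~ x) (synth (c t) (r t) psi x)).

Let lc t : 0 <= t -> L1 mu (c t).
Proof.
move=> t0; apply: (L1_cut alpha0 rho0 (measurable_fcos (lw t0))) => xi; exact: fcos_le (lw t0).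
Qed.

Let lr t : 0 <= t -> L1 mu (r t).
Proof.
move=> t0; apply: (L1_cut alpha0 rho0 (measurable_fsin (lw t0))) => xi; exact: fsin_le (lw t0).
Qed.

Let b := bandwidth alpha rho.
Let band : set R := `[- b, b]%classic.
Let B : R := pi^-1 * (2 * \int[mu]_xi \1_band xi).

Let B0 : 0 <= B.
Proof.
by rewrite mulr_ge0 ?invr_ge0 ?pi_ge0// mulr_ge0// Rintegral_ge0.
Qed.

Let fcosB s t xi : 0 <= s -> 0 <= t -> `|fcos (w t) xi - fcos (w s) xi| <= dist s t.
Proof.
move=> s0 t0; rewrite -(RintegralB measurableT (L1_cosM xi (lw t0)) (L1_cosM xi (lw s0))).
have := fcos_le xi (L1B (lw t0) (lw s0)); rewrite /fcos.
by under eq_Rintegral do rewrite mulrBr.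
Qed.

Let fsinB s t xi : 0 <= s -> 0 <= t -> `|fsin (w t) xi - fsin (w s) xi| <= dist s t.
Proof.
move=> s0 t0; rewrite -(RintegralB measurableT (L1_sinM xi (lw t0)) (L1_sinM xi (lw s0))).
have := fsin_le xi (L1B (lw t0) (lw s0)); rewrite /fsin.
by under eq_Rintegral do rewrite mulrBr.
Qed.

Let bandcut_dist (h k : R -> R) (D xi : R) : 0 <= D -> `|h xi - k xi| <= D ->
  `|bandcut h xi - bandcut k xi| <= D * \1_band xi.
Proof.
move=> D0 hk; rewrite /bandcut; case: ifP => [/andP[_ /(inband_le alpha0 rho0) xib]|_].
  suff -> : \1_band xi = 1 :> R by rewrite mulr1.
  by rewrite indicE mem_set// /band /= in_itv/= -ler_norml.
by rewrite subr0 normr0 mulr_ge0// indicE.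
Qed.

Let dist_ge0 s t : 0 <= dist s t. Proof. by rewrite Rintegral_ge0. Qed.

(** On a bounded band, convergence in mean controls the spectra in mean. *)
Let mass_dist s t : 0 <= s -> 0 <= t ->
  mass (fun xi => c t xi - c s xi) (fun xi => r t xi - r s xi) <= B * dist s t.
Proof.
move=> s0 t0; rewrite /mass /B -[leRHS]mulrA ler_wpM2l ?invr_ge0 ?pi_ge0//.
have lI : L1 mu (\1_band : R -> R) by exact: (integrable_indic_itv _ _ true false).
have -> : 2 * \int[mu]_xi \1_band xi * dist s t = \int[mu]_xi (2 * dist s t * \1_band xi).
  by rewrite (RintegralZl _ measurableT lI) mulrAC.
apply: (le_Rintegral measurableT (L1D (L1_norm (L1B (lc t0) (lc s0))) (L1_norm (L1B (lr t0) (lr s0)))) (L1Z _ lI)).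
move=> xi _; rewrite -mulrA mulr_natl mulr2n lerD// bandcut_dist ?dist_ge0//.
  exact: fcosB.
exact: fsinB.
Qed.

Let synth_dist s t e C y : 0 <= s -> 0 <= t -> multiplier e C ->
  `|synth (c t) (r t) e y - synth (c s) (r s) e y| <= C * (B * dist s t).
Proof.
move=> s0 t0 me; rewrite -(synth_specB y (lc t0) (lr t0) (lc s0) (lr s0) me).
apply: le_trans (synth_le y (L1B (lc t0) (lc s0)) (L1B (lr t0) (lr s0)) me) _.
by rewrite ler_wpM2l ?mass_dist// (multiplier_ge0 me).
Qed.

Let G t x := synth (c t) (r t) psi x.

Let w_MVT (p q : R) x : 0 < p -> p < q -> exists2 th, p <= th <= q & w q x - w p x = G th x * (q - p).
Proof.
move=> p0 pq; have [| |th] := @MVT R (w ^~ x) (fun t => G t x) p q pq.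
- by move=> t; rewrite in_itv/= => /andP[pt _]; apply: w_derive; exact: lt_trans pt.
- apply: derivable_within_continuous => t; rewrite in_itv/= => /andP[pt _].
  by have [] := w_derive (lt_le_trans p0 pt) x.
by rewrite in_itv/= => /andP[h1 h2] E; exists th => //; rewrite !ltW.
Qed.

(** The mean value theorem in time, for the rate of change: by [synth_dist] it
    depends continuously on time, uniformly in space. *)
Let w_increment t : 0 < t -> forall e, 0 < e -> exists2 dl, 0 < dl & forall h, `|h| < dl ->
  0 < t + h /\ forall x, `|w (t + h) x - w t x - h * G t x| <= e * `|h|.
Proof.
move=> t0 e e0; have K0 := psi_bound_ge0.
have KB : 0 < psi_bound * B + 1 by rewrite ltr_wpDl// mulr_ge0.
have e1 : 0 < e / (psi_bound * B + 1) by exact: divr_gt0.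
have [dl dl0 H] := w_cont (ltW t0) e1.
exists (Num.min dl t); first by rewrite lt_min dl0.
move=> h; rewrite lt_min => /andP[hd ht].
have th0 : 0 < t + h by move: ht; rewrite ltr_norml => /andP[h1 _]; lra.
split => // x.
have near_t th : 0 <= th -> `|th - t| < dl -> `|G th x - G t x| <= e.
  move=> th1 tht; rewrite (le_trans (synth_dist x (ltW t0) th1 multiplier_psi))//.
  by rewrite mulrA; apply: mul_small; [exact: mulr_ge0|exact: dist_ge0|exact: H].
have [hneg|hpos|->] := ltgtP h 0; last by rewrite addr0 subrr mul0r subr0 normr0 mulr0.
  have [|th /andP[th1 th2] E] := @w_MVT (t + h) t x th0; first by lra.
  have -> : w (t + h) x - w t x - h * G t x = (G th x - G t x) * h.
    apply: increment_error.
    by rewrite -[w (t + h) x - w t x]opprB E opprD addNKr mulrN opprK.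
  rewrite normrM ler_wpM2r// near_t//; first by apply: le_trans th1; exact: ltW.
  by apply: le_lt_trans hd; rewrite !ler0_norm; lra.
have [|th /andP[th1 th2] E] := @w_MVT t (t + h) x t0; first by lra.
have -> : w (t + h) x - w t x - h * G t x = (G th x - G t x) * h.
  by apply: increment_error; rewrite E (addrC t) addrK.
rewrite normrM ler_wpM2r// near_t//; first by apply: le_trans th1; exact: ltW.
by apply: le_lt_trans hd; rewrite !ger0_norm; lra.
Qed.

Variable T : R.
Hypothesis T0 : 0 < T.
(* The solution at time [t], evolved for the remaining time [T - t]. *)
Let N y t := synth (c t) (r t) (evol (T - t)) y.

Let N_cont y s : 0 <= s <= T -> forall e, 0 < e -> exists2 dl, 0 < dl &
  forall t, 0 <= t <= T -> `|t - s| < dl -> `|N y t - N y s| <= e.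
Proof.
move=> /andP[s0 sT] e e0.
have B1 : 0 < B + 1 by rewrite ltr_wpDl.
pose M := psi_bound * mass (c s) (r s).
have M0 : 0 <= M by rewrite mulr_ge0 ?psi_bound_ge0 ?mass_ge0.
have M1 : 0 < M + 1 by rewrite ltr_wpDl.
have e1 : 0 < e / 2 / (B + 1) by rewrite !divr_gt0.
have [dl dl0 H] := w_cont s0 e1.
exists (Num.min dl (e / 2 / (M + 1))); first by rewrite lt_min dl0 !divr_gt0.
move=> t /andP[t0 tT]; rewrite lt_min => /andP[td te].
have Tt : 0 <= T - t by rewrite subr_ge0.
have Ts : 0 <= T - s by rewrite subr_ge0.
rewrite -(subrKA (synth (c s) (r s) (evol (T - t)) y)) (le_trans (ler_normD _ _))//.
have -> : e = e / 2 + e / 2 by field.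
apply: lerD.
  rewrite (le_trans (synth_dist y s0 t0 (multiplier_evol Tt)))// mul1r.
  by apply: mul_small; [exact: B0|exact: dist_ge0|exact: H].
rewrite -(synthB y (lc s0) (lr s0) (multiplier_evol Tt) (multiplier_evol Ts)).
rewrite (le_trans (synth_le y (lc s0) (lr s0) (evol_lipschitz Ts Tt)))//.
have -> : T - t - (T - s) = - (t - s) by ring.
by rewrite normrN mulrAC -/M; apply: mul_small => //; exact: ltW.
Qed.

(** The increment of [w] over [[t, t + h]], known up to a small error uniform in
    space, is averaged over the law at time [T - t - h]; the error stays small,
    and the rate of change of [w] cancels that of the multiplier. *)
Let N_derive y t : 0 < t < T -> is_derive t 1 (N y) 0.
Proof.
move=> /andP[t0 tT]; apply: is_derive_littleo => e e0.
have K0 := psi_bound_ge0; have p1 : 0 < psi_bound + 1 by rewrite ltr_wpDl.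
pose M := 2 * psi_bound ^+ 2 * mass (c t) (r t).
have M0 : 0 <= M by rewrite mulr_ge0 ?mass_ge0// mulr_ge0// sqr_ge0.
have M1 : 0 < M + 1 by rewrite ltr_wpDl.
have e2 : 0 < e / 2 by rewrite divr_gt0.
have [dl dl0 H] := w_increment t0 e2.
pose dl' := Num.min (dl / 2) (Num.min ((T - t) / 2) (Num.min (2^-1 / (psi_bound + 1)) (e / 2 / (M + 1)))).
exists dl'; first by rewrite !lt_min !divr_gt0 ?subr_gt0 ?invr_gt0.
move=> h; rewrite !le_min => /andP[h1 /andP[h2 /andP[h3 h4]]].
have [|th0 Hh] := H h; first by lra.
have tau0 : 0 <= T - (t + h) by move: h2; rewrite ler_norml => /andP[_ h2]; lra.
set tau := T - (t + h) in tau0.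
have [Y cY] := law tau0.
have ltt := lc (ltW t0); have rtt := lr (ltW t0).
have lth := lc (ltW th0); have rth := lr (ltW th0).
have m1 := multiplier_cst (1 : R).
have mh := multiplierD m1 (multiplierZ h multiplier_psi).
have E1 := average_banded y cY lth rth (@banded_cut _) (@banded_cut _) m1.
have E2 := average_banded y cY ltt rtt (@banded_cut _) (@banded_cut _) mh.
have [K1 HK1] := synth_banded_lipschitz lth rth m1.
have [K2 HK2] := synth_banded_lipschitz ltt rtt mh.
have c1 := lipschitz_continuous HK1; have c2 := lipschitz_continuous HK2.
have E3 := averageB y cY c1 c2 (fun x => synth_le x lth rth m1) (fun x => synth_le x ltt rtt mh).
have small x : `|synth (c (t + h)) (r (t + h)) (fun=> 1) x -
    synth (c t) (r t) (fun xi => 1 + h * psi xi) x| <= e / 2 * `|h|.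
  rewrite (synthD x ltt rtt m1 (multiplierZ h multiplier_psi)) (synthZ h x ltt rtt multiplier_psi).
  by rewrite -(w_rep th0) -(w_rep t0) opprD addrA.
have S1 : `|N y (t + h) - synth (c t) (r t) (fun xi => evol tau xi * (1 + h * psi xi)) y| <= e / 2 * `|h|.
  have -> : N y (t + h) = synth (c (t + h)) (r (t + h)) (fun xi => evol tau xi * 1) y.
    by apply: synth_ext => xi; rewrite mulr1.
  rewrite -E1 -E2 -E3; apply: (average_sup y cY _ small).
  by move=> x; apply: cvgB; [exact: c1|exact: c2].
have S2 : `|synth (c t) (r t) (fun xi => evol tau xi * (1 + h * psi xi)) y - N y t| <= e / 2 * `|h|.
  have Tt : T - t = tau + h by rewrite /tau; ring.
  have tau1 : 0 <= tau + h by rewrite -Tt subr_ge0 ltW.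
  have hp : `|h| * psi_bound <= 2^-1.
    by rewrite mulrC mul_small.
  have := synth_evol_remainder y ltt rtt tau0 tau1 hp.
  have mpe := multiplierM multiplier_psi (multiplier_evol tau0).
  have -> : synth (c t) (r t) (fun xi => evol tau xi * (1 + h * psi xi)) y =
      synth (c t) (r t) (evol tau) y + h * synth (c t) (r t) (fun xi => psi xi * evol tau xi) y.
    rewrite -(synthZ h y ltt rtt mpe) -(synthD y ltt rtt (multiplier_evol tau0) (multiplierZ h mpe)).
    by apply: synth_ext => xi; ring.
  rewrite /N Tt -addrA -opprD distrC => /le_trans; apply.
  rewrite mulrAC -/M -(real_normK (num_real h)) expr2 mulrA ler_wpM2r//.
  exact: mul_small.
rewrite mulr0 subr0 -(subrKA (synth (c t) (r t) (fun xi => evol tau xi * (1 + h * psi xi)) y)).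
rewrite (le_trans (ler_normD _ _))// (_ : e * `|h| = e / 2 * `|h| + e / 2 * `|h|); first exact: lerD.
by field.
Qed.

Let N_within y : {within `[0, T], continuous (N y)}.
Proof.
apply/continuous_within_itvP => //; split.
- move=> t; rewrite in_itv/= => tT; have [/derivable1_diffP/differentiable_continuous] := N_derive y tT.
  by [].
- apply/cvgrPdist_le => e e0; have [|dl dl0 H] := @N_cont y 0 _ e e0; first by rewrite lexx ltW.
  near=> t; rewrite distrC; apply: H.
    by apply/andP; split; near: t; [exact: nbhs_right_ge|exact: nbhs_right_le].
  have t0 : 0 <= t by near: t; exact: nbhs_right_ge.
  by rewrite subr0 ger0_norm//; near: t; exact: nbhs_right_lt.
- apply/cvgrPdist_le => e e0; have [|dl dl0 H] := @N_cont y T _ e e0; first by rewrite lexx ltW.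
  near=> t; rewrite distrC; apply: H.
    by apply/andP; split; near: t; [exact: nbhs_left_ge|exact: nbhs_left_le].
  have tT : t <= T by near: t; exact: nbhs_left_le.
  have : T - dl < t by near: t; apply: nbhs_left_gt; rewrite gtrBl.
  by rewrite ler0_norm ?subr_le0//; lra.
Unshelve. all: by end_near. Qed.

Lemma evolution_unique y : w T y = synth (c 0) (r 0) (evol T) y.
Proof.
have [|th _] := @MVT R (N y) (fun=> 0) 0 T T0 _ (@N_within y).
  by move=> t; rewrite in_itv/=; exact: N_derive.
rewrite mul0r => /eqP; rewrite subr_eq0 => /eqP; rewrite /N subr0 subrr => <-.
by rewrite (w_rep T0); apply: synth_ext => xi; rewrite evol0.
Qed.

End Uniqueness.
Theorem solution_unique f Pf Df u : riesz_iterates alpha f Df -> is_frac_log rho^-1 Df Pf ->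
  is_solution alpha a m rho f u -> forall T : R, 0 < T -> forall y : R, u y T = orbit f T 0 y.
Proof.
move=> [D0 DR DC] hP [u0 uLc ucont uL1 uder] T T0 y.
have Lf : Lc f by rewrite -D0; case: (DR 0%N).
have [_ [f0 [lf0 ff0]]] := Lc_borel Lf.
pose w (t x : R) := if 0 < t then u x t else f0 x.
have wE t : 0 < t -> w t = u ^~ t by move=> t0; apply/funext => x; rewrite /w t0.
have w0 : w 0 = f0 by apply/funext => x; rewrite /w ltxx.
have lw (t : R) : 0 <= t -> L1 mu (w t).
  rewrite le_eqVlt => /orP[/eqP <-|t0]; first by rewrite w0.
  rewrite wE//; apply: Lc_L1; first exact: uLc (ltW t0).
  exact: continuous_measurable_fun (ucont t t0).
have wae (t : R) : 0 <= t -> {ae mu, forall x, u x t = w t x}.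
  rewrite le_eqVlt => /orP[/eqP <-|t0]; last by rewrite wE//; exact: aeW.
  by rewrite w0; apply: aeS ff0 => x; rewrite u0.
have w_cont (s : R) : 0 <= s -> forall e : R, 0 < e -> exists2 dl : R, 0 < dl &
    forall t : R, 0 <= t -> `|t - s| < dl -> \int[mu]_x `|w t x - w s x| <= e.
  move=> s0 e e0.
  have E (t : R) : 0 <= t -> (\int[mu]_x (`|u x t - u x s|%R)%:E)%E = (\int[mu]_x `|w t x - w s x|)%:E.
    move=> t0; rewrite (EFin_Rintegral (L1_norm (L1B (lw t t0) (lw s s0)))).
    apply: (@integral_ae_eqT _ _ _ mu); have := aeI (wae t t0) (wae s s0).
    by apply: aeS => x [-> ->].
  have /fine_cvgP[_ /cvgrPdist_le /(_ e e0)] := uL1 s s0.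
  rewrite near_withinE => /nbhs_ballP[dl dl0 H]; exists dl => // t t0 ts.
  have := H t; rewrite /ball /= distrC => /(_ ts t0).
  by rewrite E//= sub0r normrN ger0_norm// Rintegral_ge0.
have w_rep (t : R) : 0 < t -> forall x : R,
    w t x = synth (bandcut (fcos (w t))) (bandcut (fsin (w t))) (fun=> 1) x.
  move=> t0 x; have [Du [Pu [hD' hP' _]]] := uder t t0.
  have [_ _ rep _] := spectral_representation alpha0 rho0 hD' hP'.
  by rewrite wE// -rep//; exact: ucont.
have w_derive (t : R) : 0 < t -> forall x : R, is_derive t 1 (w ^~ x)
    (synth (bandcut (fcos (w t))) (bandcut (fsin (w t))) psi x).
  move=> t0 x; have [Du [Pu [hD' hP' du]]] := uder t t0.
  have [[lc lr] rep _ repP] := spectral_representation alpha0 rho0 hD' hP'.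
  rewrite wE//; have -> : synth (bandcut (fcos (u ^~ t))) (bandcut (fsin (u ^~ t))) psi x =
      a * Du 1%N x + m * Pu x.
    rewrite rep repP -(synthZ a x lc lr (multiplier_symbN 1)) -(synthZ m x lc lr (multiplier_log alpha rho0)).
    rewrite -(synthD x lc lr (multiplierZ a (multiplier_symbN 1)) (multiplierZ m (multiplier_log alpha rho0))).
    by apply: synth_ext => xi; rewrite /psi expr1; ring.
  apply: near_eq_is_derive (du x); near=> s; rewrite /w ifT//.
  by near: s; exact: (cvgr_gt t cvg_id).
have := evolution_unique lw w_cont w_rep w_derive T0 y.
rewrite (wE T T0) w0 => ->; rewrite orbitE.
by rewrite (fcos_ae ff0) (fsin_ae ff0).
Unshelve. all: by end_near. Qed.

End Evolution.
End Generator.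

Theorem theorem12 (R : realType) (d : measure_display)
  (Omega : measurableType d) (P : probability Omega R)
  (alpha a mu rho : R)
  (halpha : 0 < alpha <= 2) (ha : 0 <= a) (hmu : 0 < mu) (hrho : 0 < rho)
  (S Gam : R -> {RV P >-> R})
  (hS : symmetric_stable_process alpha S)
  (hGam : gamma_subordinator mu rho Gam)
  (hindep : independent_processes S Gam)
  (f : R -> R) (hf : Lc f)
  (Df : nat -> R -> R) (hDf : riesz_iterates alpha f Df)
  (hPf : exists Pf : R -> R, is_frac_log rho^-1 Df Pf) :
  is_solution alpha a mu rho f (semigroup P (subordinated a S Gam) f) /\
  (forall u : R -> R -> R, is_solution alpha a mu rho f u ->
     forall x t : R, 0 <= t -> u x t = semigroup P (subordinated a S Gam) f x t).
Proof.
have /andP[alpha0 _] := halpha; have [Pf hP] := hPf.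
have law t (t0 : 0 <= t) := subordinated_law alpha0 ha hrho hS hGam hindep t0.
have charf_law (t : R) : 0 <= t -> exists Y, sym_charfun P Y (charf alpha a mu rho t).
  by move=> /law[Y [_ cY _]]; exists Y.
have X0 := subordinated_time0 a hS hGam.
have Xlaw (t : R) : 0 < t -> exists Y, [/\ {ae P, forall w, subordinated a S Gam t w = Y w},
     sym_charfun P Y (charf alpha a mu rho t) &
     forall Q : R -> Prop, {ae @lebesgue_measure R, forall y, Q y} ->
       forall x, {ae P, forall w, Q (x - Y w)}].
  move=> t0; have [Y [XY cY null]] := law t (ltW t0).
  by exists Y; split => //; exact: null.
split.
  by have := semigroup_solution alpha0 ha hmu hrho charf_law hDf hP X0 Xlaw.
move=> u hu x t; rewrite le_eqVlt => /orP[/eqP <-|t0].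
  by have [-> _ _ _ _] := hu; rewrite (semigroup0 _ X0).
rewrite (solution_unique alpha0 ha hmu hrho charf_law hDf hP hu t0).
by rewrite (semigroup_orbit alpha0 ha hmu hrho hDf hP Xlaw).
Qed.
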